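(* Suppose that $T$ is NIP, $G$ is abelian, and $G(M)$ contains a representative of each coset of $G^{00}(\mathcal{U})$ in $G(\mathcal{U})$. Let $I$ be a minimal left ideal of $(S_G^{\mathrm{fs}}(\mathcal{U},M),* )$ contained in $F_M(\mathcal{F}_r)$, let $u\in I$ be an idempotent, and let $t\in\mathcal{F}_r$ with $F_M(t)=u$. Then: (1) $F_M|_{t*S_G^{\mathrm{inv}}(\mathcal{U},M)}\colon t*S_G^{\mathrm{inv}}(\mathcal{U},M)\to u*I$ is an isomorphism of Ellis subgroups; (2) $K_M|_{t^{-1}*S_G^{\mathrm{inv}}(\mathcal{U},M)}\colon t^{-1}*S_G^{\mathrm{inv}}(\mathcal{U},M)\to u*I$ is an isomorphism of Ellis subgroups.
   Context: $\mathcal{U}$ monster model of $T$, $M\prec\mathcal{U}$ small, $G$ a group definable over $\emptyset$. $S_G^{\mathrm{inv}}(\mathcal{U},M)$ (resp. $S_G^{\mathrm{fs}}(\mathcal{U},M)$): global types on $G$ which are $M$-invariant (resp. finitely satisfiable in $M$). Newelski product: $\varphi(x,d)\in p*q$ iff $\varphi(x\cdot b,d)\in p$ where $b\models q|_{Md}$. Right translate: $\varphi(x)\in p\cdot c\iff\varphi(x\cdot c)\in p$. $p^{-1}=\mathrm{tp}(a^{-1}/\mathcal{U})$ for $a\models p$. $\mathcal{F}_r$: types in $S_G^{\mathrm{inv}}(\mathcal{U},M)$ which are strong right $f$-generic over $M$ (all right translates by elements of $G(\mathcal{U})$ are $M$-invariant). $G^{00}(\mathcal{U})$: smallest type-definable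 subgroup of bounded index. Ellis subgroup: $u*I$, $I$ a minimal left ideal, $u\in I$ idempotent. Retraction $F_M$ (NIP): add predicate $\mathbf{P}$ for $M$, take a $|\mathcal{U}|^+$-saturated $(N',N)\succ(\mathcal{U},M)$; for $M$-invariant $p$ let $p|_N$ be the restriction to $N$ of its $M$-invariant extension to $N'$; $\theta(x,b)\in F_M(p)$ iff $\{\theta(x,b),\mathbf{P}(x)\}\cup p|_N$ is consistent. $K_M(p):=F_M(p^{-1})$. *)

(* Defs.v *)
From mathcomp Require Import all_boot.
From mathcomp Require Import boolp classical_sets functions cardinality.

Set Implicit Arguments.
Unset Strict Implicit.
Unset Printing Implicit Defensive.

Local Open Scope classical_set_scope.
Local Open Scope card_scope.

Record language := Language {
  fsym : Type; farity : fsym -> nat;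
  rsym : Type; rarity : rsym -> nat }.

(* [V] is the type of free variables. A binder adds the variable [None]. *)
Inductive term (L : language) (V : Type) : Type :=
| tvar of V
| tapp (f : fsym L) of ('I_(farity f) -> term L V).

Inductive formula (L : language) (V : Type) : Type :=
| feq of term L V & term L V
| frel (r : rsym L) of ('I_(rarity r) -> term L V)
| fnot of formula L V
| fand of formula L V & formula L V
| fex of formula L (option V).

Arguments tvar {L V}.
Arguments feq {L V}.
Arguments fnot {L V}.
Arguments fand {L V}.
Arguments fex {L V}.

Record structure (L : language) := Structure {
  dom :> Type;
  dom_inhabited : inhabited dom;
  fint : forall f : fsym L, ('I_(farity f) -> dom) -> dom;
  rint : forall r : rsym L, ('I_(rarity r) -> dom) -> Prop }.

Fixpoint tmap L (V W : Type) (h : V -> W) (s : term L V) : term L W :=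
  match s with
  | tvar v => tvar (h v)
  | tapp f args => tapp (fun k => tmap h (args k))
  end.

Fixpoint fmap L (V W : Type) (h : V -> W) (phi : formula L V) : formula L W :=
  match phi with
  | feq s1 s2 => feq (tmap h s1) (tmap h s2)
  | frel r args => frel (fun k => tmap h (args k))
  | fnot psi => fnot (fmap h psi)
  | fand psi1 psi2 => fand (fmap h psi1) (fmap h psi2)
  | fex psi => fex (fmap (omap h) psi)
  end.

Fixpoint teval L (A : structure L) (V : Type) (e : V -> A) (s : term L V) : A :=
  match s with
  | tvar v => e v
  | tapp f args => fint (fun k => teval e (args k))
  end.

Definition econs (V X : Type) (a : X) (e : V -> X) (v : option V) : X :=
  if v is Some w then e w else a.

Fixpoint sat L (A : structure L) (V : Type) (e : V -> A) (phi : formula L V) : Prop :=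
  match phi with
  | feq s1 s2 => teval e s1 = teval e s2
  | frel r args => rint (fun k => teval e (args k))
  | fnot psi => ~ sat e psi
  | fand psi1 psi2 => sat e psi1 /\ sat e psi2
  | fex psi => exists a, sat (econs a e) psi
  end.

Definition esum (V W X : Type) (a : V -> X) (e : W -> X) (s : V + W) : X :=
  match s with inl v => a v | inr w => e w end.

Definition smap (V V' W W' : Type) (h : V -> V') (k : W -> W') (s : V + W) : V' + W' :=
  match s with inl v => inl (h v) | inr w => inr (k w) end.

(* The formula  exists x_0 ... x_(n-1), phi(x, v). *)
Fixpoint fexn L n (V : Type) : formula L ('I_n + V) -> formula L V :=
  match n with
  | 0 => fmap (fun s : 'I_0 + V =>
           match s with
           | inl k => False_rect V (notF (valP k))
           | inr v => v
           end)
  | m.+1 => fun phi => fex (fexn (fmap (fun s : 'I_m.+1 + V =>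
           match s with
           | inl k => if unlift ord0 k is Some k' then inl k' else inr None
           | inr v => inr (Some v)
           end) phi))
  end.

Lemma teval_map L (A : structure L) (V W : Type) (h : V -> W) (e : W -> A) s :
  teval e (tmap h s) = teval (e \o h) s.
Proof.
by elim: s => [//|f args IH] /=; congr fint; apply: funext => k; apply: IH.
Qed.

Lemma sat_fmap L (A : structure L) (V W : Type) (h : V -> W) (e : W -> A) phi :
  sat e (fmap h phi) = sat (e \o h) phi.
Proof.
elim: phi W h e => [{}V s1 s2|{}V r args|{}V psi IH|{}V p1 IH1 p2 IH2|{}V psi IH]
  W h e /=.
- by rewrite !teval_map.
- by congr rint; apply: funext => k; rewrite teval_map.
- by rewrite IH.
- by rewrite IH1 IH2.
- apply: eq_exists => a; rewrite IH; congr sat.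
  by apply: funext => -[v|].
Qed.

Lemma sat_fexn L (A : structure L) n (V : Type) (e : V -> A) (phi : formula L ('I_n + V)) :
  sat e (fexn phi) <-> exists a : 'I_n -> A, sat (esum a e) phi.
Proof.
elim: n V e phi => [|n IH] V e phi /=.
  rewrite sat_fmap; split=> [h|[a h]].
    exists (fun k : 'I_0 => False_rect A (notF (valP k))); move: h.
    by congr sat; apply: funext => -[[]|].
  by move: h; congr sat; apply: funext => -[[]|].
split=> [[a0 /IH[a]]|[a h]].
  rewrite sat_fmap => h.
  exists (fun k => if unlift ord0 k is Some k' then a k' else a0).
  by move: h; congr sat; apply: funext => -[k|v] //=; case: unlift.
exists (a ord0); apply/IH; exists (a \o lift ord0); rewrite sat_fmap.
move: h; congr sat; apply: funext => -[k|v] //=.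
by case: unliftP => [k' ->|->].
Qed.

Definition theory (L : language) := set (formula L void).

Definition model_of L (T : theory L) (A : structure L) :=
  forall phi, T phi -> sat (fun v : void => match v return A with end) phi.

Definition elementary L (A B : structure L) (j : A -> B) :=
  forall k (phi : formula L 'I_k) (e : 'I_k -> A),
    sat e phi <-> sat (j \o e) phi.

Definition automorphism L (A : structure L) (s : A -> A) :=
  [/\ bijective s,
      forall (f : fsym L) (a : 'I_(farity f) -> A), s (fint a) = fint (s \o a)
    & forall (r : rsym L) (a : 'I_(rarity r) -> A), rint a <-> rint (s \o a)].

(* L(A)-formulas in n free variables: an element of A occurring as a
   variable is a parameter. *)
Definition pformula L (A : structure L) n := formula L ('I_n + A).

Definition psat L (A : structure L) n (a : 'I_n -> A) (phi : pformula A n) :=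
  sat (esum a id) phi.

(* phi(x, d) for phi(x, y) without parameters. *)
Definition inst L (A : structure L) n k (phi : formula L ('I_n + 'I_k))
  (d : 'I_k -> A) : pformula A n := fmap (smap id d) phi.

Definition over L (A : structure L) n (B : set A) (phi : pformula A n) :=
  exists k (psi : formula L ('I_n + 'I_k)) (d : 'I_k -> A),
    (forall l, B (d l)) /\ phi = inst psi d.

Definition noparam L (A : structure L) n (phi : formula L 'I_n) :
  pformula A n := fmap inl phi.

Definition pmap L (A B : structure L) n (j : A -> B) (phi : pformula A n) :
  pformula B n := fmap (smap id j) phi.

(* Consistency is relative to the elementary diagram of A, that is, finite
   satisfiability in A. *)
Definition consistent L (A : structure L) n (S : set (pformula A n)) :=
  forall S0, finite_set S0 -> S0 `<=` S ->
    exists a : 'I_n -> A, forall phi, S0 phi -> psat a phi.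

Definition saturated L (A : structure L) (small : set A -> Prop) :=
  forall (B : set A) n (S : set (pformula A n)),
    small B -> S `<=` over B -> consistent S ->
    exists a : 'I_n -> A, forall phi, S phi -> psat a phi.

Definition card_lt (X Y : Type) (A : set X) (B : set Y) := A #<= B /\ ~ (B #<= A).

Definition partial_elementary L (A : structure L) (B : set A) (f : A -> A) :=
  forall k (phi : formula L 'I_k) (d : 'I_k -> A),
    (forall l, B (d l)) -> (sat d phi <-> sat (f \o d) phi).

Definition strongly_homogeneous L (A : structure L) (small : set A -> Prop) :=
  forall (B : set A) (f : A -> A), small B -> partial_elementary B f ->
    exists2 s, automorphism s & forall b, B b -> s b = f b.

(* The cardinal kappa is represented by a type of that cardinality. *)
Definition strong_limit (kappa : Type) :=
  forall S : set kappa, card_lt S [set: kappa] ->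
    card_lt [set X | X `<=` S] [set: kappa].

Definition kappa_small (kappa X : Type) (B : set X) := card_lt B [set: kappa].

(* [formula L nat] has cardinality |L| + aleph_0, that is, |T|. *)
Definition monster L (kappa : Type) (U : structure L) :=
  [/\ strong_limit kappa,
      card_lt [set: formula L nat] [set: kappa],
      saturated (kappa_small kappa (X := U))
    & strongly_homogeneous (kappa_small kappa (X := U))].

Definition has_IP L (A : structure L) n m (phi : formula L ('I_n + 'I_m)) :=
  exists (a : nat -> 'I_n -> A) (b : set nat -> 'I_m -> A),
    forall l S, sat (esum (a l) (b S)) phi <-> S l.

Definition NIP L (T : theory L) :=
  forall A : structure L, model_of T A ->
  forall n m (phi : formula L ('I_n + 'I_m)), ~ has_IP A phi.

Definition is_group (X : Type) (op : X -> X -> X) (E : set X) :=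
  [/\ forall x y, E x -> E y -> E (op x y),
      forall x y z, E x -> E y -> E z -> op (op x y) z = op x (op y z)
    & exists e, [/\ E e, forall x, E x -> op e x = x /\ op x e = x
      & forall x, E x -> exists y, [/\ E y, op x y = e & op y x = e]]].

Definition group_isomorphism (X Y : Type) (opX : X -> X -> X) (opY : Y -> Y -> Y)
    (E : set X) (E' : set Y) (f : X -> Y) :=
  [/\ is_group opX E, is_group opY E', set_bij E E' f
    & forall x y, E x -> E y -> f (opX x y) = opY (f x) (f y)].

Definition left_ideal (X : Type) (op : X -> X -> X) (S I : set X) :=
  [/\ I !=set0, I `<=` S & forall x y, S x -> I y -> I (op x y)].

Definition minimal_left_ideal (X : Type) (op : X -> X -> X) (S I : set X) :=
  left_ideal op S I /\ forall J, left_ideal op S J -> J `<=` I -> J = I.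

Definition ellis_subgroup (X : Type) (op : X -> X -> X) (S E : set X) :=
  exists I u, [/\ minimal_left_ideal op S I, I u, op u u = u & E = op u @` I].

(* A domain together with the graphs of multiplication and inversion, all
   without parameters, on n-tuples. *)
Record group_formulas L := GroupFormulas {
  gdim : nat;
  gdom : formula L 'I_gdim;
  gmul : formula L (('I_gdim + 'I_gdim) + 'I_gdim);
  ginv : formula L ('I_gdim + 'I_gdim) }.

Definition tuples L (G : group_formulas L) (A : structure L) :=
  'I_(gdim G) -> A.

Definition Gpts L (G : group_formulas L) (A : structure L) :
  set (tuples G A) := [set a | sat a (gdom G)].

(* The default value [a] is irrelevant on G when [definable_group G A]. *)
Definition gop L (G : group_formulas L) (A : structure L) (a b : tuples G A) :
  tuples G A :=
  xget (a : {classic (tuples G A)})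
    [set c | Gpts c /\ sat (esum (esum a b) c) (gmul G)].

Definition gopp L (G : group_formulas L) (A : structure L) (a : tuples G A) :
  tuples G A :=
  xget (a : {classic (tuples G A)})
    [set c | Gpts c /\ sat (esum a c) (ginv G)].

Definition definable_group L (G : group_formulas L) (A : structure L) :=
  [/\ forall a b : tuples G A, Gpts a -> Gpts b ->
        exists! c : tuples G A, Gpts c /\ sat (esum (esum a b) c) (gmul G),
      is_group (@gop L G A) (@Gpts L G A)
    & forall a b : tuples G A, Gpts a -> Gpts b ->
        (sat (esum a b) (ginv G) <->
         forall c, Gpts c -> gop (gop a b) c = c)].

Definition gabelian L (G : group_formulas L) (A : structure L) :=
  forall a b : tuples G A, Gpts a -> Gpts b -> gop a b = gop b a.

(* phi(x * b), written  exists z in G, z = x * b /\ phi(z). *)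
Definition subst_mulr L (G : group_formulas L) (A : structure L)
    (phi : pformula A (gdim G)) (b : tuples G A) : pformula A (gdim G) :=
  fexn (fand (fmap inl (gdom G))
       (fand (fmap (esum (esum (fun k => inr (inl k)) (fun k => inr (inr (b k)))) inl)
                   (gmul G))
             (fmap (smap id inr) phi))).

(* phi(x^-1), written  exists z in G, z = x^-1 /\ phi(z). *)
Definition subst_inv L (G : group_formulas L) (A : structure L)
    (phi : pformula A (gdim G)) : pformula A (gdim G) :=
  fexn (fand (fmap inl (gdom G))
       (fand (fmap (esum (fun k => inr (inl k)) inl) (ginv G))
             (fmap (smap id inr) phi))).

Lemma gop_spec L (G : group_formulas L) (A : structure L) (a b c : tuples G A) :
  definable_group G A -> Gpts a -> Gpts b ->
  Gpts c /\ sat (esum (esum a b) c) (gmul G) <-> c = gop a b.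
Proof.
move=> [h _ _] Ga Gb; have [c0 [h0 uniq0]] := h _ _ Ga Gb.
have h1 : Gpts (gop a b) /\ sat (esum (esum a b) (gop a b)) (gmul G).
  apply: (@xgetPex {classic (tuples G A)} a
    [set c | Gpts c /\ sat (esum (esum a b) c) (gmul G)]).
  by exists c0.
by split=> [h2|->//]; rewrite -(uniq0 _ h2) -(uniq0 _ h1).
Qed.

Lemma gopp_spec L (G : group_formulas L) (A : structure L) (a c : tuples G A) :
  definable_group G A -> Gpts a ->
  Gpts c /\ sat (esum a c) (ginv G) <-> c = gopp a.
Proof.
move=> [_ [mulG assG [e [Ge idG invG]]] hinv] Ga.
have invE b : Gpts b -> sat (esum a b) (ginv G) <-> gop a b = e.
  move=> Gb; rewrite hinv//; split=> [h|-> c' Gc']; last by have [] := idG _ Gc'.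
  by rewrite -(h e Ge); have [] := idG _ (mulG _ _ Ga Gb).
have [b [Gb ab ba]] := invG _ Ga.
have h1 : Gpts (gopp a) /\ sat (esum a (gopp a)) (ginv G).
  apply: (@xgetPex {classic (tuples G A)} a
    [set c | Gpts c /\ sat (esum a c) (ginv G)]).
  by exists b; split=> //; apply/invE.
have uniqG c' : Gpts c' /\ sat (esum a c') (ginv G) -> c' = b.
  move=> [Gc' /(invE _ Gc') ac'].
  by have [<- _] := idG _ Gc'; rewrite -ba assG// ac'; have [] := idG _ Gb.
by split=> [/uniqG ->|-> //]; rewrite (uniqG _ h1).
Qed.

Lemma psat_subst_mulr L (G : group_formulas L) (A : structure L)
    (phi : pformula A (gdim G)) (a b : tuples G A) :
  definable_group G A -> Gpts a -> Gpts b ->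
  psat a (subst_mulr phi b) <-> psat (gop a b) phi.
Proof.
move=> dG Ga Gb; rewrite /psat /subst_mulr sat_fexn /=.
have E (c : tuples G A) :
    [/\ sat (esum c (esum a id) \o inl) (gdom G) = Gpts c,
     sat (esum c (esum a id) \o
       esum (esum (fun k => inr (inl k)) (fun k => inr (inr (b k)))) inl) (gmul G)
       = sat (esum (esum a b) c) (gmul G)
   & sat (esum c (esum a id) \o smap id inr) phi = sat (esum c id) phi].
  by split=> //; congr sat; apply: funext; [move=> [[]|]|move=> []].
split=> [[c]|h].
  rewrite !sat_fmap; have [-> -> ->] := E c => -[Gc [mc pc]].
  by rewrite -((gop_spec c dG Ga Gb).1 (conj Gc mc)).
exists (gop a b); rewrite !sat_fmap; have [-> -> ->] := E (gop a b).
by have [] := (gop_spec (gop a b) dG Ga Gb).2 erefl.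
Qed.

Lemma psat_subst_inv L (G : group_formulas L) (A B : structure L) (j : A -> B)
    (phi : pformula A (gdim G)) (a : tuples G B) :
  definable_group G B -> Gpts a ->
  psat a (pmap j (subst_inv phi)) <-> psat (gopp a) (pmap j phi).
Proof.
move=> dG Ga; rewrite /psat /pmap !sat_fmap /subst_inv sat_fexn /=.
have E (c : tuples G B) :
    [/\ sat (esum c (esum a id \o smap id j) \o inl) (gdom G) = Gpts c,
     sat (esum c (esum a id \o smap id j) \o
       esum (fun k => inr (inl k)) inl) (ginv G)
       = sat (esum a c) (ginv G)
   & sat (esum c (esum a id \o smap id j) \o smap id inr) phi =
     sat (esum c id \o smap id j) phi].
  by split=> //; congr sat; apply: funext => -[].
split=> [[c]|h].
  rewrite !sat_fmap; have [-> -> ->] := E c => -[Gc [mc pc]].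
  by rewrite -((gopp_spec c dG Ga).1 (conj Gc mc)).
exists (gopp a); rewrite !sat_fmap; have [-> -> ->] := E (gopp a).
by have [] := (gopp_spec (gopp a) dG Ga).2 erefl.
Qed.

Definition complete_type L (A : structure L) n (p : set (pformula A n)) :=
  consistent p /\ forall phi, p phi \/ p (fnot phi).

Definition same_type L (A : structure L) (B : set A) k (d d' : 'I_k -> A) :=
  forall theta : pformula A k, over B theta -> (psat d theta <-> psat d' theta).

Definition invariant L (A : structure L) n (B : set A) (p : set (pformula A n)) :=
  forall k (phi : formula L ('I_n + 'I_k)) (d d' : 'I_k -> A),
    same_type B d d' -> (p (inst phi d) <-> p (inst phi d')).

Definition fin_sat_in L (A : structure L) n (B : set A) (p : set (pformula A n)) :=
  forall phi, p phi ->
    exists2 a : 'I_n -> A, (forall k, B (a k)) & psat a phi.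

Definition gtype L (G : group_formulas L) (A : structure L) :=
  set (pformula A (gdim G)).

Definition S_G L (G : group_formulas L) (A : structure L) : set (gtype G A) :=
  [set p | complete_type p /\ p (noparam A (gdom G))].

Definition S_inv L (G : group_formulas L) (A : structure L) (B : set A) :
  set (gtype G A) := [set p | S_G p /\ invariant B p].

Definition S_fs L (G : group_formulas L) (A : structure L) (B : set A) :
  set (gtype G A) := [set p | S_G p /\ fin_sat_in B p].

Definition realizes_over L (A : structure L) n (B : set A)
    (b : 'I_n -> A) (q : set (pformula A n)) :=
  forall theta, q theta -> over B theta -> psat b theta.

(* When p is B-invariant, membership does not depend on the way phi is written
   as psi(x, d), nor on the realization b. *)
Definition newelski L (G : group_formulas L) (A : structure L) (B : set A)
    (p q : gtype G A) : gtype G A :=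
  [set phi | exists k (psi : formula L ('I_(gdim G) + 'I_k)) (d : 'I_k -> A),
    phi = inst psi d /\
    exists2 b : tuples G A, realizes_over (B `|` range d) b q
      & p (subst_mulr (inst psi d) b)].

Definition right_translate L (G : group_formulas L) (A : structure L)
    (p : gtype G A) (c : tuples G A) : gtype G A :=
  [set phi | p (subst_mulr phi c)].

(* phi(x) is in p^-1 iff phi(x^-1) is in p; see [inv_typeE]. *)
Definition inv_type L (G : group_formulas L) (A : structure L)
    (p : gtype G A) : gtype G A :=
  [set phi | p (subst_inv phi)].

(* p^-1 = tp(a^-1 / A) for every realization a of p in an extension V of A. *)
Lemma inv_typeE L (G : group_formulas L) (A V : structure L) (j : A -> V)
    (p : gtype G A) (a : tuples G V) :
  definable_group G V -> S_G p -> (forall phi, p phi -> psat a (pmap j phi)) ->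
  inv_type p = [set phi | psat (gopp a) (pmap j phi)].
Proof.
move=> dG [[_ pC] pG] ha.
have Ga : Gpts a.
  by have := ha _ pG; rewrite /psat /pmap /noparam !sat_fmap.
apply/seteqP; split=> phi /= h; first by apply/psat_subst_inv => //; apply: ha.
case: (pC (subst_inv phi)) => // /ha; rewrite /psat /pmap /= => hn.
by exfalso; apply: hn; apply/psat_subst_inv.
Qed.

Definition strong_right_f_generic L (G : group_formulas L) (A : structure L)
    (B : set A) : set (gtype G A) :=
  [set p | S_inv B p /\
     forall c : tuples G A, Gpts c -> invariant B (right_translate p c)].

Definition type_definable L (A : structure L) (small : set A -> Prop) n
    (H : set ('I_n -> A)) :=
  exists B (S : set (pformula A n)),
    [/\ small B, S `<=` over B & H = [set a | forall phi, S phi -> psat a phi]].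

Definition subgroup L (G : group_formulas L) (A : structure L)
    (H : set (tuples G A)) :=
  H `<=` @Gpts L G A /\ is_group (@gop L G A) H.

Definition coset L (G : group_formulas L) (A : structure L)
    (H : set (tuples G A)) (g : tuples G A) : set (tuples G A) := gop g @` H.

Definition bounded_index L (G : group_formulas L) (A : structure L)
    (kappa : Type) (H : set (tuples G A)) :=
  card_lt (coset H @` @Gpts L G A) [set: kappa].

Definition is_G00 L (G : group_formulas L) (A : structure L) (kappa : Type)
    (H : set (tuples G A)) :=
  let P := fun H' : set (tuples G A) =>
    [/\ subgroup H', type_definable (kappa_small kappa (X := A)) H'
      & bounded_index kappa H'] in
  P H /\ forall H', P H' -> H `<=` H'.

Definition add_pred (L : language) : language :=
  @Language (fsym L) (@farity L) (option (rsym L))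
    (fun r => if r is Some r' then rarity r' else 1).

Definition pair_structure L (A : structure L) (P : set A) :
  structure (add_pred L) :=
  @Structure (add_pred L) A (dom_inhabited A) (@fint L A)
    (fun r => match r return ('I_(@rarity (add_pred L) r) -> A) -> Prop with
              | Some r' => fun a => @rint L A r' a
              | None => fun a => P (a ord0)
              end).

Fixpoint tlift L (V : Type) (s : term L V) : term (add_pred L) V :=
  match s with
  | tvar v => tvar v
  | tapp f args => @tapp (add_pred L) V f (fun k => tlift (args k))
  end.

Fixpoint flift L (V : Type) (phi : formula L V) : formula (add_pred L) V :=
  match phi with
  | feq s1 s2 => feq (tlift s1) (tlift s2)
  | frel r args => @frel (add_pred L) V (Some r) (fun k => tlift (args k))
  | fnot psi => fnot (flift psi)
  | fand psi1 psi2 => fand (flift psi1) (flift psi2)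
  | fex psi => fex (flift psi)
  end.

Definition fpred L (V : Type) (v : V) : formula (add_pred L) V :=
  @frel (add_pred L) V None (fun _ => tvar v).

Lemma sat_flift L (A : structure L) (P : set A) (V : Type) (e : V -> A)
    (phi : formula L V) :
  sat (A := pair_structure P) e (flift phi) = sat e phi.
Proof.
have E W (h : W -> A) s : teval (A := pair_structure P) h (tlift s) = teval h s.
  elim: s => [//|f args IH] /=.
  by congr (@fint L A f); apply: funext => k; apply: IH.
elim: phi e => [{}V s1 s2|{}V r args|{}V psi IH|{}V p1 IH1 p2 IH2|{}V psi IH] e /=.
- by rewrite !E.
- by congr (@rint L A r); apply: funext => k; rewrite E.
- by rewrite IH.
- by rewrite IH1 IH2.
- by apply: eq_exists => a; rewrite IH.
Qed.

Section Retraction.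

Context (L : language) (G : group_formulas L) (U : structure L) (M : set U).
(* (N', N) is an elementary extension of (U, M) by j. *)
Context (N' : structure L) (N : set N') (j : U -> N').

Definition invariant_extension (p : gtype G U) (p' : gtype G N') :=
  [/\ complete_type p', invariant (j @` M) p'
    & forall phi, p phi -> p' (pmap j phi)].

Definition restriction_to_N (p : gtype G U) : gtype G N' :=
  [set phi | over N phi /\ exists2 p', invariant_extension p p' & p' phi].

Definition F_M (p : gtype G U) : gtype G U :=
  [set theta | consistent (A := pair_structure N)
     ([set flift (pmap j theta)]
      `|` [set fpred L (inl k : 'I_(gdim G) + N') | k in [set: 'I_(gdim G)]]
      `|` [set flift phi | phi in restriction_to_N p])].

Definition K_M (p : gtype G U) : gtype G U := F_M (inv_type p).

End Retraction.

(* |C| < |A|^+ is |C| <= |A|. *)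
Definition saturated_pair_extension L (A B : structure L) (P : set A)
    (Q : set B) (j : A -> B) :=
  elementary (A := pair_structure P) (B := pair_structure Q) j /\
  saturated (A := pair_structure Q) (fun C => C #<= [set: A]).

(* Main.v *)
(** Write t.g for the right translate of a type t by g. A strong right f-generic type
    t satisfies t.g = t.h whenever g and h have the same type over M, so its
    stabilizer H consists of the quotients of two elements with the same type over M.
    Hence H is type-definable of bounded index, contains G^00, and G(M) meets all of
    its cosets. It follows that t * q = t.m for every m in G(M) in the coset of q,
    so that t * S^inv = {t.m : m in G(M)}. The retraction satisfies F(t.m) = F(t).m;
    as u = F(t) is idempotent and has the same restriction to M as t, also t * t = t.

    It remains to prove u * I = {u.m : m in G(M)}, that is, k = u for every k in the
    group u * I with t * k = t. Let k' be the inverse of k and suppose that phi is in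
    u but not in k. Writing u = k * k', k = k * u, and so on, as limits of translates
    by elements of G(M), one gets two sets of points z of G(M), in one of which phi
    is in u.z and in the other it is not, each contained in the closure of the other
    modulo H. Since u = F(t), membership of phi in u.z is forced on M by a single
    formula of t, and since H stabilizes t this yields, for every finite pattern of
    truth values, some y such that phi(x y, d) has this pattern along a Morley
    sequence of t. This contradicts NIP.

    As G is abelian, inversion of types is an automorphism of S^inv, which reduces
    the statement on K to the one on F. *)
From mathcomp Require Import all_boot.
From mathcomp Require Import boolp classical_sets functions cardinality.
Require Import Defs.

Set Implicit Arguments.
Unset Strict Implicit.
Unset Printing Implicit Defensive.

Local Open Scope classical_set_scope.

(** * Cardinals below a strong limit *)

Local Open Scope card_scope.

(** The type t may be translated by any element of G(U) and stay M-invariant, whereas u is only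
    known to behave well under translation by G(M). So every statement about translates of u has to
    be kept inside M. Conditions that make sense only in U, such as being a Morley sequence of t or
    lying in H, are replaced by their approximations by formulas over M; compactness and
    elementarity of M then bring the witnesses found with t back into M. The test is made on an
    element k with t * k = t because realizations of k and of k' over M then lie in H, so a passage
    to the limit along k or k' is invisible to t. Both directions are needed: k leads from one set
    of points to the other, k' leads back. The retraction lives in an extension of the pair (U, M),
    but it enters only through the criterion [F_out], which mentions U and M alone. *)

Lemma inj_on_card_le (X Y : Type) (A : set X) (B : set Y) (f : X -> Y) :
  (forall x, A x -> B (f x)) -> {in A &, injective f} -> A #<= B.
Proof.
move=> fAB finj; have [|g] := (@injfunPex X Y A B).2; last exact: inj_card_le g.
by exists f => // x y Ax Ay; apply: finj.
Qed.

Lemma inj_card_leT (X Y : Type) (f : X -> Y) :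
  injective f -> [set: X] #<= [set: Y].
Proof. by move=> finj; apply: (@inj_on_card_le _ _ _ _ f) => // x y _ _; apply: finj. Qed.

Lemma card_leT_inj (X Y : Type) :
  [set: X] #<= [set: Y] -> exists f : X -> Y, injective f.
Proof.
move=> /card_leP[f].
have hT (Z : Type) (z : Z) : z \in [set: Z] by rewrite in_setE.
exists (fun x => val (f (SigSub (hT X x)))) => x y /val_inj h.
by have /(_ _ _ _ _ h) := @inj _ _ _ f; rewrite !in_setE => /(_ I I) [].
Qed.

Lemma surj_card_leT (X Y : Type) (f : X -> Y) :
  (forall y, exists x, f x = y) -> [set: Y] #<= [set: X].
Proof.
move=> /choice[g gK]; apply: (@inj_card_leT _ _ g) => y y' e.
by rewrite -(gK y) e gK.
Qed.

(** Zorn's lemma gives a maximal partial injection; it is total on one of the two sides, since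
    otherwise one more pair could be added. *)
Lemma card_leT_total (X Y : Type) :
  [set: X] #<= [set: Y] \/ [set: Y] #<= [set: X].
Proof.
pose P (R : set (X * Y)) := forall p q, R p -> R q -> (p.1 = q.1 <-> p.2 = q.2).
have [F FP Ftot|R [PR Rmax]] := @Zorn_bigcup (X * Y)%type P.
  move=> p q [A FA Ap] [B FB Bq].
  by case: (Ftot _ _ FA FB) => sub; [apply: (FP _ FB)|apply: (FP _ FA)] => //;
    apply: sub.
have [totX|] := pselect (forall x, exists y, R (x, y)).
  left; have /choice[f fR] := totX; apply: (@inj_card_leT _ _ f) => x x' e.
  exact: (PR _ _ (fR x) (fR x')).2 e.
move=> /existsNP[x0 nx]; right.
have totY y : exists x, R (x, y).
  apply: contrapT => ny; apply: (Rmax (R `|` [set (x0, y)])).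
    rewrite properEneq; split; last by move=> p; left.
    apply/eqP => e; apply: nx; exists y; rewrite e; by right.
  have nX p : R p -> p.1 <> x0 by case: p => a b Rp /= e; apply: nx; exists b; rewrite -e.
  have nY p : R p -> p.2 <> y by case: p => a b Rp /= e; apply: ny; exists a; rewrite -e.
  move=> p q [Rp|->] [Rq|->] //=.
  - exact: PR.
  - by split=> [/(nX _ Rp)|/(nY _ Rp)].
  - by split=> [/esym/(nX _ Rq)|/esym/(nY _ Rq)].
have /choice[f fR] := totY; apply: (@inj_card_leT _ _ f) => x x' e.
exact: (PR _ _ (fR x) (fR x')).1 e.
Qed.

Section StrongLimit.
Context (kappa : Type) (slk : strong_limit kappa).

Definition small (X : Type) := card_lt [set: X] [set: kappa].

Lemma card_le_small (X Y : Type) : [set: X] #<= [set: Y] -> small Y -> small X.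
Proof.
move=> XY [Yk nkY]; split; first exact: card_le_trans Yk.
by move=> kX; apply: nkY; apply: card_le_trans XY.
Qed.

Lemma small_set (X : Type) : small X -> small (set X).
Proof.
move=> [Xk nkX]; have [f finj] := card_leT_inj Xk.
have fX : range f #<= [set: X] by exact: card_image_le.
have [|le nle] := slk (S := range f).
  split; first exact: card_le_trans Xk.
  move=> kf; apply: nkX; exact: card_le_trans fX.
have h : [set: set X] #<= [set Y | Y `<=` range f].
  apply: (@inj_on_card_le _ _ _ _ (fun A : set X => f @` A)).
    by move=> A _ _ [x _ <-]; exists x.
  move=> A B _ _ e; apply/seteqP; split=> x Ax.
    have : (f @` A) (f x) by exists x.
    by rewrite e => -[y By /finj <-].
  have : (f @` B) (f x) by exists x.
  by rewrite -e => -[y By /finj <-].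
split; first exact: card_le_trans h le.
by move=> kX; apply: nle; apply: card_le_trans h.
Qed.

(** Kuratowski pairs embed a product into a double power set once both factors embed into one small
    type; by comparability one of the two factors is such a type. No cardinal arithmetic is
    required. *)
Lemma small_prod (X Y : Type) : small X -> small Y -> small (X * Y).
Proof.
have aux (Z : Type) (f : X -> Z) (g : Y -> Z) :
    injective f -> injective g -> small Z -> small (X * Y).
  move=> finj ginj sZ; apply: card_le_small (small_set (small_set sZ)).
  pose pr (p : X * Y) : set (set Z) :=
    [set [set f p.1]] `|` [set [set f p.1; g p.2]].
  apply: (@inj_card_leT _ _ pr) => -[a b] [a' b'] e.
  have fa : f a = f a'.
    have : pr (a', b') [set f a] by rewrite -e; left.
    by case=> /= /seteqP[h1 h2]; [apply: (h1 (f a))|apply/esym/(h2 (f a')); left].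
  have E : [set f a; g b] = [set f a; g b'].
    have : pr (a', b') [set f a; g b] by rewrite -e; right.
    case=> /= [ab|]; last by rewrite fa.
    have : pr (a, b) [set f a'; g b'] by rewrite e; right.
    case=> /= [ab'|<-]; last by rewrite fa.
    by rewrite ab [in RHS]fa ab' fa.
  have gb : g b = g b'.
    have h1 : [set f a; g b'] (g b) by rewrite -E; right.
    have h2 : [set f a; g b] (g b') by rewrite E; right.
    by case: h1 => [h1|//]; case: h2 => [->|->].
  by rewrite (finj _ _ fa) (ginj _ _ gb).
move=> sX sY; case: (card_leT_total X Y) => /card_leT_inj[f finj].
  exact: (aux _ f id).
exact: (aux _ id f).
Qed.

Lemma small_sum (X Y : Type) : small bool -> small X -> small Y -> small (X + Y).
Proof.
move=> sb sX sY; have [x0|nX] := pselect (exists x : X, True); last first.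
  apply: card_le_small sY; apply: (@surj_card_leT _ _ inr) => -[x|y]; last by exists y.
  by case: nX; exists x.
have [[y0 _]|nY] := pselect (exists y : Y, True); last first.
  apply: card_le_small sX; apply: (@surj_card_leT _ _ inl) => -[x|y]; first by exists x.
  by case: nY; exists y.
case: x0 => x0 _; apply: card_le_small (small_prod sb (small_prod sX sY)).
pose f (p : bool * (X * Y)) : X + Y := if p.1 then inl p.2.1 else inr p.2.2.
by apply: (@surj_card_leT _ _ f) => -[x|y]; [exists (true, (x, y0))|exists (false, (x0, y))].
Qed.

(** A sequence is coded by its graph, a set of pairs of an index and an entry. *)
Lemma small_seq (X : Type) : small nat -> small X -> small (seq X).
Proof.
move=> sn sX; apply: card_le_small (small_set (small_prod sn sX)).
pose f (s : seq X) : set (nat * X) := [set p | onth s p.1 = Some p.2].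
apply: (@inj_card_leT _ _ f) => s s' e.
have {}e n x : onth s n = Some x <-> onth s' n = Some x.
  by have /seteqP[h1 h2] := e; split; [apply: (h1 (n, x))|apply: (h2 (n, x))].
elim: s s' e => [|x s IH] [|x' s'] e //.
- by have [_ /(_ erefl)] := e 0 x'.
- by have [/(_ erefl)] := e 0 x.
- have [/(_ erefl)[->] _] := e 0 x; congr (_ :: _).
  by apply: IH => n y; apply: (e n.+1).
Qed.
End StrongLimit.

(** * Formulas with finitely many variables *)

Lemma tmap_comp L (V W X : Type) (g : V -> W) (h : W -> X) (s : term L V) :
  tmap h (tmap g s) = tmap (h \o g) s.
Proof. by elim: s => [//|f args IH] /=; congr tapp; apply: funext => k; apply: IH. Qed.

Lemma fmap_comp L (V W X : Type) (g : V -> W) (h : W -> X) (phi : formula L V) :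
  fmap h (fmap g phi) = fmap (h \o g) phi.
Proof.
elim: phi W X g h => [{}V s1 s2|{}V r args|{}V psi IH|{}V p1 IH1 p2 IH2|{}V psi IH]
  W X g h /=.
- by rewrite !tmap_comp.
- by congr frel; apply: funext => k; rewrite tmap_comp.
- by rewrite IH.
- by rewrite IH1 IH2.
- by rewrite IH; congr (fex (fmap _ _)); apply: funext => -[].
Qed.

Lemma tmap_finite_vars L (V : Type) (s : term L V) :
  exists (W : finType) (v : W -> V) (s' : term L W), s = tmap v s'.
Proof.
elim: s => [x|f args IH].
  by exists unit, (fun=> x), (tvar tt).
have {IH} /choice[W IH] := IH.
pose T (k : 'I_(farity f)) := {p : (W k -> V) * term L (W k) | args k = tmap p.1 p.2}.
have {IH} /(_ _)/cid IH : forall k, exists p : T k, True.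
  by move=> k; have [v [s' e]] := IH k; exists (exist _ (v, s') e).
pose d k := sval (sval (IH k)); pose dE k : args k = tmap (d k).1 (d k).2 := proj2_sig (sval (IH k)).
exists {k : 'I_(farity f) & W k}, (fun x => (d (tag x)).1 (tagged x)),
  (tapp (fun k => tmap (fun w => Tagged W w) (d k).2)) => /=.
by congr tapp; apply: funext => k; rewrite tmap_comp dE.
Qed.

(** Variables and parameters may range over any type, while saturation, invariance and elementarity
    speak of finite tuples; this lemma makes the link. *)
Lemma fmap_finite_vars L (V : Type) (phi : formula L V) :
  exists (W : finType) (v : W -> V) (psi : formula L W), phi = fmap v psi.
Proof.
elim: phi => [{}V s1 s2|{}V r args|{}V psi|{}V p1 [W1 [v1 [q1 ->]]] p2 [W2 [v2 [q2 ->]]]|{}V psi].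
- have [W1 [v1 [q1 ->]]] := tmap_finite_vars s1.
  have [W2 [v2 [q2 ->]]] := tmap_finite_vars s2.
  exists (W1 + W2)%type, (esum v1 v2), (feq (tmap inl q1) (tmap inr q2)) => /=.
  by rewrite !tmap_comp.
- have /choice[W IH] := fun k => tmap_finite_vars (args k).
  pose T (k : 'I_(rarity r)) := {p : (W k -> V) * term L (W k) | args k = tmap p.1 p.2}.
  have {IH} /(_ _)/cid IH : forall k, exists p : T k, True.
    by move=> k; have [v [s' e]] := IH k; exists (exist _ (v, s') e).
  pose d k := sval (sval (IH k)).
  pose dE k : args k = tmap (d k).1 (d k).2 := proj2_sig (sval (IH k)).
  exists {k : 'I_(rarity r) & W k}, (fun x => (d (tag x)).1 (tagged x)),
    (frel (fun k => tmap (fun w => Tagged W w) (d k).2)) => /=.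
  by congr frel; apply: funext => k; rewrite tmap_comp dE.
- by move=> [W [v [q ->]]]; exists W, v, (fnot q).
- exists (W1 + W2)%type, (esum v1 v2), (fand (fmap inl q1) (fmap inr q2)) => /=.
  by rewrite !fmap_comp.
- move=> [W [v [q ->]]].
  (* Under a quantifier, the variables sent to the bound variable [None] are dropped. *)
  pose W' := {w : W | isSome (v w)}.
  pose v' (x : W') : V :=
    match v (val x) as o return isSome o -> V with
    | Some a => fun=> a | None => fun h => False_rect V (notF h) end (valP x).
  exists W', v', (fex (fmap (fun w => insub w : option W') q)) => /=.
  rewrite fmap_comp; congr (fex (fmap _ _)); apply: funext => w /=.
  have vE x : v (val x) = Some (v' x) by rewrite /v'; move: (valP x); case: (v (val x)).
  case: insubP => [x h <-|]; first by rewrite vE.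
  by case: (v w).
Qed.

Lemma fmap_split L n (P : Type) (phi : formula L ('I_n + P)) :
  exists k (psi : formula L ('I_n + 'I_k)) (d : 'I_k -> P), phi = fmap (smap id d) psi.
Proof.
have [W [v [psi ->]]] := fmap_finite_vars phi.
pose isr w := if v w is inr _ then true else false.
pose W' := {w : W | isr w}.
pose d (x : W') : P := match v (val x) as o
    return is_true (if o is inr _ then true else false) -> P with
  | inr a => fun=> a | inl _ => fun h => False_rect P (notF h) end (valP x).
have /choice[g gE] : forall w, exists y : 'I_n + W', smap id d y = v w.
  move=> w; case e : (v w) => [k|a]; first by exists (inl k).
  have h : isr w by rewrite /isr e.
  exists (inr (exist _ w h)); rewrite /= -e.
  have dE x : v (val x) = inr (d x) by rewrite /d; move: (valP x); rewrite /isr; case: (v (val x)).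
  by rewrite -dE.
exists #|{: W'}|, (fmap (smap id (@enum_rank {: W'})) (fmap g psi)),
  (fun l => d (enum_val l)).
rewrite !fmap_comp; congr fmap; apply: funext => w /=; rewrite -gE.
by case: (g w) => //= x; rewrite enum_rankK.
Qed.

Lemma over_range L (A : structure L) n (P : Type) (f : P -> A)
    (phi : formula L ('I_n + P)) : over (range f) (fmap (smap id f) phi).
Proof.
have [k [psi [d ->]]] := fmap_split phi.
exists k, psi, (f \o d); split=> [l|]; first by exists (d l).
by rewrite /inst fmap_comp; congr fmap; apply: funext => -[].
Qed.

Lemma over_rangeE L (A : structure L) n (P : Type) (f : P -> A) (theta : pformula A n) :
  over (range f) theta -> exists phi, theta = fmap (smap id f) phi.
Proof.
move=> [k [psi [d [dB ->]]]].
have /choice[c cE] : forall l, exists p, f p = d l by move=> l; have [p _ <-] := dB l; exists p.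
exists (fmap (smap id c) psi); rewrite /inst fmap_comp; congr fmap.
by apply: funext => -[//|l] /=; rewrite cE.
Qed.

Lemma inst_ex L (A : structure L) n (phi : pformula A n) :
  exists k (psi : formula L ('I_n + 'I_k)) (d : 'I_k -> A), phi = inst psi d.
Proof.
by have [k [psi [d ->]]] := fmap_split phi; exists k, psi, d.
Qed.

Lemma psat_inst L (A : structure L) n k (psi : formula L ('I_n + 'I_k))
    (d : 'I_k -> A) (x : 'I_n -> A) :
  psat x (inst psi d) <-> sat (esum x d) psi.
Proof.
rewrite /psat /inst sat_fmap.
by have -> : esum x id \o smap id d = esum x d by apply: funext => -[].
Qed.

Lemma elementary_sat L (A B : structure L) (j : A -> B) :
  elementary j -> forall (V : Type) (phi : formula L V) (e : V -> A),
    sat e phi <-> sat (j \o e) phi.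
Proof.
move=> el V phi e; have [W [v [psi ->]]] := fmap_finite_vars phi.
have -> : fmap v psi = fmap (v \o enum_val) (fmap (@enum_rank W) psi).
  by rewrite fmap_comp; congr fmap; apply: funext => w /=; rewrite enum_rankK.
by move: (fmap _ psi) => psi'; rewrite !sat_fmap; apply: el.
Qed.

Definition fexV L (W : finType) (V : Type) (phi : formula L (W + V)) : formula L V :=
  fexn (fmap (smap (@enum_rank W) id) phi).

Lemma sat_fexV L (A : structure L) (W : finType) (V : Type) (e : V -> A)
    (phi : formula L (W + V)) :
  sat e (fexV phi) <-> exists a : W -> A, sat (esum a e) phi.
Proof.
rewrite /fexV sat_fexn; split=> -[a].
  rewrite sat_fmap => h; exists (a \o enum_rank); move: h; congr sat.
  by apply: funext => -[].
move=> h; exists (a \o enum_val); rewrite sat_fmap; move: h; congr sat.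
by apply: funext => -[w|//] /=; rewrite enum_rankK.
Qed.

Lemma fall_finite L (W : finType) (V : Type) (phi : W -> formula L V) :
  exists psi, forall (A : structure L) (e : V -> A),
    sat e psi <-> forall w, sat e (phi w).
Proof.
pose phi0 : formula L V := fex (feq (tvar None) (tvar None)).
have [psi psiE] : exists psi, forall (A : structure L) (e : V -> A),
    sat e psi <-> forall w, w \in enum W -> sat e (phi w).
  elim: (enum W) => [|w s [psi IH]].
    by exists (fnot (fand phi0 (fnot phi0))) => A e; split=> //= _ [].
  exists (fand (phi w) psi) => A e /=; rewrite IH; split=> [[h1 h2] w'|h].
    by rewrite inE => /orP[/eqP ->|/h2].
  by split=> [|w' w's]; apply: h; rewrite inE ?eqxx// w's orbT.
by exists psi => A e; rewrite psiE; split=> h w => [|_]; apply: h; rewrite ?mem_enum.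
Qed.

(** * Consistency and saturation *)

Lemma finite_set_list (X : Type) (S : set X) :
  finite_set S -> exists s : seq {classic X}, forall x, S x <-> x \in s.
Proof.
move=> fS; have /finite_seqP[s ->] : finite_set (S : set {classic X}) by [].
by exists s.
Qed.

(** [R y] is the part of S controlled by y; directedness lets a single index control a whole finite
    set. *)
Lemma finite_directed_bound (X Y : Type) (S : set X) (R : Y -> X -> Prop) (D : set Y)
    (S0 : set X) :
  D !=set0 ->
  (forall y z, D y -> D z -> exists w, [/\ D w, R y `<=` R w & R z `<=` R w]) ->
  (forall x, S x -> exists2 y, D y & R y x) ->
  finite_set S0 -> S0 `<=` S -> exists2 y, D y & S0 `<=` R y.
Proof.
move=> [y0 Dy0] dirD SD /finite_set_list[s sE] S0S.
suff [y Dy h] : exists2 y, D y & forall x, x \in s -> R y x.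
  by exists y => // x /sE; apply: h.
have : forall x, x \in s -> S x by move=> x /sE/S0S.
elim: s {sE} => [|x s IH] sS; first by exists y0.
have [|y Dy h] := IH; first by move=> x' h; apply: sS; rewrite inE h orbT.
have [z Dz Rz] := SD _ (sS x (mem_head _ _)).
have [w [Dw yw zw]] := dirD _ _ Dy Dz.
by exists w => // x'; rewrite inE => /orP[/eqP ->|/h]; [apply: zw|apply: yw].
Qed.

Lemma consistent_directed L (A : structure L) n (S : set (pformula A n)) :
  (forall phi psi, S phi -> S psi -> S (fand phi psi)) ->
  (forall phi, S phi -> exists a, psat a phi) -> consistent S.
Proof.
move=> Sand Ssat S0 fS0 S0S.
have [[phi0 Sphi0]|Semp] := pselect (S !=set0); last first.
  have [a0] := dom_inhabited A; exists (fun=> a0) => phi /S0S Sphi.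
  by case: Semp; exists phi.
have [|||phi Sphi h] := @finite_directed_bound _ _ S
    (fun phi psi => forall a, psat a phi -> psat a psi) S S0 _ _ _ fS0 S0S.
- by exists phi0.
- move=> y z Sy Sz; exists (fand y z).
  by split=> [|psi h a [/h]|psi h a [_ /h]] //; apply: Sand.
- by move=> psi Spsi; exists psi.
by have [a ha] := Ssat _ Sphi; exists a => psi /h; apply.
Qed.

(** With a family closed under conjunction, satisfiability has to be checked on single formulas
    only. *)
Lemma saturated_realize L (A : structure L) (small_set : set A -> Prop)
    (V : finType) (P : Type) (f : P -> A) (S : set (formula L (V + P))) :
  saturated small_set -> small_set (range f) ->
  (forall phi psi, S phi -> S psi -> S (fand phi psi)) ->
  (forall phi, S phi -> exists e, sat (esum e f) phi) ->
  exists e, forall phi, S phi -> sat (esum e f) phi.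
Proof.
move=> satA smf Sand Ssat.
pose h := smap (@enum_rank V) f.
have hE (a : 'I_#|V| -> A) phi : psat a (fmap h phi) = sat (esum (a \o enum_rank) f) phi.
  by rewrite /psat sat_fmap; congr sat; apply: funext => -[].
have [||a ha] := satA (range f) #|V| [set fmap h phi | phi in S] smf.
- move=> _ [phi _ <-].
  have -> : fmap h phi = fmap (smap id f) (fmap (smap enum_rank id) phi).
    by rewrite fmap_comp; congr fmap; apply: funext => -[].
  exact: over_range.
- apply: consistent_directed => [_ _ [phi Sphi <-] [psi Spsi <-]|_ [phi Sphi <-]].
    by exists (fand phi psi) => //; apply: Sand.
  have [e he] := Ssat _ Sphi; exists (e \o enum_val); rewrite hE.
  by move: he; congr sat; apply: funext => -[w|//] /=; rewrite enum_rankK.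
exists (a \o enum_rank) => phi Sphi; rewrite -hE; apply: ha; by exists phi.
Qed.

(** * Definable predicates and types over a set of parameters *)

Section Definable.
Context (L : language).

(** Working with predicates on assignments replaces syntactic substitution by closure properties.
    The parameters form a family [f], not a set, so that one formula can be evaluated with
    parameters in two structures, as in [same_tp]. *)
Definition dfn (A : structure L) (P V : Type) (f : P -> A) (X : (V -> A) -> Prop) :=
  exists phi : formula L (V + P), forall e, sat (esum e f) phi <-> X e.

Definition same_tp (A B : structure L) (P V : Type) (f : P -> A) (g : P -> B)
    (e : V -> A) (e' : V -> B) :=
  forall phi : formula L (V + P), sat (esum e f) phi <-> sat (esum e' g) phi.

Section Closure.
Context (A : structure L) (P : Type) (f : P -> A).

Lemma dfn_ext (V : Type) (X Y : (V -> A) -> Prop) :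
  (forall e, X e <-> Y e) -> dfn f X -> dfn f Y.
Proof. by move=> XY [phi h]; exists phi => e; rewrite h. Qed.

Lemma dfn_not (V : Type) (X : (V -> A) -> Prop) :
  dfn f X -> dfn f (fun e => ~ X e).
Proof. by move=> [phi h]; exists (fnot phi) => e /=; rewrite h. Qed.

Lemma dfn_and (V : Type) (X Y : (V -> A) -> Prop) :
  dfn f X -> dfn f Y -> dfn f (fun e => X e /\ Y e).
Proof. by move=> [phi h] [psi h']; exists (fand phi psi) => e /=; rewrite h h'. Qed.

Lemma dfn_imp (V : Type) (X Y : (V -> A) -> Prop) :
  dfn f X -> dfn f Y -> dfn f (fun e => X e -> Y e).
Proof.
move=> dX dY; apply: dfn_ext (dfn_not (dfn_and dX (dfn_not dY))) => e.
split=> [h Xe|h [Xe]]; last by apply; apply: h.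
by apply: contrapT => nY; apply: h.
Qed.

Lemma dfn_sub (V V' : Type) (h : V -> V' + P) (X : (V -> A) -> Prop) :
  dfn f X -> dfn f (fun e => X (esum e f \o h)).
Proof.
move=> [phi hphi]; exists (fmap (esum h inr) phi) => e; rewrite sat_fmap -hphi.
suff -> : esum e f \o esum h inr = esum (esum e f \o h) f by [].
by apply: funext => -[].
Qed.

Lemma dfn_ren (V V' : Type) (h : V -> V') (X : (V -> A) -> Prop) :
  dfn f X -> dfn f (fun e => X (e \o h)).
Proof. exact: (dfn_sub (inl \o h)). Qed.

Lemma dfn_ex (W : finType) (V : Type) (X : (W + V -> A) -> Prop) :
  dfn f X -> dfn f (fun e => exists a : W -> A, X (esum a e)).
Proof.
move=> [phi h].
exists (fexV (fmap (fun s : (W + V) + P => match s with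
  | inl (inl w) => inl w | inl (inr v) => inr (inl v) | inr p => inr (inr p) end) phi)) => e.
rewrite sat_fexV; have E a : esum a (esum e f) \o (fun s : (W + V) + P => match s with
  | inl (inl w) => inl w | inl (inr v) => inr (inl v) | inr p => inr (inr p) end) =
  esum (esum a e) f by apply: funext => -[[]|].
by split=> -[a ha]; exists a; move: ha; rewrite sat_fmap E h.
Qed.

Lemma dfn_sat (V : Type) (phi : formula L V) : dfn f (fun e => sat e phi).
Proof. by exists (fmap inl phi) => e; rewrite sat_fmap. Qed.

Lemma dfn_true (V : Type) : dfn f (fun _ : V -> A => True).
Proof.
exists (fex (feq (tvar None) (tvar None))) => e; split=> // _.
by have [a] := dom_inhabited A; exists a.
Qed.

Lemma dfn_iff_const (V : Type) (X : (V -> A) -> Prop) (Q : Prop) :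
  dfn f X -> dfn f (fun e => X e <-> Q).
Proof.
move=> dX; have [q|nq] := pselect Q.
  by apply: dfn_ext dX => e; split=> // -[_]; apply.
by apply: dfn_ext (dfn_not dX) => e; split=> // -[h _] /h.
Qed.

Lemma dfn_const (V W : Type) (c : W -> P) (X : (V + W -> A) -> Prop) :
  dfn f X -> dfn f (fun e => X (esum e (f \o c))).
Proof.
move=> dX; apply: dfn_ext (dfn_sub (smap id c) dX) => e.
suff -> : esum e f \o smap id c = esum e (f \o c) by [].
by apply: funext => -[].
Qed.

Lemma dfn_psat (V : Type) (phi : formula L (V + P)) :
  dfn f (fun e => sat (esum e f) phi).
Proof. by exists phi. Qed.

Lemma dfn_join (V W : Type) (w : W -> A) (X : (V + W -> A) -> Prop) :
  dfn f X -> dfn (esum w f) (fun e => X (esum e w)).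
Proof.
move=> [phi h]; exists (fmap (fun s : (V + W) + P => match s with
  | inl (inl v) => inl v | inl (inr v) => inr (inl v) | inr p => inr (inr p) end) phi) => e.
rewrite sat_fmap -h.
match goal with |- sat ?x _ <-> sat ?y _ => suff -> : x = y by [] end.
by apply: funext => -[[]|].
Qed.

Lemma dfn_id (V : Type) (X : (V -> A) -> Prop) : dfn f X -> dfn (A := A) id X.
Proof.
move=> [phi h]; exists (fmap (smap id f) phi) => e; rewrite sat_fmap -h.
match goal with |- sat ?x _ <-> sat ?y _ => suff -> : x = y by [] end.
by apply: funext => -[].
Qed.

End Closure.

Section SameType.
Context (A B : structure L) (P : Type) (f : P -> A) (g : P -> B).

Lemma same_tp_ren (V V' : Type) (h : V' -> V) (e : V -> A) (e' : V -> B) :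
  same_tp f g e e' -> same_tp f g (e \o h) (e' \o h).
Proof.
move=> ee' phi; have := ee' (fmap (smap h id) phi); rewrite !sat_fmap.
have -> : esum e f \o smap h id = esum (e \o h) f by apply: funext => -[].
by have -> : esum e' g \o smap h id = esum (e' \o h) g by apply: funext => -[].
Qed.

Lemma same_tp_params (V : Type) (e : V -> A) (e' : V -> B) :
  same_tp f g e e' -> same_tp f g (esum e f) (esum e' g).
Proof.
move=> ee' phi; have := ee' (fmap (esum id inr) phi); rewrite !sat_fmap.
have -> : esum e f \o esum id inr = esum (esum e f) f by apply: funext => -[[]|].
by have -> : esum e' g \o esum id inr = esum (esum e' g) g by apply: funext => -[[]|].
Qed.

End SameType.

Lemma same_tp_sym (A B : structure L) (P V : Type) (f : P -> A) (g : P -> B)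
    (e : V -> A) (e' : V -> B) : same_tp f g e e' -> same_tp g f e' e.
Proof. by move=> h phi; rewrite h. Qed.

Lemma same_tp_trans (A B C : structure L) (P V : Type) (f : P -> A) (g : P -> B)
    (k : P -> C) (e : V -> A) (e' : V -> B) (e'' : V -> C) :
  same_tp f g e e' -> same_tp g k e' e'' -> same_tp f k e e''.
Proof. by move=> h h' phi; rewrite h h'. Qed.

Lemma same_tp_dfn (A : structure L) (P V : Type) (f : P -> A) (e e' : V -> A)
    (X : (V -> A) -> Prop) : same_tp f f e e' -> dfn f X -> (X e <-> X e').
Proof. by move=> h [phi hphi]; rewrite -!hphi. Qed.

Lemma dfn_same_tp (A : structure L) (P V : Type) (f : P -> A) (e e' : V -> A) :
  (forall X : (V -> A) -> Prop, dfn f X -> X e -> X e') -> same_tp f f e e'.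
Proof.
move=> h phi; split=> he; first exact: (h _ (dfn_psat f phi)).
by apply: contrapT => hn; apply: (h _ (dfn_not (dfn_psat f phi)) hn).
Qed.

Lemma same_tp_same_type (A : structure L) (P : Type) (f : P -> A) k (d d' : 'I_k -> A) :
  same_tp f f d d' <-> same_type (range f) d d'.
Proof.
have E (a : 'I_k -> A) (phi : formula L ('I_k + P)) :
    psat a (fmap (smap id f) phi) = sat (esum a f) phi.
  by rewrite /psat sat_fmap; congr sat; apply: funext => -[].
split=> [h theta /over_rangeE[phi ->]|h phi]; first by rewrite !E.
by rewrite -!E; apply: h; apply: over_range.
Qed.

End Definable.

Section GroupDefinable.
Context (L : language) (G : group_formulas L) (A : structure L).
Hypothesis dG : definable_group G A.
Context (P : Type) (f : P -> A).

Lemma dfn_Gpts (V : Type) (h : 'I_(gdim G) -> V + P) :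
  dfn f (fun e : V -> A => @Gpts L G A (esum e f \o h)).
Proof. exact: (dfn_sub h (dfn_sat f (gdom G))). Qed.

(** The two membership conditions belong to the predicate because [gop] is described by the formula
    [gmul] on G only and takes a default value elsewhere. *)
Lemma dfn_gop (V : Type) (h1 h2 : 'I_(gdim G) -> V + P)
    (X : ('I_(gdim G) + V -> A) -> Prop) :
  dfn f X ->
  dfn f (fun e : V -> A => [/\ @Gpts L G A (esum e f \o h1),
     @Gpts L G A (esum e f \o h2) & X (esum (@gop L G A (esum e f \o h1) (esum e f \o h2)) e)]).
Proof.
move=> dX.
pose m : ((('I_(gdim G) + 'I_(gdim G)) + 'I_(gdim G)) -> ('I_(gdim G) + V) + P) :=
  esum (esum (fun k => esum (inl \o inr) inr (h1 k)) (fun k => esum (inl \o inr) inr (h2 k)))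
       (fun k => inl (inl k)).
have d1 := dfn_ex (dfn_and (dfn_Gpts (inl \o inl)) (dfn_and (dfn_sub m (dfn_sat f (gmul G))) dX)).
apply: dfn_ext (dfn_and (dfn_Gpts h1) (dfn_and (dfn_Gpts h2) d1)) => e.
have mE c : esum (esum c e) f \o m = esum (esum (esum e f \o h1) (esum e f \o h2)) c.
  by apply: funext => -[[]|] k //=; [case: (h1 k)|case: (h2 k)].
split=> [[G1 [G2 [c [Gc [mc Xc]]]]]|[G1 G2 Xc]].
  split=> //; move: mc Gc; rewrite mE => mc Gc.
  by rewrite -((gop_spec c dG G1 G2).1 (conj Gc mc)).
split=> //; split=> //; exists (gop (esum e f \o h1) (esum e f \o h2)).
have [Gc mc] := (gop_spec _ dG G1 G2).2 erefl.
by split=> //; split; rewrite ?mE.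
Qed.

End GroupDefinable.

(** * Standing assumptions *)

Record setting L (kappa : Type) (U M : structure L) (i : M -> U)
    (G : group_formulas L) : Prop := Setting {
  st_monster : monster kappa U;
  st_elementary : elementary i;
  st_small : kappa_small kappa (range i);
  st_group : definable_group G U;
  st_abelian : gabelian G U }.

Section Setting.
Context (L : language) (kappa : Type) (U M : structure L) (i : M -> U)
  (G : group_formulas L).
Context (st : setting kappa i G).
Local Notation n := (gdim G).
Local Notation tup := (tuples G U).
Local Notation Gp := (@Gpts L G U).
Local Notation gop := (@gop L G U).
Local Notation gopp := (@gopp L G U).
Local Notation dG := (st_group st).

(** * Saturation over M and finitely many parameters *)

Lemma st_strong_limit : strong_limit kappa.
Proof. by case: (st_monster st). Qed.

Lemma small_nat : small kappa nat.
Proof.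
have [_ h _ _] := st_monster st; apply: card_le_small h.
apply: (@inj_card_leT _ _ (fun k : nat => feq (tvar k) (tvar k) : formula L nat)).
by move=> a b [].
Qed.

Lemma small_countable (W : countType) : small kappa W.
Proof. apply: card_le_small small_nat; exact: (inj_card_leT (pcan_inj pickleK)). Qed.

Lemma i_inj : injective i.
Proof.
move=> a b e.
have := elementary_sat (st_elementary st) (feq (tvar true) (tvar false))
  (fun x : bool => if x then a else b).
by move=> [_]; apply; rewrite /= e.
Qed.

Lemma small_M : small kappa M.
Proof.
have [h h'] := st_small st.
have Mi : ([set: M] #<= range i)%card by apply: (@inj_on_card_le _ _ _ _ i) =>
  [m _|x y _ _ /i_inj //]; exists m.
split; first exact: card_le_trans h.
by move=> kM; apply: h'; apply: card_le_trans Mi.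
Qed.

Lemma small_addM (W : Type) : small kappa W -> small kappa (W + M).
Proof.
move=> sW; apply: (small_sum st_strong_limit) => //; [exact: small_countable|exact: small_M].
Qed.

Lemma small_range (P : Type) (f : P -> U) : small kappa P -> kappa_small kappa (range f).
Proof.
move=> [h h']; have le : (range f #<= [set: P])%card by exact: card_image_le.
split; first exact: card_le_trans h.
by move=> kf; apply: h'; apply: card_le_trans le.
Qed.

(** The members of [D] need not be definable: only their definable consequences are realized. This
    admits conditions such as lying in a stabilizer or realizing a type over a varying parameter. *)
Lemma realize (V : finType) (P : Type) (f : P -> U) (D : set ((V -> U) -> Prop)) :
  small kappa P ->
  (forall X Y, D X -> D Y -> exists2 Z, D Z & forall e, Z e -> X e /\ Y e) ->
  (forall X, D X -> exists e, X e) ->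
  exists e, forall X Y, D X -> dfn f Y -> (forall e, X e -> Y e) -> Y e.
Proof.
move=> sP Dand Dsat; have [_ _ satU _] := st_monster st.
have [| |e he] := saturated_realize (V := V) (f := f)
   (S := [set phi | exists2 X, D X & forall e, X e -> sat (esum e f) phi])
   satU (small_range f sP).
- move=> phi psi [X DX hX] [Y DY hY]; have [Z DZ hZ] := Dand _ _ DX DY.
  by exists Z => // e /hZ[/hX ? /hY].
- by move=> phi [X /Dsat[e Xe] h]; exists e; apply: h.
exists e => X Y DX [phi hphi] XY; apply/hphi/he; exists X => // e' /XY.
by rewrite hphi.
Qed.

Lemma tarski_vaught (V : finType) (X : (V -> U) -> Prop) :
  dfn i X -> (exists e, X e) -> exists m : V -> M, X (i \o m).
Proof.
move=> [phi h] [e /h Xe].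
have /(elementary_sat (st_elementary st)) : sat (i \o id) (fexV phi).
  by apply/sat_fexV; exists e.
move=> /sat_fexV[m] /(elementary_sat (st_elementary st)) hm.
exists m; apply/h; move: hm; congr sat; by apply: funext => -[].
Qed.

(** If each member of [D] had a point outside [Y], saturation would give a common point of all of
    them outside [Y]. *)
Lemma compactM (V : finType) (D : set ((V -> U) -> Prop)) (Y : (V -> U) -> Prop) :
  (exists X, D X) -> (forall X, D X -> dfn i X) ->
  (forall X X', D X -> D X' -> exists2 Z, D Z & forall e, Z e -> X e /\ X' e) ->
  dfn i Y -> (forall e, (forall X, D X -> X e) -> Y e) ->
  exists2 X, D X & forall e, X e -> Y e.
Proof.
move=> [X0 DX0] Ddfn Ddir dY DY; apply: contrapT => noX.
have [|||e he] := @realize V M i [set X | exists2 Z, D Z & X = (fun e => Z e /\ ~ Y e)].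
- exact: small_M.
- move=> _ _ [Z DZ ->] [Z' DZ' ->]; have [W DW WZ] := Ddir _ _ DZ DZ'.
  exists (fun e => W e /\ ~ Y e); first by exists W.
  by move=> e [/WZ[]].
- move=> _ [Z DZ ->]; apply: contrapT => none; apply: noX; exists Z => // e Ze.
  by apply: contrapT => nY; apply: none; exists e.
apply: (he (fun e => X0 e /\ ~ Y e) (fun e => ~ Y e)) => //.
- by exists X0.
- exact: dfn_not.
- by move=> ? [].
apply: DY => X DX; apply: (he (fun e => X e /\ ~ Y e)) => //.
- by exists X.
- exact: Ddfn.
- by move=> ? [].
Qed.

(** * The group *)

Lemma gopG (a b : tup) : Gp a -> Gp b -> Gp (gop a b).
Proof. by have [_ [h _ _] _] := dG; apply: h. Qed.

Lemma gopA (a b c : tup) : Gp a -> Gp b -> Gp c -> gop (gop a b) c = gop a (gop b c).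
Proof. by have [_ [_ h _] _] := dG; apply: h. Qed.

Lemma gopC (a b : tup) : Gp a -> Gp b -> gop a b = gop b a.
Proof. exact: st_abelian st a b. Qed.

Lemma gone_ex : exists e, [/\ Gp e, forall x, Gp x -> gop e x = x /\ gop x e = x
      & forall x, Gp x -> exists y, [/\ Gp y, gop x y = e & gop y x = e]].
Proof. by have [_ [_ _ h] _] := dG. Qed.

Definition gone : tup := sval (cid gone_ex).

Lemma goneG : Gp gone.
Proof. by rewrite /gone; case: cid => e []. Qed.

Lemma gop1l (a : tup) : Gp a -> gop gone a = a.
Proof. by rewrite /gone; case: cid => e [_ h _] /= /h[]. Qed.

Lemma gop1r (a : tup) : Gp a -> gop a gone = a.
Proof. by rewrite /gone; case: cid => e [_ h _] /= /h[]. Qed.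

Lemma goppG (a : tup) : Gp a -> Gp (gopp a).
Proof. by move=> Ga; have [] := (gopp_spec (gopp a) dG Ga).2 erefl. Qed.

Lemma gopV (a : tup) : Gp a -> gop a (gopp a) = gone.
Proof.
move=> Ga; have [Gb mb] := (gopp_spec (gopp a) dG Ga).2 erefl.
have [_ _ /(_ _ _ Ga Gb)[/(_ mb) h _]] := dG.
by rewrite -[LHS]gop1r ?h//; [exact: goneG|exact: gopG].
Qed.

Lemma gopVl (a : tup) : Gp a -> gop (gopp a) a = gone.
Proof. by move=> Ga; rewrite gopC ?gopV//; apply: goppG. Qed.

Lemma gopK (a b : tup) : Gp a -> Gp b -> gop (gop a b) (gopp b) = a.
Proof. by move=> Ga Gb; rewrite gopA ?gopV ?gop1r//; apply: goppG. Qed.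

Lemma gopVK (a b : tup) : Gp a -> Gp b -> gop (gop a (gopp b)) b = a.
Proof. by move=> Ga Gb; rewrite gopA ?gopVl ?gop1r//; apply: goppG. Qed.

Lemma gopAC (a b c : tup) : Gp a -> Gp b -> Gp c -> gop (gop a b) c = gop (gop a c) b.
Proof. by move=> Ga Gb Gc; rewrite !gopA// (gopC Gb). Qed.

Lemma gopp_unique (a b : tup) : Gp a -> Gp b -> gop a b = gone -> b = gopp a.
Proof.
move=> Ga Gb e; rewrite -(gop1l (goppG Ga)) -e gopC; last exact: goppG; last exact: gopG.
by rewrite -gopA ?gopVl ?gop1l//; apply: goppG.
Qed.

Lemma goppK (a : tup) : Gp a -> gopp (gopp a) = a.
Proof. by move=> Ga; apply/esym/gopp_unique; rewrite ?gopVl//; apply: goppG. Qed.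

Lemma gopp_gop (a b : tup) : Gp a -> Gp b -> gopp (gop a b) = gop (gopp a) (gopp b).
Proof.
move=> Ga Gb; have Ga' := goppG Ga; have Gb' := goppG Gb.
apply/esym/gopp_unique; [exact: gopG|exact: gopG|].
by rewrite -gopA//; [rewrite (gopAC Ga Gb Ga') gopV// gop1l// gopV|exact: gopG].
Qed.

Definition GM (a : tup) := Gp a /\ exists m, a = i \o m.

Lemma GM_of (m : tup) : Gp m -> (forall k, range i (m k)) -> GM m.
Proof.
move=> Gm mM; split=> //; have /choice[m0 hm0] : forall k, exists x, i x = m k.
  by move=> k; have [x _ <-] := mM k; exists x.
by exists m0; apply: funext => k; rewrite /= hm0.
Qed.

(** By elementarity, the unique solution of a formula over M lies in M. Products and inverses of
    points of M are instances. *)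
Lemma GM_definable (X : (('I_n) -> U) -> Prop) (a : tup) :
  dfn i X -> (forall e, X e <-> e = a) -> Gp a -> GM a.
Proof.
move=> dX Xa Ga; split=> //.
have [|m /Xa <-] := tarski_vaught dX; first by exists a; apply/Xa.
by exists m.
Qed.

Lemma GM_gop (a b : tup) : GM a -> GM b -> GM (gop a b).
Proof.
move=> [Ga [m em]] [Gb [m' em']]; apply: (@GM_definable
  (fun e => Gp e /\ sat (esum (esum a b) e) (gmul G))); last exact: gopG.
- apply: dfn_and (dfn_sat i (gdom G)) _.
  apply: dfn_ext (dfn_sub (esum (esum (inr \o m) (inr \o m')) inl) (dfn_sat i (gmul G))) => e.
  suff -> : esum e i \o esum (esum (inr \o m) (inr \o m')) inl = esum (esum a b) e by [].
  by rewrite em em'; apply: funext => -[[]|].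
- by move=> e; apply: gop_spec dG Ga Gb.
Qed.

Lemma GM_opp (a : tup) : GM a -> GM (gopp a).
Proof.
move=> [Ga [m em]]; apply: (@GM_definable
  (fun e => Gp e /\ sat (esum a e) (ginv G))); last exact: goppG.
- apply: dfn_and (dfn_sat i (gdom G)) _.
  apply: dfn_ext (dfn_sub (esum (inr \o m) inl) (dfn_sat i (ginv G))) => e.
  suff -> : esum e i \o esum (inr \o m) inl = esum a e by [].
  by rewrite em; apply: funext => -[].
- by move=> e; apply: gopp_spec dG Ga.
Qed.

Lemma GM_one : GM gone.
Proof.
have [||m Gm] := @tarski_vaught _ (fun e : 'I_n -> U => Gp e).
- exact: dfn_sat.
- by exists gone; exact: goneG.
by rewrite -(gopV Gm); apply: GM_gop; [|apply: GM_opp]; split=> //; exists m.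
Qed.

End Setting.

(** * Complete types as filters of definable sets *)

Section Types.
Context (L : language) (U : structure L) (G : group_formulas L).
Local Notation n := (gdim G).
Local Notation tup := (tuples G U).
Local Notation Gp := (@Gpts L G U).

(** The filter on G generated by p. It applies to arbitrary predicates of points; definability is
    what allows one to decide between a predicate and its negation. *)
Definition large (p : gtype G U) (X : tup -> Prop) :=
  exists2 phi, p phi & forall a, Gp a -> psat a phi -> X a.

Lemma S_G_intro (p : gtype G U) :
  (forall phi psi, p phi -> p psi -> p (fand phi psi)) ->
  (forall phi, p phi -> exists a, psat a phi) ->
  (forall phi, p phi \/ p (fnot phi)) -> p (noparam U (gdom G)) -> S_G p.
Proof. by move=> pand psat_ pC pG; split=> //; split=> //; apply: consistent_directed. Qed.

Section Ultra.
Context (p : gtype G U) (pS : S_G p).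

Lemma tp_finite (S0 : set (pformula U n)) : finite_set S0 -> S0 `<=` p ->
  exists2 a, Gp a & forall phi, S0 phi -> psat a phi.
Proof.
move=> fS0 S0p; have [[pc _] pG] := pS.
have [|phi|a ha] := pc (noparam U (gdom G) |` S0); first by rewrite finite_setU; split.
  by move=> [->|/S0p].
exists a => [|phi S0phi]; last by apply: ha; right.
have := ha (noparam U (gdom G)) (or_introl erefl).
by rewrite /psat /noparam sat_fmap.
Qed.

Lemma tp_not (phi : pformula U n) : p (fnot phi) <-> ~ p phi.
Proof.
split=> [pn pphi|np]; last by case: (pS.1.2 phi).
have [|a _ h] := @tp_finite [set phi; fnot phi] (finite_set2 _ _).
  by move=> _ [->|->].
by apply: (h (fnot phi)); [right|apply: h; left].
Qed.

Lemma tp_imp (phi psi : pformula U n) :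
  p phi -> (forall a, Gp a -> psat a phi -> psat a psi) -> p psi.
Proof.
move=> pphi h; apply: contrapT => /tp_not pn.
have [|a Ga ha] := @tp_finite [set phi; fnot psi] (finite_set2 _ _).
  by move=> _ [->|->].
by apply: (ha (fnot psi)); [right|apply: h => //; apply: ha; left].
Qed.

Lemma tp_and (phi psi : pformula U n) : p phi -> p psi -> p (fand phi psi).
Proof.
move=> pphi ppsi; apply: contrapT => /tp_not pn.
have [|a Ga ha] := @tp_finite [set phi; psi; fnot (fand phi psi)] (finite_set3 _ _ _).
  by move=> _ [[->|->]|->].
by apply: (ha (fnot (fand phi psi))); [right|split; apply: ha; left; [left|right]].
Qed.

Lemma largeE (phi : pformula U n) : large p (fun a => psat a phi) <-> p phi.
Proof. by split=> [[psi pp h]|pphi]; [exact: tp_imp pp h|exists phi]. Qed.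

Lemma large_ex (X : tup -> Prop) : large p X -> exists2 a, Gp a & X a.
Proof.
move=> [phi pphi h]; have [_ ->|a Ga ha] := @tp_finite [set phi] (finite_set1 _) => //.
by exists a => //; apply: h => //; apply: ha.
Qed.

Lemma large_and (X Y : tup -> Prop) :
  large p X -> large p Y -> large p (fun a => X a /\ Y a).
Proof.
move=> [phi pphi hX] [psi ppsi hY]; exists (fand phi psi); first exact: tp_and.
by move=> a Ga [/hX ? /hY]; split; auto.
Qed.

Lemma largeT (X : tup -> Prop) : (forall a, Gp a -> X a) -> large p X.
Proof. by move=> h; exists (noparam U (gdom G)) => [|a /h //]; case: pS. Qed.

Lemma largeN (X : tup -> Prop) : dfn (A := U) id X ->
  large p (fun a => ~ X a) <-> ~ large p X.
Proof.
move=> [phi h]; have pX : large p X <-> p phi.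
  rewrite -largeE; split=> -[psi pp hp]; exists psi => // a Ga /(hp _ Ga) /h //.
rewrite pX -tp_not -largeE; split=> -[psi pp hp]; exists psi => // a Ga /(hp _ Ga) /=;
  by rewrite /psat /= h.
Qed.

Lemma large_dec (X : tup -> Prop) : dfn (A := U) id X ->
  large p X \/ large p (fun a => ~ X a).
Proof. by move=> dX; have [h|/largeN] := pselect (large p X); [left|right; auto]. Qed.

End Ultra.

Lemma largeS (p : gtype G U) (X Y : tup -> Prop) :
  (forall a, Gp a -> X a -> Y a) -> large p X -> large p Y.
Proof. by move=> h [phi pp hX]; exists phi => // a Ga /(hX _ Ga)/(h _ Ga). Qed.

Lemma large_iff (p : gtype G U) (X Y : tup -> Prop) :
  (forall a, Gp a -> X a <-> Y a) -> large p X <-> large p Y.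
Proof. by move=> h; split; apply: largeS => a /h ->. Qed.

Lemma tp_eq (p q : gtype G U) : S_G p -> S_G q -> p `<=` q -> p = q.
Proof.
move=> pS qS pq; apply/seteqP; split=> // phi qphi; apply: contrapT => /(tp_not pS)/pq.
by rewrite (tp_not qS).
Qed.

End Types.

(** * Realizations over M and invariance *)

Section TypesM.
Context (L : language) (kappa : Type) (U M : structure L) (i : M -> U)
  (G : group_formulas L).
Context (st : setting kappa i G).
Local Notation n := (gdim G).
Local Notation tup := (tuples G U).
Local Notation Gp := (@Gpts L G U).
Local Notation gop := (@gop L G U).
Local Notation gopp := (@gopp L G U).
Local Notation dG := (st_group st).
Local Notation MU := (range i).
Local Notation Sinv := (@S_inv L G U MU).
Local Notation Sfs := (@S_fs L G U MU).
Local Notation op := (@newelski L G U MU).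

Lemma dfn_fix (W : Type) (w : W -> U) (Y : ('I_n + W -> U) -> Prop) :
  dfn i Y -> dfn (A := U) id (fun x : 'I_n -> U => Y (esum x w)).
Proof. by move=> /(dfn_join w)/dfn_id. Qed.

Lemma pformula_dfn (phi : pformula U n) :
  exists (W : finType) (w : W -> U) (Y : ('I_n + W -> U) -> Prop),
    dfn i Y /\ forall x, psat x phi <-> Y (esum x w).
Proof.
have [k [psi [d ->]]] := inst_ex phi.
exists ('I_k), d, (fun e => sat e psi); split=> [|x]; first exact: dfn_sat.
exact: psat_inst.
Qed.

(** This is realization of q over M and [w], phrased with M-definable predicates so that the family
    [w] may be infinite; [rlz_realizes_over] compares it with [realizes_over]. *)
Definition rlz (q : gtype G U) (W : Type) (w : W -> U) (b : tup) :=
  Gp b /\ forall Y : ('I_n + W -> U) -> Prop, dfn i Y ->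
    large q (fun x => Y (esum x w)) -> Y (esum b w).

Section Rlz.
Context (q : gtype G U) (qS : S_G q).

Lemma rlz_ex (W : Type) (w : W -> U) : small kappa W -> exists b, rlz q w b.
Proof.
move=> sW; have [|||b hb] := realize st (esum w i)
    (D := [set X : ('I_n -> U) -> Prop | large q X /\ forall a, X a -> Gp a]).
- exact: (small_addM st).
- move=> X Y [qX XG] [qY YG]; exists (fun a => X a /\ Y a); last by [].
  by split; [apply: large_and|move=> a [/XG]].
- by move=> X [/(large_ex qS)[a _ Xa] _]; exists a.
exists b; split.
  apply: (hb Gp Gp) => //; last exact: dfn_sat.
  by split=> //; apply: largeT.
move=> Y dY qY.
apply: (hb (fun x => Gp x /\ Y (esum x w)) (fun x => Y (esum x w))) => [||a [] //].
  by split=> [|a []//]; apply: largeS qY.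
exact: dfn_join.
Qed.

Lemma rlz_iff (W : Type) (w : W -> U) (b : tup) (Y : ('I_n + W -> U) -> Prop) :
  rlz q w b -> dfn i Y -> Y (esum b w) <-> large q (fun x => Y (esum x w)).
Proof.
move=> [Gb h] dY; split=> [Yb|]; last exact: h.
apply: contrapT => /(largeN qS (dfn_fix w dY)) /(h (fun e => ~ Y e)).
by move=> /(_ (dfn_not dY)).
Qed.

Lemma rlz_same_tp (W : Type) (w : W -> U) (b b' : tup) :
  rlz q w b -> rlz q w b' -> same_tp i i (esum b w) (esum b' w).
Proof.
move=> hb hb'; apply: dfn_same_tp => Y dY.
by rewrite (rlz_iff hb dY) => h; rewrite (rlz_iff hb' dY).
Qed.

Lemma rlz_ren (W W' : Type) (h : W' -> W) (w : W -> U) (b : tup) :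
  rlz q w b -> rlz q (w \o h) b.
Proof.
move=> [Gb hb]; split=> // Y dY.
have E x : esum x (w \o h) = esum x w \o smap id h by apply: funext => -[].
move=> qY; rewrite E; apply: (hb _ (dfn_ren (smap id h) dY)).
by apply: largeS qY => a _; rewrite E.
Qed.

Lemma rlz_realizes_over k (d : 'I_k -> U) (b : tup) :
  rlz q d b <-> realizes_over (MU `|` range d) b q.
Proof.
have rE : MU `|` range d = range (esum d i).
  apply/seteqP; split=> [a [[m _ <-]|[l _ <-]]|a [[l|m] _ <-]].
  - by exists (inr m).
  - by exists (inl l).
  - by right; exists l.
  - by left; exists m.
rewrite /realizes_over rE.
have E (x : tup) (phi : formula L ('I_n + ('I_k + M))) :
    psat x (fmap (smap id (esum d i)) phi) = sat (esum x (esum d i)) phi.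
  by rewrite /psat sat_fmap; congr sat; apply: funext => -[].
split=> [hb theta qtheta /over_rangeE[phi ephi]|h].
  move: qtheta; rewrite ephi E => qphi.
  pose g (s : 'I_n + ('I_k + M)) : ('I_n + 'I_k) + M := match s with
    | inl x => inl (inl x) | inr (inl l) => inl (inr l) | inr (inr m) => inr m end.
  have gE x : sat (esum (esum x d) i) (fmap g phi) = sat (esum x (esum d i)) phi.
    by rewrite sat_fmap; congr sat; apply: funext => -[|[]].
  rewrite -gE; apply: (hb.2 _ (dfn_psat i (fmap g phi))).
  by have /(largeE qS) := qphi; apply: largeS => a _; rewrite gE E.
split.
  have := h (noparam U (gdom G)) qS.2; rewrite /psat /noparam sat_fmap; apply.
  have -> : fmap inl (gdom G) = fmap (smap id (esum d i)) (fmap inl (gdom G)) :> pformula U n.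
    by rewrite fmap_comp.
  exact: over_range.
move=> Y [phi hphi] qY.
pose g (s : ('I_n + 'I_k) + M) : 'I_n + ('I_k + M) := match s with
  | inl (inl x) => inl x | inl (inr l) => inr (inl l) | inr m => inr (inr m) end.
have gE x : sat (esum x (esum d i)) (fmap g phi) = sat (esum (esum x d) i) phi.
  by rewrite sat_fmap; congr sat; apply: funext => -[[]|].
apply/hphi; rewrite -gE -E; apply: h; last exact: over_range.
by apply/(largeE qS); apply: largeS qY => a _; rewrite E gE hphi.
Qed.

End Rlz.

(** Only finitely many entries of [w] occur in the formula defining [Y], and its parameters from M
    stay fixed, so invariance for finite tuples is enough. *)
Lemma large_inv (p : gtype G U) (W : Type) (w w' : W -> U) (Y : ('I_n + W -> U) -> Prop) :
  S_G p -> invariant MU p -> same_tp i i w w' -> dfn i Y ->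
  large p (fun x => Y (esum x w)) -> large p (fun x => Y (esum x w')).
Proof.
move=> pS pinv ww' [phi hphi].
pose g (s : ('I_n + W) + M) : 'I_n + (W + M) := match s with
  | inl (inl x) => inl x | inl (inr l) => inr (inl l) | inr m => inr (inr m) end.
have gE (w0 : W -> U) x : sat (esum (esum x w0) i) phi = sat (esum x (esum w0 i)) (fmap g phi).
  by rewrite sat_fmap; congr sat; apply: funext => -[[]|].
have [k [psi [d e]]] := fmap_split (fmap g phi).
have E (w0 : W -> U) x : Y (esum x w0) <-> psat x (inst psi (esum w0 i \o d)).
  rewrite -hphi gE e /psat /inst !sat_fmap.
  match goal with |- sat ?x _ <-> sat ?y _ => suff -> : x = y by [] end.
  by apply: funext => -[].
have sd : same_type MU (esum w i \o d) (esum w' i \o d).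
  by apply/same_tp_same_type; apply: same_tp_ren; apply: same_tp_params.
have := pinv _ psi _ _ sd; rewrite -!(largeE pS) => -[h _] pY.
have /h : large p (fun a => psat a (inst psi (esum w i \o d))).
  by apply: largeS pY => a _ /E.
by apply: largeS => a _ /E.
Qed.

End TypesM.

(** * The Newelski product and right translates *)

Section Product.
Context (L : language) (kappa : Type) (U M : structure L) (i : M -> U)
  (G : group_formulas L).
Context (st : setting kappa i G).
Local Notation n := (gdim G).
Local Notation tup := (tuples G U).
Local Notation Gp := (@Gpts L G U).
Local Notation gop := (@gop L G U).
Local Notation gopp := (@gopp L G U).
Local Notation dG := (st_group st).
Local Notation MU := (range i).
Local Notation Sinv := (@S_inv L G U MU).
Local Notation Sfs := (@S_fs L G U MU).
Local Notation op := (@newelski L G U MU).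

(** The condition Y(x b, w) on the triple (x, b, w), guarded by membership of x and b in G so that
    it stays definable. *)
Definition mulr (W : Type) (Y : ('I_n + W -> U) -> Prop) (e : 'I_n + ('I_n + W) -> U) :=
  [/\ Gp (e \o inl), Gp (e \o (inr \o inl))
    & Y (esum (gop (e \o inl) (e \o (inr \o inl))) (e \o (inr \o inr)))].

Lemma dfn_mulr (P : Type) (f : P -> U) (W : Type) (Y : ('I_n + W -> U) -> Prop) :
  dfn f Y -> dfn f (mulr Y).
Proof.
move=> dY; apply: dfn_ext (dfn_gop dG (inl \o inl) (inl \o (inr \o inl))
  (dfn_ren (smap id (inr \o inr)) dY)) => e; rewrite /mulr.
set c := gop _ _.
by have -> : esum c e \o smap id (inr \o inr) = esum c (e \o (inr \o inr))
  by apply: funext => -[].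
Qed.

Section Op.
Context (p q : gtype G U) (pS : Sinv p) (qS : S_G q).

(** A realization of q over both parameter families at once links the two sides: realizations of q
    over the same parameters have the same type over M together with them, and p is M-invariant. *)
Lemma op_indep (W1 W2 : Type) (w1 : W1 -> U) (w2 : W2 -> U)
    (Y1 : ('I_n + W1 -> U) -> Prop) (Y2 : ('I_n + W2 -> U) -> Prop) (b1 b2 : tup) :
  small kappa W1 -> small kappa W2 -> dfn i Y1 -> dfn i Y2 ->
  (forall x, Gp x -> Y1 (esum x w1) <-> Y2 (esum x w2)) ->
  rlz i q w1 b1 -> rlz i q w2 b2 ->
  large p (fun x => Y1 (esum (gop x b1) w1)) -> large p (fun x => Y2 (esum (gop x b2) w2)).
Proof.
move=> s1 s2 d1 d2 Y12 h1 h2.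
have [b hb] := rlz_ex st qS (esum w1 w2) (small_sum (st_strong_limit st)
  (small_countable st bool) s1 s2).
have hb1 : rlz i q w1 b := rlz_ren inl hb.
have hb2 : rlz i q w2 b := rlz_ren inr hb.
have Gb := hb.1.
move=> pY1; have {}pY1 : large p (fun x => mulr Y1 (esum x (esum b1 w1))).
  by apply: largeS pY1 => x Gx Y1x; split=> //; exact: h1.1.
have {}pY1 := large_inv pS.1 pS.2 (rlz_same_tp qS h1 hb1) (dfn_mulr d1) pY1.
have pY2 : large p (fun x => mulr Y2 (esum x (esum b w2))).
  apply: largeS pY1 => x Gx [_ _ Y1x]; split=> //.
  exact: (Y12 (gop x b) (gopG st Gx Gb)).1 Y1x.
have {}pY2 := large_inv pS.1 pS.2 (rlz_same_tp qS hb2 h2) (dfn_mulr d2) pY2.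
by apply: largeS pY2 => x Gx [].
Qed.

Lemma op_mem (phi : pformula U n) (W : Type) (w : W -> U) (Y : ('I_n + W -> U) -> Prop)
    (b : tup) :
  small kappa W -> dfn i Y -> (forall x, Gp x -> psat x phi <-> Y (esum x w)) ->
  rlz i q w b -> op p q phi <-> large p (fun x => Y (esum (gop x b) w)).
Proof.
move=> sW dY phiY hb.
have instE k (psi : formula L ('I_n + 'I_k)) (d : 'I_k -> U) x :
    psat x (inst psi d) = sat (esum x d) psi.
  by rewrite /psat /inst sat_fmap; congr sat; apply: funext => -[].
split=> [[k [psi [d [e [b' hb' pb']]]]]|pY].
  have {}hb' := (rlz_realizes_over i qS d b').2 hb'.
  apply: (@op_indep _ _ d w (fun e => sat e psi) Y b' b) => //.
  - exact: (small_countable st).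
  - exact: dfn_sat.
  - by move=> x Gx; rewrite -instE -e phiY.
  - have /(largeE pS.1) := pb'; apply: largeS => x Gx.
    move=> /(psat_subst_mulr _ dG Gx hb'.1); by rewrite instE.
have [k [psi [d e]]] := inst_ex phi.
have [b' hb'] := rlz_ex st qS d (small_countable st 'I_k).
exists k, psi, d; split=> //; exists b'; first exact/(rlz_realizes_over i qS).
apply/(largeE pS.1).
have E x : Gp x -> Y (esum x w) <-> sat (esum x d) psi.
  by move=> Gx; rewrite -phiY// e instE.
have := op_indep sW (small_countable st _) dY (dfn_sat i psi) E hb hb' pY.
by apply: largeS => x Gx; rewrite -instE => h; apply/(psat_subst_mulr _ dG Gx hb'.1).
Qed.

Lemma pformula_dfn2 (phi psi : pformula U n) :
  exists (W : finType) (w : W -> U) (Y Z : ('I_n + W -> U) -> Prop),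
    [/\ dfn i Y, dfn i Z, forall x, psat x phi <-> Y (esum x w)
      & forall x, psat x psi <-> Z (esum x w)].
Proof.
have [W1 [w1 [Y [dY hY]]]] := pformula_dfn i phi.
have [W2 [w2 [Z [dZ hZ]]]] := pformula_dfn i psi.
exists (W1 + W2)%type, (esum w1 w2), (fun e => Y (e \o smap id inl)),
  (fun e => Z (e \o smap id inr)).
split; [exact: dfn_ren|exact: dfn_ren|move=> x|move=> x].
  by rewrite hY; suff -> : esum x (esum w1 w2) \o smap id inl = esum x w1
    by []; apply: funext => -[].
by rewrite hZ; suff -> : esum x (esum w1 w2) \o smap id inr = esum x w2
  by []; apply: funext => -[].
Qed.

Lemma S_G_op : S_G (op p q).
Proof.
have dmul (W : finType) (w : W -> U) Y (b : tup) : dfn i Y -> Gp b ->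
    dfn (A := U) id (fun x : tup => mulr Y (esum x (esum b w))).
  by move=> dY Gb; apply: (dfn_fix (esum b w)) (dfn_mulr dY).
apply: S_G_intro => [phi psi|phi|phi|].
- have [W [w [Y [Z [dY dZ hY hZ]]]]] := pformula_dfn2 phi psi.
  have [b hb] := rlz_ex st qS w (small_countable st W).
  rewrite (op_mem (small_countable st W) dY (fun x _ => hY x) hb).
  rewrite (op_mem (small_countable st W) dZ (fun x _ => hZ x) hb) => pY pZ.
  rewrite (op_mem (small_countable st W) (dfn_and dY dZ) _ hb).
    exact: (large_and pS.1).
  by move=> x _; rewrite /psat /= -/(psat x phi) -/(psat x psi) hY hZ.
- have [W [w [Y [dY hY]]]] := pformula_dfn i phi.
  have [b hb] := rlz_ex st qS w (small_countable st W).
  rewrite (op_mem (small_countable st W) dY (fun x _ => hY x) hb).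
  by move=> /(large_ex pS.1)[a Ga ha]; exists (gop a b); apply/hY.
- have [W [w [Y [dY hY]]]] := pformula_dfn i phi.
  have [b hb] := rlz_ex st qS w (small_countable st W).
  rewrite (op_mem (small_countable st W) dY (fun x _ => hY x) hb).
  rewrite (op_mem (small_countable st W) (dfn_not dY) _ hb); last first.
    by move=> x _; rewrite /psat /= -/(psat x phi) hY.
  have [h|h] := large_dec pS.1 (dmul _ w _ _ dY hb.1); [left|right]; apply: largeS h.
    by move=> a Ga [].
  by move=> a Ga nY Ya; apply: nY; split=> //; exact: hb.1.
- have [b hb] := rlz_ex st qS (fun v : void => match v return U with end)
    (small_countable st void).
  rewrite (op_mem (small_countable st void) (Y := fun e => Gp (e \o inl)) _ _ hb).
  + by apply: (largeT pS.1) => a Ga; apply: (gopG st) => //; exact: hb.1.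
  + exact: (dfn_ren inl (dfn_sat i (gdom G))).
  + by move=> x Gx; rewrite /psat /noparam sat_fmap.
Qed.

Lemma opE (W : Type) (w : W -> U) (Y : ('I_n + W -> U) -> Prop) (b : tup) :
  small kappa W -> dfn i Y -> rlz i q w b ->
  large (op p q) (fun x => Y (esum x w)) <-> large p (fun x => Y (esum (gop x b) w)).
Proof.
move=> sW dY hb; have [phi hphi] := dfn_fix w dY.
rewrite -(op_mem (phi := phi) sW dY _ hb); last by move=> x _; rewrite -hphi.
rewrite -(largeE S_G_op); apply: large_iff => x _; by rewrite -hphi.
Qed.

Lemma rlz_same_tp_inv (W : Type) (w w' : W -> U) (b b' : tup) :
  invariant MU q -> same_tp i i w w' -> rlz i q w b -> rlz i q w' b' ->
  same_tp i i (esum b w) (esum b' w').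
Proof.
move=> qinv ww' hb hb'; apply: dfn_same_tp => Y dY /(rlz_iff qS hb dY) qY.
by apply/(rlz_iff qS hb' dY); apply: large_inv ww' dY qY.
Qed.

Lemma same_tp_invariant (r : gtype G U) :
  (forall k (psi : formula L ('I_n + 'I_k)) (d d' : 'I_k -> U), same_tp i i d d' ->
    r (inst psi d) -> r (inst psi d')) -> invariant MU r.
Proof.
move=> h k psi d d' /same_tp_same_type dd'.
by split; apply: h => //; apply: same_tp_sym.
Qed.

Lemma S_inv_op : invariant MU q -> Sinv (op p q).
Proof.
move=> qinv; split; first exact: S_G_op.
apply: same_tp_invariant => k psi d d' dd'.
have [b hb] := rlz_ex st qS d (small_countable st 'I_k).
have [b' hb'] := rlz_ex st qS d' (small_countable st 'I_k).
have dpsi : dfn i (fun e : 'I_n + 'I_k -> U => sat e psi) by exact: dfn_sat.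
rewrite (op_mem (small_countable st _) dpsi (fun x _ => psat_inst psi d x) hb).
rewrite (op_mem (small_countable st _) dpsi (fun x _ => psat_inst psi d' x) hb') => h.
have {}h : large p (fun x => mulr (fun e => sat e psi) (esum x (esum b d))).
  by apply: largeS h => x Gx hx; split=> //; exact: hb.1.
have := large_inv pS.1 pS.2 (rlz_same_tp_inv qinv dd' hb hb') (dfn_mulr dpsi) h.
by apply: largeS => x Gx [].
Qed.

End Op.

(** With c realizing r over w, and b realizing q over c and w, the element b c realizes q * r over
    w, so both sides evaluate the formula at x b c. *)
Lemma opA (p q r : gtype G U) : Sinv p -> Sinv q -> Sinv r ->
  op (op p q) r = op p (op q r).
Proof.
move=> pS qS rS.
have pqS := S_inv_op pS qS.1 qS.2; have qrS := S_inv_op qS rS.1 rS.2.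
apply: tp_eq; [exact: (S_G_op pqS rS.1)|exact: (S_G_op pS qrS.1)|move=> phi].
have [W [w [Y [dY hY]]]] := pformula_dfn i phi; have sW := small_countable st W.
have [c hc] := rlz_ex st rS.1 w sW; have Gc := hc.1.
have [b hb] := rlz_ex st qS.1 (esum c w) (small_countable st _); have Gb := hb.1.
have hbc : rlz i (op q r) w (gop b c).
  split=> [|Z dZ]; first exact: (gopG st).
  rewrite (opE qS rS.1 sW dZ hc) => qZ.
  have : mulr Z (esum b (esum c w)).
    by apply/(rlz_iff qS.1 hb (dfn_mulr dZ)); apply: largeS qZ => x Gx Zx; split.
  by case.
rewrite (op_mem pqS rS.1 sW dY (fun x _ => hY x) hc).
rewrite (op_mem pS qrS.1 sW dY (fun x _ => hY x) hbc) => h.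
have {}h : large (op p q) (fun x => mulr Y (esum x (esum c w))).
  by apply: largeS h => x Gx Yx; split.
have {}h := (opE pS qS.1 (small_countable st _) (dfn_mulr dY) hb).1 h.
by apply: largeS h => x Gx [_ _ Yx]; rewrite -(gopA st Gx Gb Gc).
Qed.

Lemma Sfs_large (p : gtype G U) (X : tup -> Prop) :
  Sfs p -> large p X -> exists2 m, GM i m & X m.
Proof.
move=> [pS pfs] [phi pphi h].
have [m mM hm] := pfs _ (tp_and pS pphi pS.2).
have [hphi] : psat m phi /\ psat m (noparam U (gdom G)) := hm.
rewrite /psat /noparam sat_fmap => Gm.
exists m; last by apply: h.
exact: GM_of.
Qed.

Lemma Sfs_intro (p : gtype G U) :
  S_G p -> (forall phi, p phi -> exists2 m, GM i m & psat m phi) -> Sfs p.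
Proof.
move=> pS h; split=> // phi /h[m [Gm [m0 em]] hm]; exists m => // k.
by rewrite em; exists (m0 k).
Qed.

Lemma dfn_atM (W : Type) (Y : ('I_n + W -> U) -> Prop) (m : tup) :
  GM i m -> dfn i Y -> dfn i (fun w => Y (esum m w)).
Proof.
move=> [_ [m0 ->]] dY; apply: dfn_ext (dfn_sub (esum (inr \o m0) inl) dY) => e.
suff -> : esum e i \o esum (inr \o m0) inl = esum (i \o m0) e by [].
by apply: funext => -[].
Qed.

(** If p contained psi(x, d) and the negation of psi(x, d'), some point of M would satisfy both,
    although d and d' have the same type over M. *)
Lemma Sfs_inv (p : gtype G U) : Sfs p -> Sinv p.
Proof.
move=> pf; have pS := pf.1; split=> //.
apply: same_tp_invariant => k psi d d' dd' h.
apply: contrapT => /(tp_not pS) h'.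
have /(largeE pS)/(Sfs_large pf)[m mM hm] := tp_and pS h h'.
have [h1] : psat m (inst psi d) /\ ~ psat m (inst psi d') := hm.
move: h1; rewrite !psat_inst => h1; apply.
by apply/(same_tp_dfn dd' (dfn_atM mM (dfn_sat i psi))).
Qed.

(** Finite satisfiability is used twice: for p to replace x by a point of M, and then for q to
    replace b. *)
Lemma S_fs_op (p q : gtype G U) : Sfs p -> Sfs q -> Sfs (op p q).
Proof.
move=> pf qf; have pS := Sfs_inv pf; have qS := Sfs_inv qf.
apply: Sfs_intro => [|phi]; first exact: (S_G_op pS qS.1).
have [W [w [Y [dY hY]]]] := pformula_dfn i phi; have sW := small_countable st W.
have [b hb] := rlz_ex st qS.1 w sW; have Gb := hb.1.
rewrite (op_mem pS qS.1 sW dY (fun x _ => hY x) hb) => /(Sfs_large pf)[m mM Ym].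
have : mulr Y (esum m (esum b w)) by split=> //; exact: mM.1.
move=> /(rlz_iff qS.1 hb (dfn_atM mM (dfn_mulr dY)))/(Sfs_large qf)[m' m'M [_ _ Y']].
by exists (gop m m'); [exact: (GM_gop st)|apply/hY].
Qed.

End Product.

Section Translate.
Context (L : language) (kappa : Type) (U M : structure L) (i : M -> U)
  (G : group_formulas L).
Context (st : setting kappa i G).
Local Notation n := (gdim G).
Local Notation tup := (tuples G U).
Local Notation Gp := (@Gpts L G U).
Local Notation gop := (@gop L G U).
Local Notation gopp := (@gopp L G U).
Local Notation dG := (st_group st).
Local Notation MU := (range i).
Local Notation Sinv := (@S_inv L G U MU).
Local Notation Sfs := (@S_fs L G U MU).
Local Notation op := (@newelski L G U MU).
Local Notation rt := (@right_translate L G U).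

Lemma rtE (p : gtype G U) (c : tup) (phi : pformula U n) : S_G p -> Gp c ->
  rt p c phi <-> large p (fun x => psat (gop x c) phi).
Proof.
move=> pS Gc; rewrite /right_translate /= -(largeE pS).
by apply: large_iff => a Ga; apply: (psat_subst_mulr _ dG).
Qed.

Lemma S_G_rt (p : gtype G U) (c : tup) : S_G p -> Gp c -> S_G (rt p c).
Proof.
move=> pS Gc; apply: S_G_intro => [phi psi|phi|phi|].
- by rewrite !rtE//; apply: large_and.
- by rewrite rtE// => /(large_ex pS)[a Ga ha]; exists (gop a c).
- have [h|/(largeE pS) h] := pS.1.2 (subst_mulr phi c); [by left|right].
  by apply/rtE => //; apply: largeS h => a Ga /= na /(psat_subst_mulr _ dG Ga Gc).
- apply/rtE => //; apply: (largeT pS) => a Ga.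
  by rewrite /psat /noparam sat_fmap; apply: (gopG st).
Qed.

Lemma large_rt_imp (p : gtype G U) (c : tup) (X : tup -> Prop) : S_G p -> Gp c ->
  large (rt p c) X -> large p (fun x => X (gop x c)).
Proof.
move=> pS Gc [phi /(rtE _ pS Gc) h hX]; apply: largeS h => a Ga; apply: hX.
exact: (gopG st).
Qed.

Lemma large_rt (p : gtype G U) (c : tup) (X : tup -> Prop) : S_G p -> Gp c ->
  dfn (A := U) id X -> large (rt p c) X <-> large p (fun x => X (gop x c)).
Proof.
move=> pS Gc [phi hphi]; split; first exact: large_rt_imp.
by move=> h; exists phi => [|a Ga /hphi//]; apply/rtE => //; apply: largeS h => a Ga /hphi.
Qed.

Lemma rt_rt (p : gtype G U) (c b : tup) : S_G p -> Gp c -> Gp b ->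
  rt (rt p c) b = rt p (gop c b).
Proof.
move=> pS Gc Gb; have pcS := S_G_rt pS Gc; have Gcb := gopG st Gc Gb.
apply: tp_eq; [exact: S_G_rt|exact: S_G_rt|move=> phi].
rewrite !rtE// => /large_rt_imp h; apply: largeS (h pS Gc) => a Ga.
by rewrite (gopA st).
Qed.

Lemma rt_one (p : gtype G U) : S_G p -> rt p (gone st) = p.
Proof.
move=> pS; have G1 := goneG st; apply: tp_eq => // [|phi]; first exact: S_G_rt.
rewrite rtE// => h; apply/(largeE pS); apply: largeS h => a Ga.
by rewrite (gop1r st).
Qed.

Lemma rt_cancel (p q : gtype G U) (c : tup) : S_G p -> S_G q -> Gp c ->
  rt p c = rt q c -> p = q.
Proof.
move=> pS qS Gc e; have Gc' := goppG st Gc.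
by rewrite -(rt_one pS) -(rt_one qS) -(gopV st Gc) -!rt_rt// e.
Qed.

Lemma dfn_mulrM (W : Type) (Y : ('I_n + W -> U) -> Prop) (m : tup) :
  GM i m -> dfn i Y ->
  dfn i (fun e : 'I_n + W -> U => mulr Y (esum (e \o inl) (esum m (e \o inr)))).
Proof.
move=> [_ [m0 ->]] dY.
pose h (s : 'I_n + ('I_n + W)) : ('I_n + W) + M := match s with
  | inl x => inl (inl x) | inr (inl k) => inr (m0 k) | inr (inr w) => inl (inr w) end.
apply: dfn_ext (dfn_sub h (dfn_mulr st dY)) => e.
suff -> : esum e i \o h = esum (e \o inl) (esum (i \o m0) (e \o inr)) by [].
by apply: funext => -[|[]].
Qed.

Lemma same_tp_atM (W : Type) (w w' : W -> U) (m : tup) : GM i m ->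
  same_tp i i w w' -> same_tp i i (esum m w) (esum m w').
Proof.
move=> mM ww'; apply: dfn_same_tp => Y dY.
by rewrite (same_tp_dfn ww' (dfn_atM mM dY)).
Qed.

Lemma rt_Sinv (p : gtype G U) (m : tup) : Sinv p -> GM i m -> Sinv (rt p m).
Proof.
move=> [pS pinv] mM; have Gm := mM.1; split; first exact: S_G_rt.
apply: same_tp_invariant => k psi d d' dd'; rewrite !rtE// => h.
have dpsi : dfn i (fun e : 'I_n + 'I_k -> U => sat e psi) by exact: dfn_sat.
have {}h : large p (fun x => mulr (fun e => sat e psi) (esum x (esum m d))).
  by apply: largeS h => x Gx /psat_inst hx; split.
have := large_inv pS pinv (same_tp_atM mM dd') (dfn_mulr st dpsi) h.
by apply: largeS => x Gx [_ _ hx]; apply/psat_inst.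
Qed.

(** If b realizes q over some parameters, then b m realizes q.m over them, as m lies in M. *)
Lemma op_rt_r (p q : gtype G U) (m : tup) : Sinv p -> S_G q -> GM i m ->
  op p (rt q m) = rt (op p q) m.
Proof.
move=> pS qS mM; have Gm := mM.1; have qmS := S_G_rt qS Gm.
have pqS := S_G_op st pS qS.
apply: tp_eq; [exact: (S_G_op st pS qmS)|exact: S_G_rt|move=> phi].
have [W [w [Y [dY hY]]]] := pformula_dfn i phi; have sW := small_countable st W.
have [b hb] := rlz_ex st qS w sW; have Gb := hb.1.
have hbm : rlz i (rt q m) w (gop b m).
  split=> [|Z dZ]; first exact: (gopG st).
  move=> /(large_rt_imp qS Gm) qZ.
  have [_ _] : mulr Z (esum b (esum m w)); last by [].
  apply: (hb.2 _ (dfn_mulrM mM dZ)).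
  by apply: largeS qZ => x Gx Zx; split.
rewrite (op_mem st pS qmS sW dY (fun x _ => hY x) hbm) rtE// => h.
have {}h : large p (fun x => mulr Y (esum (gop x b) (esum m w))).
  apply: largeS h => x Gx Yx; split=> //; first exact: (gopG st).
  by rewrite /= (gopA st).
have := (opE st pS qS sW (dfn_mulrM mM dY) hb).2 h.
by apply: largeS => x Gx [_ _ Yx]; apply/hY.
Qed.

(** Commutativity enters here through x m b = x b m. *)
Lemma op_rt_l (p q : gtype G U) (m : tup) : Sinv p -> S_G q -> GM i m ->
  op (rt p m) q = rt (op p q) m.
Proof.
move=> pS qS mM; have Gm := mM.1; have pmS := rt_Sinv pS mM.
have pqS := S_G_op st pS qS.
apply: tp_eq; [exact: (S_G_op st pmS qS)|exact: S_G_rt|move=> phi].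
have [W [w [Y [dY hY]]]] := pformula_dfn i phi; have sW := small_countable st W.
have [b hb] := rlz_ex st qS w sW; have Gb := hb.1.
rewrite (op_mem st pmS qS sW dY (fun x _ => hY x) hb) rtE//.
move=> /(large_rt_imp pS.1 Gm) h.
have {}h : large p (fun x => mulr Y (esum (gop x b) (esum m w))).
  apply: largeS h => x Gx Yx; split=> //; first exact: (gopG st).
  by rewrite /= (gopAC st).
have := (opE st pS qS sW (dfn_mulrM mM dY) hb).2 h.
by apply: largeS => x Gx [_ _ Yx]; apply/hY.
Qed.

Definition tpM (m : tup) : gtype G U := [set phi | psat m phi].

Lemma tpM_Sfs (m : tup) : GM i m -> Sfs (tpM m).
Proof.
move=> mM; apply: Sfs_intro => [|phi h]; last by exists m.
apply: S_G_intro => [phi psi|phi h|phi|] //; first by exists m.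
  exact: EM.
by rewrite /tpM /psat /= /noparam sat_fmap; case: mM.
Qed.

(** Commutativity turns the left translate of q by m into the right one. Hence left ideals of S^fs
    are stable under right translation by G(M). *)
Lemma op_tpM (m : tup) (q : gtype G U) : GM i m -> S_G q -> op (tpM m) q = rt q m.
Proof.
move=> mM qS; have Gm := mM.1; have tS := Sfs_inv (tpM_Sfs mM).
apply: tp_eq; [exact: (S_G_op st tS qS)|exact: S_G_rt|move=> phi].
have [W [w [Y [dY hY]]]] := pformula_dfn i phi; have sW := small_countable st W.
have [b hb] := rlz_ex st qS w sW; have Gb := hb.1.
rewrite (op_mem st tS qS sW dY (fun x _ => hY x) hb) rtE// => -[psi hpsi /(_ _ Gm hpsi) Yb].
have : mulr Y (esum m (esum b w)) by split.
move=> /(rlz_iff qS hb (dfn_atM mM (dfn_mulr st dY))).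
by apply: largeS => x Gx [_ _ Yx]; apply/hY; rewrite (gopC st).
Qed.

(** * The stabilizer of a strong f-generic type *)

(** A formula satisfied by (e, w) gives an existential formula true of e, hence of e'; saturation
    realizes all of them by one w'. *)
Lemma same_tp_extend (V W : finType) (e e' : V -> U) (w : W -> U) :
  same_tp i i e e' -> exists w', same_tp i i (esum e w) (esum e' w').
Proof.
move=> ee'.
have [|||w' hw'] := realize st (esum e' i) (V := W) (D :=
    [set X | exists2 Y : (V + W -> U) -> Prop, dfn i Y /\ Y (esum e w)
       & X = fun w' => Y (esum e' w')]).
- by apply: (small_addM st); exact: (small_countable st).
- move=> _ _ [Y [dY Yw] ->] [Z [dZ Zw] ->].
  exists (fun w' => Y (esum e' w') /\ Z (esum e' w')) => //.
  by exists (fun e => Y e /\ Z e) => //; split=> //; apply: dfn_and.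
- move=> _ [Y [dY Yw] ->].
  pose h (s : V + W) : W + V := match s with inl v => inr v | inr w => inl w end.
  have E (e0 : V -> U) w0 : esum w0 e0 \o h = esum e0 w0 by apply: funext => -[].
  have [w0] : exists w0, Y (esum w0 e' \o h).
    apply/(same_tp_dfn ee' (dfn_ex (dfn_ren h dY))).
    by exists w; rewrite E.
  by rewrite E; exists w0.
exists w'; apply: dfn_same_tp => Y dY Yw.
apply: (hw' (fun w0 => Y (esum e' w0)) (fun w0 => Y (esum e' w0))) => //.
  by exists Y.
pose h (s : V + W) : W + V := match s with inl v => inr v | inr w => inl w end.
apply: dfn_ext (dfn_join e' (dfn_ren h dY)) => w0.
suff -> : esum w0 e' \o h = esum e' w0 by [].
by apply: funext => -[].
Qed.

Section Fgeneric.
Context (t : gtype G U) (tF : strong_right_f_generic MU t).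

Lemma Fr_Sinv : Sinv t. Proof. by case: tF. Qed.
Local Notation tS := (Fr_Sinv.1).

(** Invariance of t moves (b, d) to some (b', d'), and invariance of the translate t.b' moves d'
    back to d. The second move is where strong f-genericity enters. *)
Lemma Fr_rt_same_tp (b b' : tup) : Gp b -> Gp b' ->
  same_tp i i b b' -> rt t b = rt t b'.
Proof.
move=> Gb Gb' bb'; apply: tp_eq; [exact: (S_G_rt tS)|exact: (S_G_rt tS)|move=> phi].
have [k [psi [d ->]]] := inst_ex phi; rewrite (rtE _ tS Gb) => h.
have [d' dd'] := same_tp_extend d bb'.
have dpsi : dfn i (fun e : 'I_n + 'I_k -> U => sat e psi) by exact: dfn_sat.
have {}h : large t (fun x => mulr (fun e => sat e psi) (esum x (esum b d))).
  by apply: largeS h => x Gx /psat_inst hx; split.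
have {}h := large_inv tS Fr_Sinv.2 dd' (dfn_mulr st dpsi) h.
have {}h : rt t b' (inst psi d').
  by apply/(rtE _ tS Gb'); apply: largeS h => x Gx [_ _ hx]; apply/psat_inst.
have [_ /(_ _ Gb') inv'] := tF.
apply/(inv' _ psi _ d') => //; apply/same_tp_same_type.
exact: (same_tp_ren inr dd').
Qed.

Definition stab : set tup := [set g | Gp g /\ rt t g = t].

Lemma stab_gop (g h : tup) : stab g -> stab h -> stab (gop g h).
Proof.
move=> [Gg tg] [Gh th]; split; first exact: (gopG st).
by rewrite -(rt_rt tS)// tg.
Qed.

Lemma stab_opp (g : tup) : stab g -> stab (gopp g).
Proof.
move=> [Gg tg]; have Gg' := goppG st Gg; split=> //.
by rewrite -[in LHS]tg (rt_rt tS)// (gopV st Gg) (rt_one tS).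
Qed.

Lemma stab_one : stab (gone st).
Proof. by split; [exact: goneG|exact: (rt_one tS)]. Qed.

Lemma stab_subgroup : subgroup stab.
Proof.
split; first by move=> g [].
split=> [|x y z [? _] [? _] [? _]|]; first exact: stab_gop.
  exact: (gopA st).
exists (gone st); split; first exact: stab_one.
  by move=> x [Gx _]; rewrite (gop1l st) ?(gop1r st).
move=> x xH; have [Gx _] := xH; exists (gopp x).
by split; [exact: stab_opp|exact: (gopV st)|exact: (gopVl st)].
Qed.

Lemma stab_same_tp (g h : tup) : Gp g -> same_tp i i h g -> stab h -> stab g.
Proof. by move=> Gg hg [Gh th]; split=> //; rewrite -(Fr_rt_same_tp Gh Gg hg). Qed.

(* Some h in the stabilizer has the type of g over M, because h is a
   quotient of two elements with the same type over M. *)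
Lemma stab_closed (g : tup) :
  (forall X : ('I_n -> U) -> Prop, dfn i X -> (forall h, stab h -> X h) -> X g) -> stab g.
Proof.
move=> gX; have Gg : Gp g by apply: (gX _ (dfn_sat i (gdom G))) => h [].
(* The conditions on a pair (a, h) ask that h be in the stabilizer and in a given M-definable set
   containing g, and that a realize t over M and h. In the limit only their consequences over M
   survive. *)
have [|||e he] := realize st i (V := ('I_n + 'I_n)%type) (D :=
    [set Z | exists2 X : ('I_n -> U) -> Prop, dfn i X /\ X g
       & Z = fun e => [/\ stab (e \o inr), X (e \o inr) & rlz i t (e \o inr) (e \o inl)]]).
- exact: (small_M st).
- move=> _ _ [X [dX Xg] ->] [Y [dY Yg] ->].
  exists (fun e => [/\ stab (e \o inr), X (e \o inr) /\ Y (e \o inr)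
     & rlz i t (e \o inr) (e \o inl)]); last by move=> e [? []].
  by exists (fun e => X e /\ Y e) => //; split=> //; apply: dfn_and.
- move=> _ [X [dX Xg] ->].
  have [h [sh Xh]] : exists h, stab h /\ X h.
    apply: contrapT => none; apply: (gX _ (dfn_not dX)) => // h sh Xh.
    by apply: none; exists h.
  have [a ha] := rlz_ex st tS h (small_countable st 'I_n).
  by exists (esum a h).
pose D0 (X : ('I_n -> U) -> Prop) (e : 'I_n + 'I_n -> U) :=
  [/\ stab (e \o inr), X (e \o inr) & rlz i t (e \o inr) (e \o inl)].
have {}he X Y : dfn i X -> X g -> dfn i Y -> (forall e, D0 X e -> Y e) -> Y e.
  by move=> dX Xg dY; apply: he => //; exists X.
pose a : tup := e \o inl; pose h : tup := e \o inr.
have Ga : Gp a.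
  apply: (he Gp (fun e => Gp (e \o inl))) => //; first exact: dfn_sat.
    exact: (dfn_ren inl (dfn_sat i (gdom G))).
  by move=> e' [_ _ []].
have gh : same_tp i i h g.
  apply: same_tp_sym; apply: dfn_same_tp => X dX Xg.
  apply: (he X (fun e => X (e \o inr))) => //; first exact: (dfn_ren inr dX).
  by move=> e' [].
have Gh : Gp h by apply/(same_tp_dfn gh (dfn_sat i (gdom G))).
(* Before the limit, h' fixes t and a' realizes t over M and h', so a' h' satisfies every formula
   over M that a' does. This is a consequence over M of the conditions, so it holds for (a, h)
   too. *)
have aah : same_tp i i a (gop a h).
  apply: dfn_same_tp => X dX Xa.
  pose Y (e : 'I_n + 'I_n -> U) := X (e \o inl) ->
    mulr (fun e : 'I_n + void -> U => X (e \o inl)) (e \o esum inl (esum inr (fun v : void => match v with end))).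
  have dY : dfn i Y.
    apply: dfn_imp; first exact: (dfn_ren inl dX).
    exact: (dfn_ren _ (dfn_mulr st (dfn_ren inl dX))).
  have : Y e; last by move=> /(_ Xa)[].
  apply: (he Gp Y) => //; first exact: dfn_sat.
  move=> e' [[Gh' th'] _ ha'] Xa'.
  have Ga' := ha'.1; split=> //.
  have tX : large t (fun x => X (x : tup)).
    exact: (rlz_iff tS ha' (dfn_ren inl dX)).1 Xa'.
  rewrite -th' in tX; have {}tX := large_rt_imp tS Gh' tX.
  pose Z (e : 'I_n + 'I_n -> U) :=
    mulr (fun e : 'I_n + void -> U => X (e \o inl)) (e \o esum inl (esum inr (fun v : void => match v with end))).
  have dZ : dfn i Z by exact: (dfn_ren _ (dfn_mulr st (dfn_ren inl dX))).
  have [_ _] : Z (esum (e' \o inl) (e' \o inr)); last by [].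
  apply: (ha'.2 _ dZ); by apply: largeS tX => x Gx Xx; split.
(* (t.h).a = t.(a h) = t.a, and a can be cancelled. *)
have th : rt t h = t.
  have e1 : rt (rt t h) a = rt t a.
    rewrite (rt_rt tS)// (gopC st)//.
    by apply/esym/Fr_rt_same_tp => //; apply: (gopG st).
  exact: rt_cancel (S_G_rt tS Gh) tS Ga e1.
exact: stab_same_tp gh (conj Gh th).
Qed.

End Fgeneric.
End Translate.

(** * Index of the stabilizer and products with a strong f-generic type *)

Section Components.
Context (L : language) (kappa : Type) (U M : structure L) (i : M -> U)
  (G : group_formulas L).
Context (st : setting kappa i G).
Local Notation n := (gdim G).
Local Notation tup := (tuples G U).
Local Notation Gp := (@Gpts L G U).
Local Notation gop := (@gop L G U).
Local Notation gopp := (@gopp L G U).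
Local Notation dG := (st_group st).
Local Notation MU := (range i).
Local Notation Sinv := (@S_inv L G U MU).
Local Notation Sfs := (@S_fs L G U MU).
Local Notation op := (@newelski L G U MU).
Local Notation rt := (@right_translate L G U).

(** Such a formula is a formula in natural-number variables together with the finite list of what
    they stand for. *)
Lemma small_formula : small kappa (formula L ('I_n + M)).
Proof.
have slk := st_strong_limit st; have [_ sL _ _] := st_monster st.
have sV : small kappa ('I_n + M) by apply: (small_addM st); exact: (small_countable st).
have [m0] := dom_inhabited M.
apply: card_le_small (small_prod slk sL (small_seq slk (small_nat st) sV)).
pose f (x : formula L nat * seq ('I_n + M)) := fmap (nth (inr m0) x.2) x.1.
apply: (@surj_card_leT _ _ f) => phi.
have [W [v [psi ->]]] := fmap_finite_vars phi.
exists (fmap (fun w => nat_of_ord (enum_rank w)) psi, [seq v w | w <- enum W]).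
rewrite /f /= fmap_comp; congr fmap; apply: funext => w /=.
by rewrite (nth_map w) ?nth_enum_rank// -cardE ltn_ord.
Qed.

Section Fgeneric.
Context (t : gtype G U) (tF : strong_right_f_generic MU t).
Local Notation tS := (Fr_Sinv tF).

Lemma stab_bounded : bounded_index kappa (stab t).
Proof.
have [h h'] := small_set (st_strong_limit st) (small_set (st_strong_limit st) small_formula).
(* A coset is sent to the set of all types over M of its representatives. This avoids choosing one
   and costs a second power set. *)
pose f (C : set tup) : set (set (formula L ('I_n + M))) :=
  [set [set phi | sat (esum g i) phi] | g in [set g | Gp g /\ C = coset (stab t) g]].
have le : (coset (stab t) @` Gp #<= [set: set (set (formula L ('I_n + M)))])%card.
  apply: (@inj_on_card_le _ _ _ _ f) => // C C'.
  rewrite !in_setE => -[g Gg <-] [g1 Gg1 <-] e.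
  have : f (coset (stab t) g1) [set phi | sat (esum g i) phi].
    by rewrite -e; exists g.
  move=> [g' [Gg' ->] /seteqP[e1 e2]].
  have tgg' : rt t g = rt t g'.
    by apply: (Fr_rt_same_tp st tF) => // phi; split; [apply: e2|apply: e1].
  have sub (a b : tup) : Gp a -> Gp b -> rt t a = rt t b ->
      coset (stab t) a `<=` coset (stab t) b.
    move=> Ga Gb ab _ [x [Gx tx] <-]; have Gb' := goppG st Gb.
    have Gab := gopG st Ga Gb'.
    have sab : stab t (gop a (gopp b)).
      split=> //; rewrite -(rt_rt st tS.1)// ab (rt_rt st tS.1)// (gopV st Gb).
      exact: (rt_one st tS.1).
    exists (gop (gop a (gopp b)) x).
      by apply: (stab_gop st tF).
    rewrite -(gopA st Gb Gab Gx); congr gop.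
    by rewrite (gopC st Gb Gab) (gopVK st Ga Gb).
  by apply/seteqP; split; apply: sub.
split; first exact: card_le_trans h.
by move=> k; apply: h'; apply: card_le_trans le.
Qed.

Lemma stab_type_definable : type_definable (kappa_small kappa (X := U)) (stab t).
Proof.
have E (a : tup) (phi : formula L ('I_n + M)) :
    psat a (fmap (smap id i) phi) = sat (esum a i) phi.
  by rewrite /psat sat_fmap; congr sat; apply: funext => -[].
exists MU, [set fmap (smap id i) phi | phi in
  [set phi | forall h, stab t h -> sat (esum h i) phi]]; split.
- exact: st_small st.
- by move=> _ [phi _ <-]; apply: over_range.
- apply/seteqP; split=> [h sh _ [phi hphi <-]|g hg]; first by rewrite E; apply: hphi.
  apply: (stab_closed st tF) => X [phi hphi] hX; apply/hphi.
  by rewrite -E; apply: hg; exists phi => // h /hX/hphi.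
Qed.

Lemma G00_sub_stab (G00 : set tup) : is_G00 kappa G00 -> G00 `<=` stab t.
Proof.
move=> [_]; apply; split; [exact: (stab_subgroup st tF)|exact: stab_type_definable|].
exact: stab_bounded.
Qed.

(** As G^00 fixes t, a representative in M of the coset of g translates t as g does. This is all
    that is kept of the hypothesis on cosets. *)
Lemma G00_rep (G00 : set tup) : is_G00 kappa G00 ->
  (forall g, Gp g -> exists m : tup, [/\ Gp m, forall k, MU (m k) & coset G00 g m]) ->
  forall g, Gp g -> exists2 m, GM i m & rt t g = rt t m.
Proof.
move=> /G00_sub_stab sub reps g Gg; have [m [Gm mM [h /sub[Gh th] e]]] := reps g Gg.
exists m; first exact: GM_of.
by rewrite -e (gopC st)// -(rt_rt st tS.1)// th.
Qed.

Definition venv (v : void) : U := match v with end.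

(** The product asks for a realization of q over M and the parameters of the formula; here one over
    M alone suffices, because t.b depends only on the type of b over M. *)
Lemma op_Fr (q : gtype G U) (b : tup) : S_G q -> rlz i q venv b -> op t q = rt t b.
Proof.
move=> qS hb; have Gb := hb.1.
apply: tp_eq; [exact: (S_G_op st tS qS)|exact: (S_G_rt st tS.1 Gb)|move=> phi].
have [W [w [Y [dY hY]]]] := pformula_dfn i phi; have sW := small_countable st W.
have [b' hb'] := rlz_ex st qS w sW; have Gb' := hb'.1.
rewrite (op_mem st tS qS sW dY (fun x _ => hY x) hb') => h.
have bb' : same_tp i i b' b.
  have hv : rlz i q venv b'.
    have := rlz_ren (fun v : void => match v with end) hb'.
    by congr rlz; apply: funext => -[].
  exact: (same_tp_ren inl (rlz_same_tp qS hv hb)).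
rewrite -(Fr_rt_same_tp st tF Gb' Gb bb') (rtE st _ tS.1 Gb').
by apply: largeS h => x Gx Yx; apply/hY.
Qed.

Lemma op_Fr_tpM (m : tup) : GM i m -> op t (tpM m) = rt t m.
Proof.
move=> mM; apply: op_Fr; first exact: (tpM_Sfs mM).1.
by split=> [|Y dY [phi hphi hY]]; [case: mM|apply: hY => //; case: mM].
Qed.

End Fgeneric.

(** * The group of G(M)-translates of an idempotent *)

Definition orbitM (p : gtype G U) : set (gtype G U) := [set rt p m | m in [set m : tup | GM i m]].

Section Idempotent.
Context (p : gtype G U) (pS : Sinv p) (pp : op p p = p).

(** Translations by G(M) can be pulled out of both factors, so m |-> p.m is a homomorphism on
    G(M). *)
Lemma op_orbit (m m' : tup) : GM i m -> GM i m' ->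
  op (rt p m) (rt p m') = rt p (gop m m').
Proof.
move=> mM m'M; have Gm := mM.1; have Gm' := m'M.1.
rewrite (op_rt_l st pS (S_G_rt st pS.1 Gm') mM) (op_rt_r st pS pS.1 m'M) pp.
by rewrite (rt_rt st pS.1)// (gopC st).
Qed.

Lemma orbit_group : is_group op (orbitM p).
Proof.
split=> [_ _ [m mM <-] [m' m'M <-]|_ _ _ [a aM <-] [b bM <-] [c cM <-]|].
- by rewrite op_orbit//; exists (gop m m') => //; apply: (GM_gop st).
- rewrite !op_orbit//; [|exact: (GM_gop st)|exact: (GM_gop st)].
  by rewrite (gopA st) //; [case: aM|case: bM|case: cM].
exists p; split.
- by exists (gone st); [exact: GM_one|exact: (rt_one st pS.1)].
- move=> _ [m mM <-]; have Gm := mM.1; have M1 := GM_one st; have G1 := goneG st.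
  have e1 := op_orbit M1 mM; have e2 := op_orbit mM M1.
  by move: e1 e2; rewrite (rt_one st pS.1) (gop1l st Gm) (gop1r st Gm).
- move=> _ [m mM <-]; have Gm := mM.1; have m'M := GM_opp st mM.
  exists (rt p (gopp m)); split; first by exists (gopp m).
    by rewrite op_orbit// (gopV st Gm) (rt_one st pS.1).
  by rewrite op_orbit// (gopVl st Gm) (rt_one st pS.1).
Qed.

End Idempotent.

Section FgenericIdempotent.
Context (t : gtype G U) (tF : strong_right_f_generic MU t) (tt : op t t = t).
Hypothesis reps : forall g, Gp g -> exists2 m, GM i m & rt t g = rt t m.
Local Notation tS := (Fr_Sinv tF).

Lemma op_Fr_ex (q : gtype G U) : S_G q -> exists2 m, GM i m & op t q = rt t m.
Proof.
move=> qS; have [b hb] := rlz_ex st qS venv (small_countable st void).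
have [m mM e] := reps hb.1; exists m => //.
by rewrite (op_Fr tF qS hb).
Qed.

Lemma op_Fr_orbit : op t @` Sinv = orbitM t.
Proof.
apply/seteqP; split=> [_ [q qS <-]|_ [m mM <-]].
  by have [m mM ->] := op_Fr_ex qS.1; exists m.
by exists (tpM m); [exact: (Sfs_inv (tpM_Sfs mM))|exact: op_Fr_tpM].
Qed.

Lemma Fr_ellis : ellis_subgroup op Sinv (op t @` Sinv).
Proof.
exists [set op q t | q in Sinv], t; split=> //.
- split.
    split; first by exists (op t t), t; first exact: tS.
      by move=> _ [q qS <-]; apply: (S_inv_op st qS tS.1 tS.2).
    move=> x _ xS [q qS <-]; exists (op x q); last exact: (opA st xS qS tS).
    exact: (S_inv_op st xS qS.1 qS.2).
  move=> J [[y Jy] JS JI] JK; apply/seteqP; split=> // _ [q qS <-]; apply: (JI) => //.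
  (* For y in J one has t * y = t.m; multiplying on the left by the translate of t by the inverse of
     m puts t itself into J. *)
  have [m mM e] := op_Fr_ex (JS _ Jy).1.
  have m'M := GM_opp st mM; have tm'S := rt_Sinv st tS m'M.
  have := JI _ _ tm'S (JI _ _ tS Jy).
  by rewrite e op_orbit//; [rewrite (gopVl st mM.1) (rt_one st tS.1)|exact: tS].
- by exists t => //; exact: tS.
- apply/seteqP; split=> [_ [q qS <-]|_ [_ [q qS <-] <-]].
    have [m mM ->] := op_Fr_ex qS.1; have tmS := rt_Sinv st tS mM.
    exists (op (rt t m) t); first by exists (rt t m).
    by rewrite (op_rt_l st tS tS.1 mM) (op_rt_r st tS (S_G_op st tS tS.1) mM) !tt.
  by exists (op q t) => //; apply: (S_inv_op st qS tS.1 tS.2).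
Qed.

End FgenericIdempotent.

(** * Inversion *)

Lemma psat_subst_invE (phi : pformula U n) (a : tup) : Gp a ->
  psat a (subst_inv phi) <-> psat (gopp a) phi.
Proof.
move=> Ga; have E (b : tup) (psi : pformula U n) : psat b (pmap id psi) = psat b psi.
  by rewrite /psat /pmap sat_fmap; congr sat; apply: funext => -[].
by rewrite -E -[X in _ <-> X]E; apply: (psat_subst_inv id _ dG).
Qed.

Lemma mem_inv_type (p : gtype G U) (phi : pformula U n) : S_G p ->
  inv_type p phi <-> large p (fun x => psat (gopp x) phi).
Proof.
move=> pS; rewrite /inv_type /= -(largeE pS).
by apply: large_iff => a Ga; apply: psat_subst_invE.
Qed.

Lemma S_G_inv (p : gtype G U) : S_G p -> S_G (inv_type p).
Proof.
move=> pS; apply: S_G_intro => [phi psi|phi|phi|].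
- by rewrite !mem_inv_type//; apply: large_and.
- by rewrite mem_inv_type// => /(large_ex pS)[a Ga ha]; exists (gopp a).
- have [h|/(largeE pS) h] := pS.1.2 (subst_inv phi); [by left|right].
  apply/mem_inv_type => //; apply: largeS h => a Ga na ha; apply: na.
  exact: (psat_subst_invE phi Ga).2 ha.
- apply/mem_inv_type => //; apply: (largeT pS) => a Ga.
  by rewrite /psat /noparam sat_fmap; apply: (goppG st).
Qed.

Lemma large_inv_imp (p : gtype G U) (X : tup -> Prop) : S_G p ->
  large (inv_type p) X -> large p (fun x => X (gopp x)).
Proof.
move=> pS [phi /(mem_inv_type _ pS) h hX]; apply: largeS h => a Ga; apply: hX.
exact: (goppG st).
Qed.

Lemma large_inv_type (p : gtype G U) (X : tup -> Prop) : S_G p -> dfn (A := U) id X ->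
  large p (fun x => X (gopp x)) -> large (inv_type p) X.
Proof.
move=> pS [phi hphi] h; exists phi => [|a Ga /hphi//].
by apply/mem_inv_type => //; apply: largeS h => a Ga /hphi.
Qed.

Lemma inv_typeK (p : gtype G U) : S_G p -> inv_type (inv_type p) = p.
Proof.
move=> pS; apply: tp_eq => // [|phi]; first by do 2 apply: S_G_inv.
rewrite mem_inv_type; last exact: S_G_inv.
move=> /(large_inv_imp pS) h; apply/(largeE pS); apply: largeS h => a Ga.
by rewrite (goppK st Ga).
Qed.

Definition invr (W : Type) (Y : ('I_n + W -> U) -> Prop) (e : 'I_n + W -> U) :=
  Gp (e \o inl) /\ Y (esum (gopp (e \o inl)) (e \o inr)).

Lemma dfn_invr (W : Type) (Y : ('I_n + W -> U) -> Prop) : dfn i Y -> dfn i (invr Y).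
Proof.
move=> dY.
pose h : 'I_n + 'I_n -> 'I_n + ('I_n + W) := esum (inr \o inl) inl.
have d1 := dfn_ex (dfn_and (dfn_ren inl (dfn_sat i (gdom G)))
  (dfn_and (dfn_ren h (dfn_sat i (ginv G))) (dfn_ren (smap id inr) dY))).
apply: dfn_ext (dfn_and (dfn_ren inl (dfn_sat i (gdom G))) d1) => e.
have hE c : esum c e \o h = esum (e \o inl) c by apply: funext => -[].
have sE c : esum c e \o smap id inr = esum c (e \o inr) by apply: funext => -[].
split=> [[Ge [c [Gc []]]]|[Ge Ye]].
  by rewrite hE sE => ic Yc; split=> //; rewrite -((gopp_spec c dG Ge).1 (conj Gc ic)).
split=> //; exists (gopp (e \o inl)); rewrite hE sE.
by have [] := (gopp_spec _ dG Ge).2 erefl.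
Qed.

Lemma inv_Sinv (p : gtype G U) : Sinv p -> Sinv (inv_type p).
Proof.
move=> [pS pinv]; split; first exact: S_G_inv.
apply: same_tp_invariant => k psi d d' dd'; rewrite !mem_inv_type// => h.
have dpsi : dfn i (fun e : 'I_n + 'I_k -> U => sat e psi) by exact: dfn_sat.
have {}h : large p (fun x => invr (fun e => sat e psi) (esum x d)).
  by apply: largeS h => x Gx /psat_inst hx; split.
have := large_inv pS pinv dd' (dfn_invr dpsi) h.
by apply: largeS => x Gx [_ hx]; apply/psat_inst.
Qed.

(** If b realizes q then its inverse realizes q^-1, and in an abelian group inversion is
    multiplicative. *)
Lemma inv_op (p q : gtype G U) : Sinv p -> Sinv q ->
  inv_type (op p q) = op (inv_type p) (inv_type q).
Proof.
move=> pS qS; have pS' := inv_Sinv pS; have qS' := inv_Sinv qS.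
have pqS := S_G_op st pS qS.1.
apply: tp_eq; [exact: S_G_inv|exact: (S_G_op st pS' qS'.1)|move=> phi].
have [W [w [Y [dY hY]]]] := pformula_dfn i phi; have sW := small_countable st W.
have [b hb] := rlz_ex st qS.1 w sW; have Gb := hb.1; have Gb' := goppG st Gb.
have hb' : rlz i (inv_type q) w (gopp b).
  split=> // Z dZ /(large_inv_imp qS.1) qZ.
  have [_] : invr Z (esum b w); last by [].
  by apply: (hb.2 _ (dfn_invr dZ)); apply: largeS qZ => x Gx Zx; split.
rewrite (op_mem st pS' qS'.1 sW dY (fun x _ => hY x) hb') mem_inv_type// => h.
have {}h : large (op p q) (fun x => invr Y (esum x w)).
  by apply: largeS h => x Gx /hY Yx; split.
have {}h := (opE st pS qS.1 sW (dfn_invr dY) hb).1 h.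
have : large (inv_type p) (fun x => mulr Y (esum x (esum (gopp b) w))).
  apply: (large_inv_type pS.1 (dfn_fix (esum (gopp b) w) (dfn_mulr st dY))).
  apply: largeS h => x Gx [_ Yx]; have Gx' := goppG st Gx; split=> //.
  by move: Yx; rewrite /= (gopp_gop st Gx Gb).
by apply: largeS => x Gx [].
Qed.

Lemma rt_inv (p : gtype G U) (c : tup) : S_G p -> Gp c ->
  rt (inv_type p) c = inv_type (rt p (gopp c)).
Proof.
move=> pS Gc; have Gc' := goppG st Gc; have pS' := S_G_inv pS.
have rS := S_G_rt st pS Gc'.
apply: tp_eq; [exact: (S_G_rt st pS' Gc)|exact: S_G_inv|move=> phi].
rewrite (rtE st _ pS' Gc) => /(large_inv_imp pS) h.
have [W [w [Y [dY hY]]]] := pformula_dfn i phi.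
have : large (rt p (gopp c)) (fun x => invr Y (esum x w)).
  apply/(large_rt st pS Gc' (dfn_fix w (dfn_invr dY))).
  apply: largeS h => x Gx /hY Yx; split; first exact: (gopG st Gx Gc').
  by move: Yx; rewrite /= (gopp_gop st Gx Gc') (goppK st Gc).
move=> h'; apply/mem_inv_type => //; apply: largeS h' => x Gx [_ Yx].
exact/hY.
Qed.

Lemma inv_Fr (t : gtype G U) : strong_right_f_generic MU t ->
  strong_right_f_generic MU (inv_type t).
Proof.
move=> tF; have tS := Fr_Sinv tF; split; first exact: inv_Sinv.
move=> c Gc; have Gc' := goppG st Gc; rewrite (rt_inv tS.1 Gc).
by have [] : Sinv (inv_type (rt t (gopp c)));
  [apply: inv_Sinv; split; [exact: (S_G_rt st tS.1 Gc')|exact: tF.2]|].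
Qed.

End Components.

(** * The retraction in terms of U and M *)

Section Retraction.
Context (L : language) (kappa : Type) (U M : structure L) (i : M -> U)
  (G : group_formulas L).
Context (st : setting kappa i G).
Local Notation n := (gdim G).
Local Notation tup := (tuples G U).
Local Notation Gp := (@Gpts L G U).
Local Notation gop := (@gop L G U).
Local Notation gopp := (@gopp L G U).
Local Notation dG := (st_group st).
Local Notation MU := (range i).
Local Notation Sinv := (@S_inv L G U MU).
Local Notation Sfs := (@S_fs L G U MU).
Local Notation op := (@newelski L G U MU).
Local Notation rt := (@right_translate L G U).
Context (N' : structure L) (N : set N') (j : U -> N').
Hypothesis sp : saturated_pair_extension MU N j.
Local Notation F := (@F_M L G U MU N' N j).
Local Notation ji := (j \o i).

Lemma j_sat (V : Type) (phi : formula L V) (e : V -> U) :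
  sat e phi <-> sat (j \o e) phi.
Proof.
rewrite -(sat_flift MU) -[X in _ <-> X](sat_flift N).
exact: (elementary_sat sp.1 (flift phi) e).
Qed.

Lemma j_N (x : U) : MU x -> N (j x).
Proof. exact: (elementary_sat sp.1 (fpred L tt) (fun=> x)).1. Qed.

(** Each formula over M true of w in N' has a solution in U by elementarity of [j], and saturation
    of U realizes all of them together. *)
Lemma realize_in_U (W : finType) (w : W -> N') : exists d, same_tp i ji d w.
Proof.
have [|||d hd] := realize st i (V := W) (D := [set X | exists2 phi : formula L (W + M),
    sat (esum w ji) phi & X = fun e => sat (esum e i) phi]).
- exact: (small_M st).
- move=> _ _ [phi hphi ->] [psi hpsi ->].
  by exists (fun e => sat (esum e i) (fand phi psi)) => //; exists (fand phi psi).
- move=> _ [phi hphi ->]; have : sat i (fexV phi); last by move=> /sat_fexV.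
  by apply/j_sat/sat_fexV; exists w.
have {}hd phi : sat (esum w ji) phi -> sat (esum d i) phi.
  move=> hphi; apply: (hd (fun e => sat (esum e i) phi) (fun e => sat (esum e i) phi)) => //; first by exists phi.
  exact: dfn_psat.
exists d => phi; split=> [h|]; last exact: hd.
by apply: contrapT => /(hd (fnot phi)).
Qed.

Lemma same_tp_j (W : Type) (d : W -> U) : same_tp i ji d (j \o d).
Proof.
move=> phi; rewrite j_sat.
suff -> : j \o esum d i = esum (j \o d) ji by [].
by apply: funext => -[].
Qed.

Section Extension.
Context (p : gtype G U) (pS : Sinv p).

(** The M-invariant extension of p to N': a parameter from N' is replaced by one in U with the same
    type over M. *)
Definition pext : gtype G N' := [set phi |
  exists k (psi : formula L ('I_n + 'I_k)) (d' : 'I_k -> N') (d : 'I_k -> U),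
    [/\ phi = inst psi d', same_tp i ji d d' & p (inst psi d)]].

Lemma large_inst k (psi : formula L ('I_n + 'I_k)) (d : 'I_k -> U) :
  p (inst psi d) <-> large p (fun x => sat (esum x d) psi).
Proof. by rewrite -(largeE pS.1); apply: large_iff => a _; rewrite psat_inst. Qed.

(** The implication between the three formulas depends only on the type of all their parameters
    together, so it holds for a copy [e] of these in U; invariance of p passes between d1, d2, d3
    and the parts of [e]. *)
Lemma pext_imp (k1 k2 k3 : nat) (psi1 : formula L ('I_n + 'I_k1))
    (psi2 : formula L ('I_n + 'I_k2)) (psi3 : formula L ('I_n + 'I_k3))
    d1' d2' d3' d1 d2 d3 :
  same_tp i ji d1 d1' -> same_tp i ji d2 d2' -> same_tp i ji d3 d3' ->
  (forall x : 'I_n -> N', sat (esum x d1') psi1 -> sat (esum x d2') psi2 ->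
    sat (esum x d3') psi3) ->
  p (inst psi1 d1) -> p (inst psi2 d2) -> p (inst psi3 d3).
Proof.
move=> h1 h2 h3 imp; rewrite !large_inst => p1 p2.
have [e he] := realize_in_U (esum d1' (esum d2' d3')).
have e1 : same_tp i i d1 (e \o inl).
  by apply: same_tp_trans h1 _; apply: same_tp_sym; exact: (same_tp_ren inl he).
have e2 : same_tp i i d2 (e \o (inr \o inl)).
  by apply: same_tp_trans h2 _; apply: same_tp_sym; exact: (same_tp_ren (inr \o inl) he).
have e3 : same_tp i i (e \o (inr \o inr)) d3.
  apply: same_tp_trans (same_tp_ren (inr \o inr) he) _; exact: same_tp_sym h3.
apply: (large_inv pS.1 pS.2 e3 (dfn_sat i psi3)).
have {}p1 := large_inv pS.1 pS.2 e1 (dfn_sat i psi1) p1.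
have {}p2 := large_inv pS.1 pS.2 e2 (dfn_sat i psi2) p2.
apply: largeS (large_and pS.1 p1 p2) => a _ [a1 a2].
pose chi : formula L ('I_k1 + ('I_k2 + 'I_k3)) := fexV (fand (fmap (smap id inl) psi1)
  (fand (fmap (smap id (inr \o inl)) psi2) (fnot (fmap (smap id (inr \o inr)) psi3)))).
have chiE (A : structure L) (f : _ -> A) : sat f chi <-> exists x : 'I_n -> A,
    [/\ sat (esum x (f \o inl)) psi1, sat (esum x (f \o (inr \o inl))) psi2
      & ~ sat (esum x (f \o (inr \o inr))) psi3].
  rewrite sat_fexV.
  have E (x : 'I_n -> A) :
    [/\ esum x f \o smap id inl = esum x (f \o inl),
        esum x f \o smap id (inr \o inl) = esum x (f \o (inr \o inl))
      & esum x f \o smap id (inr \o inr) = esum x (f \o (inr \o inr))].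
    by split; apply: funext => -[].
  split=> -[x].
    rewrite /= !sat_fmap; have [-> -> ->] := E x => -[x1 [x2 x3]].
    by exists x.
  move=> [x1 x2 x3]; exists x; rewrite /= !sat_fmap.
  by have [-> -> ->] := E x.
have : ~ sat e chi.
  have := he (fmap inl chi); rewrite !sat_fmap => -> /chiE[x [x1 x2]]; apply.
  exact: imp.
by move=> nchi; apply: contrapT => a3; apply: nchi; apply/chiE; exists a.
Qed.

Lemma pext_complete : complete_type pext.
Proof.
split.
  apply: consistent_directed => [phi1 phi2|phi].
    move=> [k1 [psi1 [d1' [d1 [-> h1 p1]]]]] [k2 [psi2 [d2' [d2 [-> h2 p2]]]]].
    have [k3 [psi3 [d3' e]]] := inst_ex (fand (inst psi1 d1') (inst psi2 d2')).
    have [d3 h3] := realize_in_U d3'.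
    exists k3, psi3, d3', d3; split=> //.
    apply: (pext_imp h1 h2 h3) p1 p2 => x /psat_inst x1 /psat_inst x2.
    by apply/psat_inst; rewrite -e.
  move=> [k [psi [d' [d [-> h]]]]]; rewrite large_inst => /(large_ex pS.1)[a _ ha].
  have : sat (esum d' ji) (fmap inl (fexV psi)).
    by apply/h; rewrite sat_fmap; apply/sat_fexV; exists a.
  by rewrite sat_fmap => /sat_fexV[x hx]; exists x; apply/psat_inst.
move=> phi; have [k [psi [d' ->]]] := inst_ex phi.
have [d h] := realize_in_U d'.
by case: (pS.1.1.2 (inst psi d)) => hp; [left; exists k, psi, d', d|right;
  exists k, (fnot psi), d', d].
Qed.

Lemma image_range : j @` MU = range ji.
Proof.
apply/seteqP; split=> [_ [_ [m _ <-] <-]|_ [m _ <-]]; first by exists m.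
by exists (i m) => //; exists m.
Qed.

Lemma pext_invariant_extension : invariant_extension MU j p pext.
Proof.
split; first exact: pext_complete.
  rewrite image_range => k phi.
  suff imp d d' : same_tp ji ji d d' -> pext (inst phi d) -> pext (inst phi d').
    by move=> d d' /same_tp_same_type h; split; apply: imp => //; apply: same_tp_sym.
  move=> dd' [k1 [psi1 [d1' [d1 [e h1 p1]]]]].
  have [d0 h0] := realize_in_U d.
  exists k, phi, d', d0; split=> //; first exact: same_tp_trans h0 dd'.
  apply: (pext_imp h1 h1 h0 _ p1 p1) => x /psat_inst; rewrite -e.
  by move=> /psat_inst.
move=> phi pphi; have [k [psi [d e]]] := inst_ex phi; exists k, psi, (j \o d), d.
split; [|exact: same_tp_j|by rewrite -e].
by rewrite e /pmap /inst fmap_comp; congr fmap; apply: funext => -[].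
Qed.

(** Over j(U) an extension of p is determined by p, and invariance carries this to every parameter
    with the same type over M as one in j(U). *)
Lemma invariant_extension_unique (p' : gtype G N') k (psi : formula L ('I_n + 'I_k))
    (d : 'I_k -> U) (d' : 'I_k -> N') :
  invariant_extension MU j p p' -> same_tp i ji d d' -> p' (inst psi d') -> p (inst psi d).
Proof.
move=> [[p'c p'C]]; rewrite image_range => p'inv pp' dd' hp'.
apply: contrapT => /(tp_not pS.1)/pp' hn.
have e : pmap j (fnot (inst psi d)) = fnot (inst psi (j \o d)).
  by rewrite /pmap /inst /= fmap_comp; congr (fnot (fmap _ _)); apply: funext => -[].
have hd : p' (inst psi (j \o d)).
  apply/(p'inv _ psi (j \o d) d') => //; apply/same_tp_same_type.
  by apply: same_tp_trans (same_tp_sym _) dd'; exact: same_tp_j.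
rewrite e in hn.
have [|a ha] := p'c [set inst psi (j \o d); fnot (inst psi (j \o d))] (finite_set2 _ _).
  by move=> _ [->|->].
by apply: (ha (fnot (inst psi (j \o d)))); [right|apply: ha; left].
Qed.

Lemma pext_large (W : Type) (psi : formula L ('I_n + (W + M))) (w : W -> U) (w' : W -> N') :
  same_tp i ji w w' -> large p (fun x => sat (esum x (esum w i)) psi) ->
  pext (fmap (smap id (esum w' ji)) psi).
Proof.
move=> ww'; have [k [psi0 [d ->]]] := fmap_split psi => h.
exists k, psi0, (esum w' ji \o d), (esum w i \o d); split.
- by rewrite /inst fmap_comp; congr fmap; apply: funext => -[].
- exact: (same_tp_ren d (same_tp_params ww')).
- apply/large_inst; apply: largeS h => a _; rewrite sat_fmap.
  have -> : esum a (esum w i) \o smap id d = esum a (esum w i \o d) by apply: funext => -[].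
  by [].
Qed.

End Extension.

(** The criterion for F quantifies over points of M; in the language of pairs this is first order,
    so elementarity and saturation of the pair apply to it. *)
Lemma pair_formula (W : finType) (V : Type) (chi : formula L (W + V))
    (rho : formula L ('I_n + (W + V))) :
  exists omega : formula (add_pred L) (W + V),
    forall (A : structure L) (P : set A) (y : W -> A) (e : V -> A),
      sat (A := pair_structure P) (esum y e) omega <->
      [/\ forall w, P (y w), sat (esum y e) chi
        & forall x : 'I_n -> A, (forall k, P (x k)) -> ~ sat (esum x (esum y e)) rho].
Proof.
have [pW pWE] := fall_finite (fun w : W => fpred L (inl w : W + V)).
have [px pxE] := fall_finite (fun k : 'I_n => fpred L (inl k : 'I_n + (W + V))).
exists (fand pW (fand (flift chi) (fnot (fexV (fand px (flift rho)))))) => A P y e.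
have fE V0 (f : V0 -> A) phi := sat_flift P f phi.
split=> [[/pWE h1 [h2 h3]]|[h1 h2 h3]].
  split=> //; first by rewrite -fE.
  move=> x Px hx; apply: h3; apply/sat_fexV; exists x; split; first exact/pxE.
  by rewrite fE.
split; first exact/pWE.
split; first by rewrite fE.
move=> /sat_fexV[x [/pxE Px hx]]; apply: (h3 x Px); by rewrite -fE.
Qed.

(* A parameter n in N that witnesses inconsistency is replaced by its type over M:
   by elementarity of the pair each formula of that type has a solution in M with
   the same effect on M, and conversely the pair is saturated. *)
Lemma F_out (p : gtype G U) (theta : pformula U n) : Sinv p ->
  ~ F p theta <-> exists (W : finType) (Y : ('I_n + W -> U) -> Prop) (w : W -> U),
    [/\ dfn i Y, large p (fun x => Y (esum x w)) & forall X : (W -> U) -> Prop,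
      dfn i X -> X w -> exists m : W -> M, X (i \o m) /\
        forall a : tup, GM i a -> Y (esum a (i \o m)) -> ~ psat a theta].
Proof.
move=> pS; split=> [/existsNP[S0 /not_implyP[fS0 /not_implyP[S0S noa]]]|].
  (* A finite inconsistent set is merged into a single formula with parameters in N. [good] says
     that the formula belongs to the invariant extension of p, and [R] collects what it implies at
     the points of N satisfying theta. *)
  pose data := {k : nat & (formula L ('I_n + 'I_k) * ('I_k -> N'))%type}.
  pose R (D : data) (phi : formula (add_pred L) ('I_n + N')) :=
    forall a : 'I_n -> N', psat a (pmap j theta) -> (forall k, N (a k)) ->
      sat (esum a (projT2 D).2) (projT2 D).1 -> psat (A := pair_structure N) a phi.
  pose good (D : data) := (forall w, N ((projT2 D).2 w)) /\
    exists2 d, same_tp i ji d (projT2 D).2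
      & large p (fun x => sat (esum x d) (projT2 D).1).
  have [|||[l [psi w]] [/= wN [d /= dw pd]] hR] := finite_directed_bound (R := R) (D := good) _ _ _ fS0 S0S.
  - exists (existT _ 0 (fmap inl (gdom G), fun v : 'I_0 => False_rect N' (notF (valP v)))).
    split=> [[]//|]; have [d h] := realize_in_U (fun v : 'I_0 => False_rect N' (notF (valP v))).
    by exists d => //; apply: (largeT pS.1) => a Ga /=; rewrite sat_fmap.
  - move=> [k1 [psi1 w1]] [k2 [psi2 w2]] [/= N1 [d1 h1 p1]] [/= N2 [d2 h2 p2]].
    pose w : 'I_(k1 + k2) -> N' := esum w1 w2 \o @fintype.split k1 k2.
    have wl : w \o lshift k2 = w1 by apply: funext => l; rewrite /w /= (unsplitK (inl l)).
    have wr : w \o @rshift k1 k2 = w2 by apply: funext => l; rewrite /w /= (unsplitK (inr l)).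
    have [d h] := realize_in_U w.
    have E (A : structure L) (x : 'I_n -> A) (v : 'I_(k1 + k2) -> A) :
      esum x v \o smap id (lshift k2) = esum x (v \o lshift k2) /\
      esum x v \o smap id (@rshift k1 k2) = esum x (v \o @rshift k1 k2)
      by split; apply: funext => -[].
    exists (existT _ (k1 + k2)
      (fand (fmap (smap id (lshift k2)) psi1) (fmap (smap id (@rshift k1 k2)) psi2), w)).
    split.
    + split=> [l|]; first by rewrite /w /=; case: fintype.split.
      exists d => //=.
      have e1 : same_tp i i d1 (d \o lshift k2).
        apply: same_tp_trans h1 _; apply: same_tp_sym; rewrite -wl.
        exact: (same_tp_ren (lshift k2) h).
      have e2 : same_tp i i d2 (d \o @rshift k1 k2).
        apply: same_tp_trans h2 _; apply: same_tp_sym; rewrite -wr.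
        exact: (same_tp_ren (@rshift k1 k2) h).
      have {}p1 := large_inv pS.1 pS.2 e1 (dfn_sat i psi1) p1.
      have {}p2 := large_inv pS.1 pS.2 e2 (dfn_sat i psi2) p2.
      apply: largeS (large_and pS.1 p1 p2) => a _ [a1 a2].
      by rewrite !sat_fmap; have [-> ->] := E _ a d.
    + move=> phi hphi a a1 a2 /= [a3 _]; apply: hphi => //=.
      by move: a3; rewrite sat_fmap; have [-> _] := E _ a w; rewrite wl.
    + move=> phi hphi a a1 a2 /= [_ a3]; apply: hphi => //=.
      by move: a3; rewrite sat_fmap; have [_ ->] := E _ a w; rewrite wr.
  - have vd : good (existT _ 0 (fmap inl (gdom G), fun v : 'I_0 => False_rect N' (notF (valP v)))).
      split=> [[]//|]; have [d h] := realize_in_U (fun v : 'I_0 => False_rect N' (notF (valP v))).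
      by exists d => //; apply: (largeT pS.1) => a Ga /=; rewrite sat_fmap.
    move=> phi [[->|[k _ <-]]|[phi0 [[k [psi [d' [d'N e]]]] [p' p'E p'phi]] <-]].
    + by eexists; [exact: vd|move=> a ha _ _; rewrite /psat sat_flift].
    + by eexists; [exact: vd|move=> a _ ha _; apply: ha].
    + exists (existT _ k (psi, d')).
        split=> //=; have [d h] := realize_in_U d'; exists d => //.
        apply/(large_inst pS); rewrite e in p'phi.
        exact: (invariant_extension_unique pS p'E h p'phi).
      by move=> a _ _ /= ha; rewrite /psat sat_flift e; apply/psat_inst.
  pose W : finType := 'I_l; exists W, (fun e => sat e psi), d; split=> //; first exact: dfn_sat.
  move=> X [chi hX] Xd.
  have [omega oE] := pair_formula (fmap (smap id i) chi : formula L (W + U))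
    (fand (fmap (smap id inr) theta) (fmap (smap id inl) psi)).
  have iE (A : structure L) (f : U -> A) (y : W -> A) :
      sat (esum y f) (fmap (smap id i) chi) = sat (esum y (f \o i)) chi.
    by rewrite sat_fmap; congr sat; apply: funext => -[].
  have rE (A : structure L) (f : U -> A) (x : 'I_n -> A) (y : W -> A) :
      sat (esum x (esum y f)) (fand (fmap (smap id inr) theta) (fmap (smap id inl) psi)) <->
      sat (esum x f) theta /\ sat (esum x y) psi.
    rewrite /= !sat_fmap.
    have -> : esum x (esum y f) \o smap id inr = esum x f by apply: funext => -[].
    by have -> : esum x (esum y f) \o smap id inl = esum x y by apply: funext => -[].
  (* In (N', N) the tuple w is a witness; elementarity of the pair gives a witness y in M, while the
     parameters of theta stay fixed. *)
  have /sat_fexV[y] : sat (A := pair_structure MU) id (fexV omega).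
    apply/(elementary_sat sp.1); apply/sat_fexV; exists w; apply/oE; split=> //.
      by rewrite iE; apply/dw/hX.
    move=> x xN; rewrite rE => -[x1 x2]; apply: noa; exists x => phi S0phi.
    apply: (hR _ S0phi) => //; rewrite /psat /pmap sat_fmap.
    by move: x1; congr sat; apply: funext => -[].
  move=> /oE[yM]; rewrite iE => cy noy; have Xy : X y := (hX y).1 cy.
  have /choice[m hm] : forall v, exists x, i x = y v.
    by move=> v; have [x _ <-] := yM v; exists x.
  have im : i \o m = y by apply: funext => v; rewrite /= hm.
  exists m; rewrite im; split=> // a [_ [a0 ea]] Ya ta; apply: (noy a).
    by move=> k; rewrite ea; exists (a0 k).
  by apply/rE; split.
(* Conversely, each formula in the type of w over M has a solution in M that excludes theta on G(M);
   saturation of the pair yields one tuple y of N that has the whole type and excludes theta on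
   G(N). *)
move=> [W [Y [w [[psi hY] pY hX]]]] Fp.
pose g (s : ('I_n + W) + M) : 'I_n + (W + M) := match s with
  | inl (inl x) => inl x | inl (inr l) => inr (inl l) | inr m => inr (inr m) end.
(* Membership in G is added because the hypothesis excludes theta only at points of G(M). *)
pose psi1 := fand (fmap inl (gdom G)) (fmap g psi).
have psi1E (A : structure L) (f : M -> A) (x : 'I_n -> A) (y : W -> A) :
    sat (esum x (esum y f)) psi1 <-> sat x (gdom G) /\ sat (esum (esum x y) f) psi.
  rewrite /= !sat_fmap.
  by have -> : esum x (esum y f) \o g = esum (esum x y) f by apply: funext => -[[]|].
pose rho := fand (fmap (smap id inr) theta) (fmap (smap id (smap id i)) psi1).
have rE (A : structure L) (f : U -> A) (x : 'I_n -> A) (y : W -> A) :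
    sat (esum x (esum y f)) rho <->
    sat (esum x f) theta /\ sat (esum x (esum y (f \o i))) psi1.
  rewrite /rho [sat _ (fand _ _)]/= !(sat_fmap (smap _ _)).
  have -> : esum x (esum y f) \o smap id inr = esum x f by apply: funext => -[].
  by have -> : esum x (esum y f) \o smap id (smap id i) = esum x (esum y (f \o i))
    by apply: funext => -[|[]].
have iE (A : structure L) (f : U -> A) (y : W -> A) chi :
    sat (esum y f) (fmap (smap id i) chi) = sat (esum y (f \o i)) chi.
  by rewrite sat_fmap; congr sat; apply: funext => -[].
have /choice[omega oE] := fun chi : formula L (W + M) =>
  pair_formula (fmap (smap id i) chi : formula L (W + U)) rho.
pose Q chi (y : W -> N') := [/\ forall v, N (y v), sat (esum y ji) chi
  & forall x : 'I_n -> N', (forall k, N (x k)) -> ~ sat (esum x (esum y j)) rho].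
have {}oE' chi y : sat (A := pair_structure N) (esum y j) (omega chi) <-> Q chi y.
  by rewrite oE iE.
have [|||y hy] := saturated_realize (A := pair_structure N) (V := W) (f := j)
   (S := [set phi | exists2 chi, sat (esum w i) chi
       & forall y, Q chi y -> sat (A := pair_structure N) (esum y j) phi]) sp.2.
- exact: card_image_le.
- move=> phi1 phi2 [chi1 c1 h1] [chi2 c2 h2]; exists (fand chi1 chi2) => //.
  by move=> y [yN [y1 y2] yx]; split; [apply: h1|apply: h2].
- move=> phi [chi cw h].
  have [m [cm mx]] := hX _ (dfn_psat i chi) cw.
  have /(elementary_sat sp.1)/sat_fexV[y] :
      sat (A := pair_structure MU) id (fexV (omega chi)).
    apply/sat_fexV; exists (i \o m); apply/oE; split.
    + by move=> v; exists (m v).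
    + by rewrite iE.
    + move=> x xM /rE[tx /psi1E[Gx Yx]].
      by apply: (mx x (GM_of Gx xM)) => //; apply/hY.
  by move=> /oE' Qy; exists y; apply: h.
have {}hy chi : sat (esum w i) chi -> Q chi y.
  by move=> cw; apply/oE'; apply: hy; exists chi => // y' /oE'.
have wy : same_tp i ji w y.
  move=> chi; split=> [/hy[]//|cy]; apply: contrapT => ncw.
  by have [_ + _] := hy (fnot chi) ncw.
have [yN _ yx] : Q (fex (feq (tvar None) (tvar None))) y.
  by apply: hy; have [u0] := dom_inhabited U; exists u0.
have [||a ha] := Fp ([set flift (pmap j theta)]
    `|` [set fpred L (inl k : 'I_n + N') | k in [set: 'I_n]]
    `|` [set flift (fmap (smap id (esum y ji)) psi1)]).
- rewrite !finite_setU; split; last exact: finite_set1.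
  by split; [exact: finite_set1|apply: finite_image; exact: finite_finset].
- move=> phi [[->|h]|->]; [by left; left|by left; right|right].
  exists (fmap (smap id (esum y ji)) psi1) => //; split.
    have [k [phi1 [d [dN e]]]] := @over_range L N' _ _ (esum y ji) psi1.
    exists k, phi1, d; split=> // l; have [[v|m] _ <-] := dN l => /=; first exact: yN.
    by apply: j_N; exists m.
  exists (pext p); first exact: pext_invariant_extension.
  apply: (pext_large pS wy); apply: largeS pY => x Gx Yx; apply/psi1E; split=> //.
  exact/hY.
apply: (yx a).
  by move=> k; apply: (ha (fpred L (inl k))); left; right; exists k.
have h1 := ha _ (or_introl (or_introl erefl)).
have h2 := ha _ (or_intror erefl).
apply/rE; split.
  move: h1; rewrite /psat sat_flift /pmap sat_fmap; congr sat.
  by apply: funext => -[].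
move: h2; rewrite /psat sat_flift (sat_fmap (smap _ _)); congr sat.
by apply: funext => -[|[]].
Qed.

(** In the criterion [F_out], translating by m amounts to a change of variable among the points of
    G(M). *)
Lemma F_rt (p : gtype G U) (m : tup) (theta : pformula U n) : Sinv p -> GM i m ->
  F (rt p m) theta <-> F p (subst_mulr theta m).
Proof.
move=> pS mM; have Gm := mM.1; have pmS := rt_Sinv st pS mM.
have m'M := GM_opp st mM; have Gm' := m'M.1.
suff : ~ F (rt p m) theta <-> ~ F p (subst_mulr theta m).
  by move=> [h1 h2]; split=> h; apply: contrapT; [move=> /h2|move=> /h1].
rewrite !F_out//; split=> -[W [Y [w [dY pY hX]]]].
  exists W, (fun e => mulr Y (esum (e \o inl) (esum m (e \o inr)))), w; split.
  - exact: (dfn_mulrM st mM dY).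
  - by apply: largeS (large_rt_imp st pS.1 Gm pY) => x Gx Yx; split.
  - move=> X dX Xw; have [m0 [Xm0 hm0]] := hX X dX Xw; exists m0; split=> // a aM [_ _ Ya].
    by move=> /(psat_subst_mulr _ dG aM.1 Gm); apply: hm0 => //; apply: (GM_gop st).
exists W, (fun e => mulr Y (esum (e \o inl) (esum (gopp m) (e \o inr)))), w; split.
- exact: (dfn_mulrM st m'M dY).
- have d' := dfn_fix w (dfn_mulrM st m'M dY).
  apply/(large_rt st pS.1 Gm d'); apply: largeS pY => x Gx Yx; split=> //.
    exact: (gopG st).
  by rewrite /= (gopK st).
- move=> X dX Xw; have [m0 [Xm0 hm0]] := hX X dX Xw; exists m0; split=> // a aM [_ _ Ya] ta.
  have a'M := GM_gop st aM m'M; apply: (hm0 _ a'M Ya).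
  by apply/(psat_subst_mulr _ dG a'M.1 Gm); rewrite (gopVK st aM.1 Gm).
Qed.

(** A formula over M that belongs to t is itself a witness, without any parameter w, that its
    negation is outside F(t). So F(t) and t agree over M. *)
Lemma rlz_F (t : gtype G U) (b : tup) : Sinv t -> S_G (F t) ->
  rlz i (F t) (@venv L U) b -> rlz i t (@venv L U) b.
Proof.
move=> tS uS [Gb hb]; split=> // Y dY tY; apply: hb => //.
have [phi hphi] := dfn_fix (@venv L U) dY.
suff : F t phi by move=> Fphi; exists phi => // a Ga /hphi.
apply: contrapT => /(tp_not uS) Fn; apply: (_ : ~ F t (fnot phi)) => //.
apply/F_out => //; exists (void : finType), Y, (@venv L U); split=> // X dX Xv.
exists (fun v : void => match v with end).
have -> : i \o (fun v : void => match v with end) = @venv L U by apply: funext => -[].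
by split=> // a aM Ya; apply; apply/hphi.
Qed.

End Retraction.

(** * Triviality of the kernel *)

Section Kernel.
Context (L : language) (kappa : Type) (U M : structure L) (i : M -> U)
  (G : group_formulas L).
Context (st : setting kappa i G).
Local Notation n := (gdim G).
Local Notation tup := (tuples G U).
Local Notation Gp := (@Gpts L G U).
Local Notation gop := (@gop L G U).
Local Notation gopp := (@gopp L G U).
Local Notation dG := (st_group st).
Local Notation MU := (range i).
Local Notation Sinv := (@S_inv L G U MU).
Local Notation Sfs := (@S_fs L G U MU).
Local Notation op := (@newelski L G U MU).
Local Notation rt := (@right_translate L G U).

(** p * q is a limit along p of translates of q: for m in M, the formula holds at m b iff q contains
    its translate, and m x = x m. Nothing is claimed at points outside M. *)
Lemma op_GM (p q : gtype G U) (phi : pformula U n) : Sinv p -> S_G q ->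
  op p q phi -> large p (fun m => GM i m -> rt q m phi).
Proof.
move=> pS qS.
have [W [w [Y [dY hY]]]] := pformula_dfn i phi; have sW := small_countable st W.
have [b hb] := rlz_ex st qS w sW; have Gb := hb.1.
rewrite (op_mem st pS qS sW dY (fun x _ => hY x) hb); apply: largeS => m Gm Ym mM.
have : mulr Y (esum m (esum b w)) by split.
move=> /(rlz_iff qS hb (dfn_atM mM (dfn_mulr st dY))) h.
apply/(rtE st _ qS Gm); apply: largeS h => x Gx [_ _ Yx]; apply/hY.
by rewrite (gopC st).
Qed.

(** Variables for l points of G, arranged so that adding a point is adding a summand. *)
Fixpoint seqvar (l : nat) : finType :=
  if l is l'.+1 then (seqvar l' + 'I_n)%type : finType else (void : finType).

Section Kernel.
Context (t u k k' : gtype G U).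
Hypothesis tF : strong_right_f_generic MU t.
Hypotheses (uS : Sfs u) (kS : Sfs k) (k'S : Sfs k').
Hypotheses (kk' : op k k' = u) (ku : op k u = k) (k'k : op k' k = u) (k'u : op k' u = k').
Hypotheses (tk : op t k = t) (tk' : op t k' = t).
(* This is the description of the retraction given by F_out, where u = F(t). *)
Hypothesis uF : forall theta, ~ u theta ->
  exists (W : finType) (Y : ('I_n + W -> U) -> Prop) (w : W -> U),
    [/\ dfn i Y, large t (fun x => Y (esum x w)) & forall X : (W -> U) -> Prop,
      dfn i X -> X w -> exists m : W -> M, X (i \o m) /\
        forall a : tup, GM i a -> Y (esum a (i \o m)) -> ~ psat a theta].
Context (kd : nat) (psi : formula L ('I_n + 'I_kd)) (d : 'I_kd -> U).
Local Notation phi := (inst psi d).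
Local Notation tS := (Fr_Sinv tF).

(* Modulo the stabilizer of t, each of the two sets of points is contained in the
   closure of the other; the passage is by multiplication with k or k'. *)
Definition Zpt (s : bool) (z : tup) :=
  GM i z /\ if s then rt u z phi /\ ~ rt k z phi else ~ rt u z phi /\ rt k' z phi.

(** The type along which one leaves the set [Zpt s]. *)
Definition kap (s : bool) := if s then k else k'.

Lemma kapS (s : bool) : Sfs (kap s). Proof. by case: s. Qed.

(** For s true, phi in u.z = k * (k'.z) gives phi in k'.(z m), and phi outside k.z = k * (u.z) gives
    phi outside u.(z m), for k-many m. For s false, the relations u = k' * k and k' = k' * u are
    used in the same way. *)
Lemma Zpt_step (s : bool) (z : tup) : Zpt s z ->
  large (kap s) (fun m => GM i m -> Zpt (~~ s) (gop z m)).
Proof.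
move=> [zM]; have Gz := zM.1.
have uS' := Sfs_inv uS; have kS' := Sfs_inv kS; have k'S' := Sfs_inv k'S.
have pos (x y r : gtype G U) : Sinv x -> S_G y -> op x y = r -> rt r z phi ->
    large x (fun m => GM i m -> rt y (gop z m) phi).
  move=> xS yS <-; rewrite -(op_rt_r st xS yS zM) => /(op_GM xS (S_G_rt st yS Gz)).
  by apply: largeS => m Gm h mM; rewrite -(rt_rt st yS Gz Gm); apply: h.
have neg (x y r : gtype G U) : Sinv x -> S_G y -> op x y = r -> ~ rt r z phi ->
    large x (fun m => GM i m -> ~ rt y (gop z m) phi).
  move=> xS yS <-; have xyS := S_G_op st xS yS.
  rewrite -(tp_not (S_G_rt st xyS Gz)) -(op_rt_r st xS yS zM).
  move=> /(op_GM xS (S_G_rt st yS Gz)); apply: largeS => m Gm h mM.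
  rewrite -(tp_not (S_G_rt st yS (gopG st Gz Gm))) -(rt_rt st yS Gz Gm); exact: h.
case: s => -[h1 h2] /=.
  have g1 := pos _ _ _ kS' k'S'.1 kk' h1; have g2 := neg _ _ _ kS' uS'.1 ku h2.
  apply: largeS (large_and kS'.1 g1 g2) => m Gm [m1 m2] mM.
  by split; [exact: (GM_gop st)|split; [exact: m2|exact: m1]].
have g1 := neg _ _ _ k'S' kS'.1 k'k h1; have g2 := pos _ _ _ k'S' uS'.1 k'u h2.
apply: largeS (large_and k'S'.1 g1 g2) => m Gm [m1 m2] mM.
by split; [exact: (GM_gop st)|split; [exact: m2|exact: m1]].
Qed.

(** The hypothesis [uF] is applied to the translate by z of phi or of its negation, whichever u does
    not contain. *)
Lemma Zpt_out (s : bool) (z : tup) : Zpt s z ->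
  exists (W : finType) (Y : ('I_n + W -> U) -> Prop) (w : W -> U),
    [/\ dfn i Y, large t (fun x => Y (esum x w)) & forall X : (W -> U) -> Prop,
      dfn i X -> X w -> exists m : W -> M, X (i \o m) /\
        forall a : tup, GM i a -> Y (esum a (i \o m)) -> (psat (gop a z) phi <-> s)].
Proof.
move=> [zM hz]; have Gz := zM.1.
have : ~ u (if s then fnot (subst_mulr phi z) else subst_mulr phi z).
  by case: s hz => -[h _] //; rewrite (tp_not uS.1); apply.
move=> /uF[W [Y [w [dY tY hX]]]]; exists W, Y, w; split=> // X dX Xw.
have [m [Xm hm]] := hX X dX Xw; exists m; split=> // a aM Ya.
have := hm a aM Ya; have E := psat_subst_mulr phi dG aM.1 Gz.
case: (s) => h; split=> //; last by move=> /E /h.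
by move=> _; apply/E; apply: contrapT => h'; apply: h.
Qed.

Definition morley_next (V : finType) (e : V -> U) : tup :=
  sval (cid (rlz_ex st tS.1 e (small_countable st V))).

Lemma morley_nextP (V : finType) (e : V -> U) : rlz i t e (morley_next e).
Proof. exact: svalP (cid _). Qed.

Fixpoint morley (l : nat) : seqvar l -> U :=
  match l return seqvar l -> U with
  | 0 => fun v => match v with end
  | l'.+1 => esum (@morley l') (morley_next (@morley l'))
  end.
Arguments morley l : clear implicits.

Context (S : set nat).

Fixpoint pattern (l : nat) (yd : 'I_n + 'I_kd -> U) : (seqvar l -> U) -> Prop :=
  match l return (seqvar l -> U) -> Prop with
  | 0 => fun=> True
  | l'.+1 => fun e => pattern yd (e \o inl) /\
      (mulr (fun e => sat e psi) (esum (e \o inr) yd) <-> S l')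
  end.

(* A finite approximation inside M of the following closed condition on z: for some
   h stabilizing t, the truth values of phi(x h z, d) along some Morley sequence of
   t of length l over M are given by S. *)
Definition good (l : nat) (z : tup) :=
  forall (Th : (seqvar l -> U) -> Prop) (eta : ('I_n -> U) -> Prop),
    dfn i Th -> Th (morley l) -> dfn i eta -> (forall h, stab t h -> eta h) ->
    exists (e : seqvar l -> M) (h : tup),
      [/\ Th (i \o e), GM i h, eta h & pattern (esum (gop h z) d) (i \o e)].

Lemma good0 (z : tup) : good 0 z.
Proof.
move=> Th eta dTh Th0 deta heta; exists (fun v : void => match v with end), (gone st).
split=> //; last by apply: heta; exact: (stab_one st tF).
  by move: Th0; congr Th; apply: funext => -[].
exact: GM_one.
Qed.

(** Let e have the type over M of the Morley sequence, h be in the stabilizer and w' have the type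
    of w. Then t contains Th(e, x), and also Y(x h, w') since t.h = t, so some x satisfies both. By
    compactness this persists for approximations over M, so that e, h, w' and x can all be taken in
    M, where Y forces the truth value s of phi at x h z. *)
Lemma good_extend (s : bool) (z : tup) (l : nat) :
  Zpt s z -> (s <-> S l) -> good l z -> good l.+1 z.
Proof.
move=> hz sS gl Th eta dTh ThE deta heta; have [zM _] := hz; have Gz := zM.1.
have [W [Y [w [dY tY hX]]]] := Zpt_out hz.
pose V : finType := (seqvar l + ('I_n + W))%type.
pose D : set ((V -> U) -> Prop) := [set Q | exists Th' eta' X,
  [/\ dfn i Th' /\ Th' (morley l), dfn i eta' /\ (forall h, stab t h -> eta' h),
      dfn i X /\ X w & Q = fun e : V -> U => [/\ Th' (e \o inl), eta' (e \o (inr \o inl))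
        & X (e \o (inr \o inr))]]].
pose Gam0 (e : 'I_n + V -> U) :=
  Th (e \o esum (inr \o inl) inl) /\ mulr Y (e \o smap id inr).
have dGam0 : dfn i Gam0.
  by apply: dfn_and; [exact: dfn_ren|apply: dfn_ren; exact: (dfn_mulr st dY)].
pose Gam (e : V -> U) := exists x : 'I_n -> U, Gam0 (esum x e).
have [|||||Q [Th' [eta' [X [[dTh' Th'E] [deta' heta'] [dX Xw] ->]]]] QG] :=
    compactM (D := D) (Y := Gam) st.
- exists (fun e => [/\ True, True & True]), (fun=> True), (fun=> True), (fun=> True).
  by split=> //; split=> //; exact: dfn_true.
- move=> _ [Th' [eta' [X [[dTh' _] [deta' _] [dX _] ->]]]].
  have h1 : dfn i (fun e : V -> U => Th' (e \o inl)) by exact: dfn_ren.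
  have h2 : dfn i (fun e : V -> U => eta' (e \o (inr \o inl))) by exact: dfn_ren.
  have h3 : dfn i (fun e : V -> U => X (e \o (inr \o inr))) by exact: dfn_ren.
  by apply: dfn_ext (dfn_and h1 (dfn_and h2 h3)) => e; split=> [[? []]|[]].
- move=> _ _ [T1 [e1 [X1 [[dT1 T1E] [de1 he1] [dX1 X1w] ->]]]]
    [T2 [e2 [X2 [[dT2 T2E] [de2 he2] [dX2 X2w] ->]]]].
  exists (fun e => [/\ T1 (e \o inl) /\ T2 (e \o inl),
    e1 (e \o (inr \o inl)) /\ e2 (e \o (inr \o inl))
    & X1 (e \o (inr \o inr)) /\ X2 (e \o (inr \o inr))]); last by move=> e [[? ?] [? ?] []].
  exists (fun e => T1 e /\ T2 e), (fun e => e1 e /\ e2 e), (fun e => X1 e /\ X2 e).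
  split=> //; split=> //; try exact: dfn_and.
  by move=> h sh; split; [apply: he1|apply: he2].
- exact: (dfn_ex dGam0).
- move=> e he; pose h : tup := e \o (inr \o inl).
  have D1 Th' eta' X : dfn i Th' -> Th' (morley l) -> dfn i eta' ->
      (forall h, stab t h -> eta' h) -> dfn i X -> X w ->
      [/\ Th' (e \o inl), eta' (e \o (inr \o inl)) & X (e \o (inr \o inr))].
    move=> *; apply: (he (fun e => [/\ Th' (e \o inl), eta' (e \o (inr \o inl))
      & X (e \o (inr \o inr))])).
    by exists Th', eta', X.
  have T0 := dfn_true i.
  have me : same_tp i i (morley l) (e \o inl).
    apply: dfn_same_tp => Q dQ hQ.
    by have [] := D1 Q (fun=> True) (fun=> True) dQ hQ (T0 _) (fun _ _ => I) (T0 _) I.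
  have sh : stab t h.
    apply: (stab_closed st tF) => Q dQ hQ.
    by have [] := D1 (fun=> True) Q (fun=> True) (T0 _) I dQ hQ (T0 _) I.
  have ww : same_tp i i w (e \o (inr \o inr)).
    apply: dfn_same_tp => Q dQ hQ.
    by have [] := D1 (fun=> True) (fun=> True) Q (T0 _) I (T0 _) (fun _ _ => I) dQ hQ.
  have [Gh th] := sh.
  pose Ths (e : 'I_n + seqvar l -> U) := Th (e \o esum inr inl).
  have dThs : dfn i Ths by exact: dfn_ren.
  have E (x : tup) (v : seqvar l -> U) : esum x v \o esum inr inl = esum v x
    by apply: funext => -[].
  have t1 : large t (fun x => Ths (esum x (morley l))).
    apply/(rlz_iff tS.1 (morley_nextP (morley l)) dThs).
    by rewrite /Ths E.
  have {}t1 := large_inv tS.1 tS.2 me dThs t1.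
  have t2 := large_inv tS.1 tS.2 ww dY tY.
  rewrite -th in t2; have {}t2 := large_rt_imp st tS.1 Gh t2.
  have [x Gx [x1 x2]] := large_ex tS.1 (large_and tS.1 t1 t2).
  exists x; split.
    move: x1; rewrite /Ths E; congr Th; by apply: funext => -[].
  have -> : esum x e \o smap id inr = esum x (esum h (e \o (inr \o inr))).
    by apply: funext => -[|[]].
  by split.
(* This copy m of w in M comes from the criterion for the retraction, so Y(a, m) decides phi at a z
   for every a in G(M). *)
have [m [Xm hm]] := hX X dX Xw.
have [|h sh|e [h [The hM [eta1 eta2] pat]]] :=
    gl Th' (fun h => eta' h /\ eta h) dTh' Th'E.
- exact: dfn_and.
- by split; [apply: heta'|apply: heta].
have [Gh [h0 eh]] := hM.
pose c : V -> M := esum e (esum h0 m).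
have cE : i \o c = esum (i \o e) (esum h (i \o m)).
  by rewrite eh; apply: funext => -[|[]].
have [||x0 [x1 x2]] := tarski_vaught st (V := 'I_n) (X := fun x => Gam0 (esum x (i \o c))).
- exact: (dfn_const c dGam0).
- by apply: QG; rewrite cE.
pose x : tup := i \o x0.
have {}x2 : mulr Y (esum x (esum h (i \o m))).
  move: x2; rewrite cE; congr mulr; by apply: funext => -[|[]].
have [Gx _ Yx] := x2.
have xM : GM i x by split=> //; exists x0.
have := hm _ (GM_gop st xM hM) Yx; rewrite sS => hS.
pose e' : seqvar l.+1 -> M := esum e x0.
have eE : i \o e' = esum (i \o e) x by apply: funext => -[].
exists e', h; split=> //.
  by move: x1; rewrite cE eE; congr Th; apply: funext => -[].
rewrite eE; split=> //; rewrite -hS psat_inst (gopA st Gx Gh Gz).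
split=> [[_ _]//|hp]; split=> //; exact: (gopG st Gh Gz).
Qed.

(** By [op_Fr] the translate t.b is t * k or t * k', and both are t. *)
Lemma stab_kap (s : bool) (b : tup) : rlz i (kap s) (@venv L U) b -> stab t b.
Proof.
move=> hb; split; first exact: hb.1.
by rewrite -(op_Fr st tF (kapS s).1 hb); case: (s).
Qed.

(** A point m taken along [kap s] moves z into the other set and approximates an element of the
    stabilizer, so h m satisfies [eta] when h is close enough to the stabilizer. A pattern at h and
    z m is the same pattern at h m and z. *)
Lemma good_limit (s : bool) (z : tup) (l : nat) :
  Zpt s z -> (forall z', Zpt (~~ s) z' -> good l z') -> good l z.
Proof.
move=> hz gl Th eta dTh ThE deta heta; have [zM _] := hz; have Gz := zM.1.
have kpS := kapS s.
pose V : finType := ('I_n + 'I_n)%type.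
pose D : set ((V -> U) -> Prop) := [set Q | exists eta' X,
  [/\ dfn i eta' /\ (forall h, stab t h -> eta' h), dfn i X /\ large (kap s) X
    & Q = fun e : V -> U => eta' (e \o inl) /\ X (e \o inr)]].
pose ev : 'I_n + ('I_n + void) -> V := esum inl (esum inr (fun v : void => match v with end)).
pose Gam (e : V -> U) := mulr (fun e : 'I_n + void -> U => eta (e \o inl)) (e \o ev).
have [|||||Q [eta' [X [[deta' heta'] [dX kX] ->]]] QG] := compactM (D := D) (Y := Gam) st.
- exists (fun e => True /\ True), (fun=> True), (fun=> True); split=> //; split=> //.
  + exact: dfn_true.
  + exact: dfn_true.
  + exact: (largeT kpS.1).
- move=> _ [eta' [X [[deta' _] [dX _] ->]]].
  have h1 : dfn i (fun e : V -> U => eta' (e \o inl)) by exact: dfn_ren.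
  have h2 : dfn i (fun e : V -> U => X (e \o inr)) by exact: dfn_ren.
  exact: dfn_and h1 h2.
- move=> _ _ [e1 [X1 [[de1 he1] [dX1 X1w] ->]]] [e2 [X2 [[de2 he2] [dX2 X2w] ->]]].
  exists (fun e => (e1 (e \o inl) /\ e2 (e \o inl)) /\ (X1 (e \o inr) /\ X2 (e \o inr)));
    last by move=> e [[? ?] []].
  exists (fun e => e1 e /\ e2 e), (fun e => X1 e /\ X2 e).
  split=> //; split; try exact: dfn_and.
    by move=> h sh; split; [apply: he1|apply: he2].
  exact: (large_and kpS.1).
- exact: (dfn_ren ev (dfn_mulr st (dfn_ren inl deta))).
- move=> e he; pose h : tup := e \o inl; pose b : tup := e \o inr.
  have T0 := dfn_true i.
  have sh : stab t h.
    apply: (stab_closed st tF) => Q dQ hQ.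
    have [|//] := he (fun e => Q (e \o inl) /\ True).
    exists Q, (fun=> True); split=> //; split; first exact: T0.
    exact: (largeT kpS.1).
  have kX X : dfn i X -> large (kap s) X -> X b.
    move=> dX kX; have [|//] := he (fun e => True /\ X (e \o inr)).
    by exists (fun=> True), X; split=> //; split=> //; exact: T0.
  have sb : stab t b.
    apply: (stab_kap (s := s)); split=> [|Z dZ kZ].
      by apply: kX; [exact: dfn_sat|exact: (largeT kpS.1)].
    apply: (kX (fun x => Z (esum x (@venv L U)))) => //.
    apply: dfn_ext (dfn_sub (esum inl (fun v : void => match v with end)) dZ) => x.
    match goal with |- Z ?a <-> Z ?b => suff -> : a = b by [] end.
    by apply: funext => -[].
  have [Gh _] := sh; have [Gb _] := sb.
  by split=> //; apply: heta; apply: (stab_gop st tF).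
have kZ := Zpt_step hz.
have [m mM [Xm Zm]] := Sfs_large kpS (large_and kpS.1 kX kZ).
have [e [h [The hM hh pat]]] := gl _ (Zm mM) Th eta' dTh ThE deta' heta'.
have [Gh _] := hM; have [Gm _] := mM.
exists e, (gop h m); split=> //.
- exact: (GM_gop st).
- by have [_ _] : Gam (esum h m) by apply: QG.
- by rewrite (gopA st Gh Gm Gz) (gopC st Gm Gz).
Qed.

(** Both sets are treated at once: at stage l, points with truth value S l extend the pattern, and
    the others are limits of such points. *)
Lemma all_good (l : nat) (s : bool) (z : tup) : Zpt s z -> good l z.
Proof.
elim: l s z => [|l IH] s z hz; first exact: good0.
have [b bS] : exists b : bool, b <-> S l.
  by have [h|h] := pselect (S l); [exists true|exists false].
have ext z' : Zpt b z' -> good l.+1 z'.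
  by move=> hz'; apply: (good_extend hz' bS); apply: IH hz'.
have [e|ne] := eqVneq s b; first by apply: ext; rewrite -e.
apply: (good_limit hz) => z' hz'; apply: ext; move: hz'.
by case: (s) ne; case: (b).
Qed.

Lemma dfn_pattern (P : Type) (f : P -> U) (l : nat) :
  dfn f (fun e : ('I_n + 'I_kd) + seqvar l -> U => pattern (e \o inl) (e \o inr)).
Proof.
elim: l => [|l IH]; first exact: dfn_true.
apply: dfn_and; first exact: (dfn_ren (smap id inl) IH).
apply: dfn_iff_const.
pose h : 'I_n + ('I_n + 'I_kd) -> ('I_n + 'I_kd) + seqvar l.+1 :=
  esum (fun x => inr (inr x)) inl.
apply: dfn_ext (dfn_ren h (dfn_mulr st (dfn_sat f psi))) => e.
suff -> : e \o h = esum ((e \o inr) \o inr) (e \o inl) by [].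
by apply: funext => -[].
Qed.

(** If no (y, d) had the pattern along the Morley sequence, a formula over M true of the sequence
    would say so, but [good] realizes that formula together with the pattern. As d need not lie in
    M, it is quantified together with y. *)
Lemma pattern_morley (z : tup) (s : bool) (l : nat) : Zpt s z ->
  exists yd, pattern yd (morley l).
Proof.
move=> hz; apply: contrapT => none.
have [|||e [h [nP _ _ pat]]] := @all_good l s z hz
   (fun e => ~ exists yd : 'I_n + 'I_kd -> U, pattern yd e) (fun=> True) _ none.
- exact: (dfn_not (dfn_ex (dfn_pattern i l))).
- exact: dfn_true.
- by [].
by apply: nP; exists (esum (gop h z) d).
Qed.

End Kernel.
Arguments morley {t} tF l _.

(* If phi is in u but not in k, every finite pattern of truth values of phi(x y, d)
   is realized along a Morley sequence of t, so x, y, d witness IP. *)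
Lemma kernel_trivial (T : theory L) (t u k k' : gtype G U) :
  NIP T -> model_of T U -> strong_right_f_generic MU t -> Sfs u -> Sfs k -> Sfs k' ->
  op k k' = u -> op k u = k -> op k' k = u -> op k' u = k' -> op t k = t -> op t k' = t ->
  (forall theta, ~ u theta ->
    exists (W : finType) (Y : ('I_n + W -> U) -> Prop) (w : W -> U),
    [/\ dfn i Y, large t (fun x => Y (esum x w)) & forall X : (W -> U) -> Prop,
      dfn i X -> X w -> exists m : W -> M, X (i \o m) /\
        forall a : tup, GM i a -> Y (esum a (i \o m)) -> ~ psat a theta]) ->
  k = u.
Proof.
move=> nip mT tF uS kS k'S kk' ku k'k k'u tk tk' uF.
apply/esym; apply: (tp_eq uS.1 kS.1) => phi0 uphi; apply: contrapT => kphi.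
have [kd [psi [d e]]] := inst_ex phi0; rewrite e in uphi kphi.
have Z1 : Zpt u k k' psi d true (gone st).
  by split; [exact: GM_one|rewrite !(rt_one st); [|exact: kS.1|exact: uS.1]].
pose a (l : nat) : tup := morley_next tF (morley tF l).
have main (S : set nat) : exists yd : 'I_n + 'I_kd -> U,
    forall l, mulr (fun e => sat e psi) (esum (a l) yd) <-> S l.
  (* The finite patterns given by S are increasingly strong conditions; saturation over the whole
     Morley sequence gives one (y, d) for all of them. *)
  have [|||yd hyd] := realize st (fun x : nat * 'I_n => a x.1 x.2)
      (V := ('I_n + 'I_kd)%type)
      (D := [set Q | exists l, Q = fun yd => pattern psi S yd (morley tF l)]).
  - exact: (small_countable st).
  - have mono l l' yd : (l <= l')%N -> pattern psi S yd (morley tF l') ->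
        pattern psi S yd (morley tF l).
      by move=> /subnK <-; elim: (l' - l) => [//|r IH] [/IH].
    move=> _ _ [l ->] [l' ->].
    exists (fun yd => pattern psi S yd (morley tF (maxn l l'))); first by exists (maxn l l').
    by move=> yd h; split; apply: mono h; rewrite ?leq_maxl ?leq_maxr.
  - by move=> _ [l ->]; apply: (pattern_morley tF uS kS k'S kk' ku k'k k'u tk tk' uF S l Z1).
  exists yd => l.
  apply: (hyd (fun yd => pattern psi S yd (morley tF l.+1))
    (fun yd => mulr (fun e => sat e psi) (esum (a l) yd) <-> S l)).
  - by exists l.+1.
  - apply: dfn_iff_const.
    pose h : 'I_n + ('I_n + 'I_kd) -> ('I_n + 'I_kd) + (nat * 'I_n) :=
      esum (fun x => inr (l, x)) inl.
    apply: dfn_ext (dfn_sub h (dfn_mulr st (dfn_sat _ psi))) => yd'.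
    match goal with |- mulr _ ?x <-> mulr _ ?y => suff -> : x = y by [] end.
    by apply: funext => -[].
  - by move=> yd' [].
(* IP is witnessed by a formula without parameters, in x on one side and the pair (y, d) on the
   other. *)
have [Phi hPhi] := dfn_mulr st (dfn_sat (@venv L U) psi).
pose V : finType := ('I_n + 'I_kd)%type.
pose h (s : ('I_n + V) + void) : 'I_n + 'I_#|V| := match s with
  | inl (inl x) => inl x | inl (inr v) => inr (enum_rank v)
  | inr v => match v with end end.
have /choice[yd hyd] := main.
apply: (nip U mT _ _ (fmap h Phi)); exists a, (fun S => yd S \o enum_val) => l S.
rewrite sat_fmap -hyd -hPhi.
match goal with |- sat ?x _ <-> sat ?y _ => suff -> : x = y by [] end.
by apply: funext => -[[x|v]|[]] //=; rewrite enum_rankK.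
Qed.

End Kernel.

(** * Ellis subgroups *)

Section Main.
Context (L : language) (kappa : Type) (U M : structure L) (i : M -> U)
  (G : group_formulas L).
Context (st : setting kappa i G).
Local Notation n := (gdim G).
Local Notation tup := (tuples G U).
Local Notation Gp := (@Gpts L G U).
Local Notation gop := (@gop L G U).
Local Notation gopp := (@gopp L G U).
Local Notation dG := (st_group st).
Local Notation MU := (range i).
Local Notation Sinv := (@S_inv L G U MU).
Local Notation Sfs := (@S_fs L G U MU).
Local Notation op := (@newelski L G U MU).
Local Notation rt := (@right_translate L G U).
Context (N' : structure L) (N : set N') (j : U -> N').
Hypothesis sp : saturated_pair_extension MU N j.
Local Notation F := (@F_M L G U MU N' N j).

Section Ideal.
Context (I : set (gtype G U)) (u : gtype G U).
Hypotheses (mI : minimal_left_ideal op Sfs I) (Iu : I u) (uu : op u u = u).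

Lemma ideal_Sfs (x : gtype G U) : I x -> Sfs x.
Proof. by have [[_ h _] _] := mI; apply: h. Qed.

Lemma ideal_Sinv (x : gtype G U) : I x -> Sinv x.
Proof. by move=> /ideal_Sfs/Sfs_inv. Qed.

Lemma ideal_op (x y : gtype G U) : Sfs x -> I y -> I (op x y).
Proof. by have [[_ _ h] _] := mI; apply: h. Qed.

(** By minimality, as S^fs * k is a left ideal contained in I. *)
Lemma ideal_generated (k : gtype G U) : I k -> I = [set op s k | s in Sfs].
Proof.
move=> Ik; apply/esym/mI.2; last by move=> _ [s sS <-]; apply: ideal_op.
split; first by exists (op u k), u; first exact: ideal_Sfs.
  by move=> _ [s sS <-]; apply/ideal_Sfs/ideal_op.
move=> x _ xS [s sS <-]; exists (op x s); first exact: (S_fs_op st).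
by rewrite (opA st) //; [exact: Sfs_inv|exact: Sfs_inv|exact: ideal_Sinv].
Qed.

Lemma ideal_op_idem (x : gtype G U) : I x -> op x u = x.
Proof.
rewrite (ideal_generated Iu) => -[s sS <-].
by rewrite (opA st) ?uu//; [exact: Sfs_inv|exact: ideal_Sinv|exact: ideal_Sinv].
Qed.

(** Writing u = y * k, the element u * y * u is a left inverse of k. *)
Lemma ideal_inverse (k : gtype G U) : I k -> op u k = k ->
  exists k', [/\ I k', op u k' = k' & op k' k = u].
Proof.
move=> Ik uk; have uS := ideal_Sinv Iu; have kS := ideal_Sinv Ik.
have : I u by []; rewrite {1}(ideal_generated Ik) => -[y yf yk].
have yS := Sfs_inv yf.
have uyf : Sfs (op u y) := S_fs_op st (ideal_Sfs Iu) yf.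
have uyS := Sfs_inv uyf.
exists (op (op u y) u); split; first exact: ideal_op.
  by rewrite -(opA st uS uyS uS) -(opA st uS uS yS) uu.
by rewrite (opA st uyS uS kS) uk (opA st uS yS kS) yk uu.
Qed.

Lemma ideal_rt (x : gtype G U) (m : tup) : I x -> GM i m -> I (rt x m).
Proof.
move=> Ix mM; rewrite -(op_tpM st mM (ideal_Sfs Ix).1).
by apply: ideal_op => //; apply: tpM_Sfs.
Qed.

End Ideal.

Section Iso.
Context (T : theory L) (I : set (gtype G U)) (u t : gtype G U).
Hypotheses (mT : model_of T U) (nip : NIP T).
Hypotheses (mI : minimal_left_ideal op Sfs I) (Iu : I u) (uu : op u u = u).
Hypotheses (tF : strong_right_f_generic MU t) (Ft : F t = u).
Hypothesis reps : forall g, Gp g -> exists2 m, GM i m & rt t g = rt t m.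
Local Notation tS := (Fr_Sinv tF).
Local Notation uS := (ideal_Sinv mI Iu).

(** As u and t agree over M, t * u = t * t = t.m for some m in G(M). Idempotence of u gives t.m =
    (t.m).m, and cancelling m yields t.m = t. *)
Lemma op_Fr_retract : op t u = t /\ op t t = t.
Proof.
have [b hb] := rlz_ex st uS.1 (@venv L U) (small_countable st void).
have hb' : rlz i t (@venv L U) b.
  by apply: (rlz_F st sp tS); rewrite Ft //; exact: uS.1.
have tu := op_Fr st tF uS.1 hb.
have [m mM bm] := reps hb.1.
suff tm : t = rt t m by rewrite tu (op_Fr st tF tS.1 hb') bm -tm.
apply: (rt_cancel st tS.1 (S_G_rt st tS.1 mM.1) mM.1).
rewrite -{1}bm -tu -{1}uu -(opA st tS uS uS) [in LHS]tu bm (op_rt_l st tS uS.1 mM).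
by rewrite tu bm.
Qed.

Lemma retract_rt (m : tup) : GM i m -> F (rt t m) = rt u m.
Proof.
move=> mM; apply/seteqP; rewrite -Ft.
by split=> theta; [move=> /(F_rt st sp _ tS mM)|move=> h; apply/(F_rt st sp _ tS mM)].
Qed.

(** The left inverse k' of k is also a right inverse, because k' has a left inverse k2 and k2 = k.
    This supplies the relations that [kernel_trivial] requires. *)
Lemma ideal_kernel (k : gtype G U) : I k -> op u k = k -> op t k = t -> k = u.
Proof.
move=> Ik uk tk; have [k' [Ik' uk' k'k]] := ideal_inverse mI Iu uu Ik uk.
have [k2 [Ik2 uk2 k2k']] := ideal_inverse mI Iu uu Ik' uk'.
have kS := ideal_Sinv mI Ik; have k'S := ideal_Sinv mI Ik'; have k2S := ideal_Sinv mI Ik2.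
have kk2 : k2 = k.
  by rewrite -(ideal_op_idem mI Iu uu Ik2) -k'k -(opA st k2S k'S kS) k2k' uk.
have kk' : op k k' = u by rewrite -{1}kk2.
have tk' : op t k' = t.
  by rewrite -{1}tk (opA st tS kS k'S) kk' op_Fr_retract.1.
apply: (@kernel_trivial _ _ _ _ _ _ st T t u k k') => //.
- exact: (ideal_Sfs mI Iu).
- exact: (ideal_Sfs mI Ik).
- exact: (ideal_Sfs mI Ik').
- exact: (ideal_op_idem mI Iu uu Ik).
- exact: (ideal_op_idem mI Iu uu Ik').
- by move=> theta; rewrite -Ft => /(F_out st sp _ tS).
Qed.

Lemma ideal_orbit : op u @` I = orbitM i u.
Proof.
apply/seteqP; split=> [_ [x Ix <-]|_ [m mM <-]]; last first.
  exists (rt u m); first exact: (ideal_rt mI Iu mM).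
  by rewrite (op_rt_r st uS uS.1 mM) uu.
have xS := ideal_Sinv mI Ix; have uxI := ideal_op mI (ideal_Sfs mI Iu) Ix.
have uxS := ideal_Sinv mI uxI.
have [m mM tx] := op_Fr_ex st tF reps uxS.1.
have Gm := mM.1; have m'M := GM_opp st mM; have Gm' := m'M.1.
(* Since t * (u * x) = t.m, translating u * x back by the inverse of m gives an element fixing t. *)
have ku : rt (op u x) (gopp m) = u.
  apply: ideal_kernel; first exact: (ideal_rt mI uxI m'M).
    by rewrite (op_rt_r st uS uxS.1 m'M) -(opA st uS uS xS) uu.
  by rewrite (op_rt_r st tS uxS.1 m'M) tx (rt_rt st tS.1)// (gopV st Gm) (rt_one st tS.1).
exists m => //; rewrite -[X in rt X m]ku.
by rewrite (rt_rt st uxS.1)// (gopVl st Gm) (rt_one st uxS.1).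
Qed.

Lemma retract_iso : group_isomorphism op op (op t @` Sinv) (op u @` I) F.
Proof.
have [tu tt] := op_Fr_retract.
rewrite (op_Fr_orbit st tF reps) ideal_orbit; split.
- exact: (orbit_group st tS tt).
- exact: (orbit_group st uS uu).
- split.
  + by move=> _ [m mM <-]; rewrite retract_rt//; exists m.
  + move=> x y; rewrite !in_setE => -[m mM <-] [m' m'M <-]; rewrite !retract_rt// => e.
    (* Left multiplication by t recovers t.m from u.m, because t * u = t. *)
    by rewrite -tu -(op_rt_r st tS uS.1 mM) -(op_rt_r st tS uS.1 m'M) e.
  + by move=> _ [m mM <-]; exists (rt t m); [exists m|exact: retract_rt].
- move=> _ _ [m mM <-] [m' m'M <-]; have mm'M := GM_gop st mM m'M.
  by rewrite (op_orbit st tS tt mM m'M) !retract_rt// (op_orbit st uS uu mM m'M).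
Qed.

End Iso.
End Main.

Theorem theorem4p16 (L : language) (T : theory L)
  (kappa : Type) (U : structure L) (M : structure L) (i : M -> U)
  (G : group_formulas L) (G00 : set (tuples G U))
  (N' : structure L) (N : set N') (j : U -> N')
  (I : set (gtype G U)) (u t : gtype G U) :
  let MU := range i in
  let Sinv := @S_inv L G U MU in
  let Sfs := @S_fs L G U MU in
  let op := @newelski L G U MU in
  let Fr := @strong_right_f_generic L G U MU in
  let F := @F_M L G U MU N' N j in
  let K := @K_M L G U MU N' N j in
  model_of T U -> monster kappa U ->
  elementary i -> kappa_small kappa MU ->
  definable_group G U ->
  saturated_pair_extension MU N j ->
  NIP T -> gabelian G U ->
  is_G00 kappa G00 ->
  (forall g, Gpts g -> exists m : tuples G U,
     [/\ Gpts m, forall k, MU (m k) & coset G00 g m]) ->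
  minimal_left_ideal op Sfs I -> I `<=` F @` Fr ->
  I u -> op u u = u ->
  Fr t -> F t = u ->
  [/\ ellis_subgroup op Sinv (op t @` Sinv),
      ellis_subgroup op Sfs (op u @` I)
    & group_isomorphism op op (op t @` Sinv) (op u @` I) F] /\
  [/\ ellis_subgroup op Sinv (op (inv_type t) @` Sinv),
      ellis_subgroup op Sfs (op u @` I)
    & group_isomorphism op op (op (inv_type t) @` Sinv) (op u @` I) K].
Proof.
move=> MU Sinv Sfs op Fr F K mT mon eli smM dG sp nip abG hG00 hrep mI _ Iu uu tF Ft.
have st : setting kappa i G by [].
have reps t' (t'F : Fr t') := G00_rep st t'F hG00 hrep.
have tS := Fr_Sinv tF; have t'F : Fr (inv_type t) := inv_Fr st tF.
have t'S := Fr_Sinv t'F.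
have [tu tt] := op_Fr_retract st sp mI Iu uu tF Ft (reps _ tF).
have t't' : op (inv_type t) (inv_type t) = inv_type t.
  by rewrite /op -(inv_op st tS tS) [newelski _ _ _]tt.
have ellu : ellis_subgroup op Sfs (op u @` I) by exists I, u.
have iso := retract_iso st sp mT nip mI Iu uu tF Ft (reps _ tF).
have ellt' := Fr_ellis st t'F t't' (reps _ t'F).
split; split=> //; first exact: (Fr_ellis st tF tt (reps _ tF)).
(* K is F after inversion, and inversion carries the group of t^-1 isomorphically onto that of t. *)
have [grt gru [Fmap Finj Fsurj] Fop] := iso.
have inv_mem x : Sinv x -> Sinv (inv_type x) by exact: (inv_Sinv st).
have mem_inv x : (op (inv_type t) @` Sinv) x -> (op t @` Sinv) (inv_type x).
  move=> [q qS <-]; exists (inv_type q); first exact: inv_mem.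
  by rewrite /op (inv_op st t'S qS) (inv_typeK st tS.1).
have mem_Sinv x : (op (inv_type t) @` Sinv) x -> Sinv x.
  by move=> [q qS <-]; apply: (S_inv_op st t'S qS.1 qS.2).
split=> //.
- by rewrite (op_Fr_orbit st t'F (reps _ t'F)); apply: (orbit_group st t'S t't').
- split.
  + by move=> x /mem_inv; apply: Fmap.
  + move=> x y; rewrite !in_setE => xE yE e.
    have : inv_type x = inv_type y.
      by apply: Finj => //; rewrite in_setE; apply: mem_inv.
    move=> /(congr1 (@inv_type L G U)).
    by rewrite !(inv_typeK st)//; [case: (mem_Sinv _ yE)|case: (mem_Sinv _ xE)].
  + move=> y /Fsurj[x [q qS <-] <-]; have tqS := S_inv_op st tS qS.1 qS.2.
    exists (inv_type (op t q)); last by rewrite /K /K_M (inv_typeK st tqS.1).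
    by exists (inv_type q); [exact: inv_mem|rewrite /op (inv_op st tS qS)].
- move=> x y xE yE; have xS := mem_Sinv _ xE; have yS := mem_Sinv _ yE.
  rewrite /K /K_M /op (inv_op st xS yS); apply: Fop; exact: mem_inv.
Qed.
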